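(* Let $\beta>0$ and let $g=\phi^2 g_{flat}\in C_\beta$ be a Riemannian metric on the flat Klein bottle $K_\beta$ ($\phi$ smooth positive). Then $\alpha_{sys}(K,C_\beta)=\alpha_{sys}(K_\beta,g_\beta)$ and $$\frac{\|\phi-P_{\phi_\beta}(\phi)\|_{L^2}^2}{\mathrm{sys}^2(K_\beta,g)}\le\alpha_{sys}(K_\beta,g)-\alpha_{sys}(K,C_\beta).$$ In particular, $\alpha_{sys}(K_\beta,g)=\alpha_{sys}(K,C_\beta)$ holds if and only if $g$ is a constant multiple of $g_\beta=\phi_\beta^2 g_{flat}$.
   Context: For $\beta>0$ let $\Gamma_\beta$ be the group generated by the Euclidean isometries $A(x,y)=(x+\pi,-y)$ and $B(x,y)=(x,y+4\beta)$; $K_\beta=\mathbb{R}^2/\Gamma_\beta$ with induced flat metric $g_{flat}$; functions on $K_\beta$ are identified with $\Gamma_\beta$-invariant functions on $\mathbb{R}^2$. $C_\beta$ is the conformal class of $g_{flat}$ (Riemannian metrics $\phi^2g_{flat}$, $\phi$ smooth positive). For a (possibly only continuous) conformal metric $\psi^2g_{flat}$: lengths $\int\psi(\gamma)|\gamma'|_{g_{flat}}dt$, area $\int\psi^2d\mathrm{vol}_{g_{flat}}$, $\mathrm{sys}$ = infimum of lengths of noncontractible closed curves, $\alpha_{sys}=\mathrm{area}/\mathrm{sys}^2$, and $\alpha_{sys}(K,C_\beta)=\inf_{g\in C_\beta}\alpha_{sys}(K_\beta,g)$. Let $\phi_0(y)=\frac{2e^y}{1+e^{2y}}$, $\beta_0=\log(1+\sqrt2)$,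 $\beta_1=\log(2+\sqrt3)$. Define $\phi_\beta$ on $y\in[0,\beta]$: if $\beta\le\pi/4$, $\phi_\beta\equiv\frac{\pi}{4\beta}$; if $\pi/4<\beta<\beta_0$, $\phi_\beta(y)=\phi_0(y)$ for $y\le s_\beta$ and $\phi_0(s_\beta)$ for $y>s_\beta$, where $s_\beta$ is the unique $s\in(0,\beta)$ with $\int_0^s\phi_0+(\beta-s)\phi_0(s)=\pi/4$; if $\beta_0\le\beta\le\beta_1$, $\phi_\beta=\phi_0$; if $\beta>\beta_1$, $\phi_\beta=\phi_0$ on $[0,\beta_1]$ and $\frac12$ on $(\beta_1,\beta]$. Extend $\phi_\beta$ to $\mathbb{R}$ by $\phi_\beta(y)=\phi_\beta(-y)=\phi_\beta(y+2\beta)$ and to $K_\beta$ as a function independent of $x$ (a continuous positive function). $g_\beta=\phi_\beta^2g_{flat}$ and $P_{\phi_\beta}(\phi)=\frac{(\phi,\phi_\beta)_{L^2}}{(\phi_\beta,\phi_\beta)_{L^2}}\phi_\beta$, the orthogonal projection onto $\mathbb{R}\phi_\beta$ in $L^2(K_\beta,g_{flat})$. *)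

(* Defs.v *)
From Stdlib Require Import Reals ClassicalEpsilon.
From Coquelicot Require Import Coquelicot.
Open Scope R_scope.

Definition pt := (R * R)%type.

Definition isoA (p : pt) : pt := (fst p + PI, - snd p).
Definition isoAinv (p : pt) : pt := (fst p - PI, - snd p).
Definition isoB (beta : R) (p : pt) : pt := (fst p, snd p + 4 * beta).
Definition isoBinv (beta : R) (p : pt) : pt := (fst p, snd p - 4 * beta).

Inductive in_Gamma (beta : R) : (pt -> pt) -> Prop :=
| Gamma_id : in_Gamma beta (fun p => p)
| Gamma_A g : in_Gamma beta g -> in_Gamma beta (fun p => isoA (g p))
| Gamma_Ainv g : in_Gamma beta g -> in_Gamma beta (fun p => isoAinv (g p))
| Gamma_B g : in_Gamma beta g -> in_Gamma beta (fun p => isoB beta (g p))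
| Gamma_Binv g : in_Gamma beta g -> in_Gamma beta (fun p => isoBinv beta (g p)).

(* Functions on K_beta = Gamma_beta-invariant functions on R^2. *)
Definition Gamma_invariant (beta : R) (f : pt -> R) : Prop :=
  forall g, in_Gamma beta g -> forall p, f (g p) = f p.

Definition dx (f : pt -> R) : pt -> R :=
  fun p => Derive (fun x => f (x, snd p)) (fst p).
Definition dy (f : pt -> R) : pt -> R :=
  fun p => Derive (fun y => f (fst p, y)) (snd p).

Fixpoint Ck (n : nat) (f : pt -> R) : Prop :=
  match n with
  | O => forall p : pt, continuous f p
  | S m => (forall p : pt, continuous f p) /\
           (forall p : pt, ex_derive (fun x => f (x, snd p)) (fst p) /\
                           ex_derive (fun y => f (fst p, y)) (snd p)) /\
           Ck m (dx f) /\ Ck m (dy f)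
  end.

Definition smooth (f : pt -> R) : Prop := forall n, Ck n f.

(* Conformal factors phi of metrics phi^2 g_flat in C_beta. *)
Definition conf_factor (beta : R) (phi : pt -> R) : Prop :=
  smooth phi /\ (forall p, 0 < phi p) /\ Gamma_invariant beta phi.

(* Integration over K_beta w.r.t. g_flat: integral over the fundamental
   domain [0,pi] x [0,4 beta] of the Gamma_beta action. *)
Definition intK (beta : R) (f : pt -> R) : R :=
  RInt (fun x => RInt (fun y => f (x, y)) 0 (4 * beta)) 0 PI.

Definition L2dot (beta : R) (f g : pt -> R) : R := intK beta (fun p => f p * g p).

Definition area (beta : R) (psi : pt -> R) : R := intK beta (fun p => psi p ^ 2).

(* Curves: C^1 maps t |-> (c1 t, c2 t) (only t in [0,1] matters). *)
Definition C1_curve (c1 c2 : R -> R) : Prop :=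
  (forall t, ex_derive c1 t /\ ex_derive c2 t) /\
  (forall t, continuous (Derive c1) t /\ continuous (Derive c2) t).

(* A noncontractible closed curve in K_beta, lifted to R^2: a path from
   p to g p for some non-identity deck transformation g in Gamma_beta. *)
Definition noncontractible_loop (beta : R) (c1 c2 : R -> R) : Prop :=
  C1_curve c1 c2 /\
  exists g, in_Gamma beta g /\ g <> (fun p => p) /\ (c1 1, c2 1) = g (c1 0, c2 0).

Definition curve_length (psi : pt -> R) (c1 c2 : R -> R) : R :=
  RInt (fun t => psi (c1 t, c2 t) *
                 sqrt (Derive c1 t ^ 2 + Derive c2 t ^ 2)) 0 1.

Definition sys (beta : R) (psi : pt -> R) : R :=
  real (Glb_Rbar (fun L => exists c1 c2,
          noncontractible_loop beta c1 c2 /\ L = curve_length psi c1 c2)).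

Definition alpha_sys (beta : R) (psi : pt -> R) : R :=
  area beta psi / (sys beta psi) ^ 2.

Definition alpha_sys_C (beta : R) : Rbar :=
  Glb_Rbar (fun a => exists phi, conf_factor beta phi /\ a = alpha_sys beta phi).

Definition phi0 (y : R) : R := 2 * exp y / (1 + exp (2 * y)).
Definition beta0 : R := ln (1 + sqrt 2).
Definition beta1 : R := ln (2 + sqrt 3).

Definition s_beta (beta : R) : R :=
  epsilon (inhabits 0) (fun s => 0 < s < beta /\
     RInt phi0 0 s + (beta - s) * phi0 s = PI / 4).

(* phi_beta on [0,beta] *)
Definition phi_beta_base (beta y : R) : R :=
  if Rle_dec beta (PI / 4) then PI / (4 * beta)
  else if Rlt_dec beta beta0 then
    (if Rle_dec y (s_beta beta) then phi0 y else phi0 (s_beta beta))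
  else if Rle_dec beta beta1 then phi0 y
  else (if Rle_dec y beta1 then phi0 y else 1 / 2).

(* even, 2 beta-periodic extension to R *)
Definition phi_beta_ext (beta y : R) : R :=
  let t := y - 2 * beta * IZR (Int_part (y / (2 * beta))) in
  phi_beta_base beta (Rmin t (2 * beta - t)).

Definition phi_beta (beta : R) : pt -> R := fun p => phi_beta_ext beta (snd p).

Definition proj_phi_beta (beta : R) (phi : pt -> R) : pt -> R :=
  fun p => L2dot beta phi (phi_beta beta) / L2dot beta (phi_beta beta) (phi_beta beta)
           * phi_beta beta p.

(* Main.v *)
Require Import Defs.
From Stdlib Require Import Reals Lra Lia ZArith ClassicalEpsilon FunctionalExtensionality.
From Coquelicot Require Import Coquelicot.
Open Scope R_scope.

(** Suppose a family of noncontractible loops, weighted by a measure of total mass [M],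
    sweeps out [phi_beta] times the flat area.  Integrating [phi] along these loops gives
    [(phi, phi_beta) >= M * sys phi], with equality for [phi = phi_beta] if all loops of the
    family have minimal length for [phi_beta].  By Pythagoras,
    [area phi = |phi - P phi|^2 + (phi, phi_beta)^2 / |phi_beta|^2], and the stability
    inequality follows.

    In Mercator coordinates [phi0 = 1 / cosh] is the conformal factor of the round sphere, and
    the isometry [A] sends a point to its antipode.  On [[0, beta]] one has
    [phi_beta = max (phi0, c)] for a constant [c].  The loops are half great circles
    [sinh y = a sin (x - x0)] around the two invariant circles [y = 0] and [y = 2 beta],
    completed by vertical loops (small [beta]) or by horizontal double loops (large [beta]).
    The weight of the great circles solves an Abel equation; the solution is verified by
    exchanging two coordinate axes in an integral over the sphere.

    Conversely all loops have [phi_beta]-length at least [PI]: a loop that acts like an odd power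
    of [A] is folded into the band [|y| <= beta], where it joins two antipodal points.
    Finally [phi_beta], a function of [cos (PI y / beta)], is a uniform limit of trigonometric
    polynomials, so its value of [alpha_sys] is the infimum over smooth conformal factors. *)

(** * Continuous functions and their integrals *)

(** The weight of the great circles is forced. Vertical loops contribute a constant [c] at every
    height, so the semicircles have to produce [phi0 - c] on [[0, s]]; their weight is nonnegative
    because [c <= phi0 s]. Horizontal loops are used on [[s, beta]] only, so next to them the
    semicircles have to produce all of [phi0]. The thresholds are lengths: a vertical loop has
    length [PI] when [phi_beta] has integral [PI / 4] over [[0, beta]], a double horizontal loop
    when [phi_beta = 1 / 2].

    Abel's kernel has an inverse square root singularity. Polar coordinates on a sphere replace the
    improper integrals by integrals of continuous functions over a rectangle; the exchange of axes
    becomes the symmetry of a bilinear form, which Weierstrass approximation reduces to monomials.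

    In the lower bounds for lengths, folding is only Lipschitz, and the distance from a point of the
    sphere is not differentiable at that point and its antipode, where the folded loops begin and
    end. Hence gradients are replaced by local slopes and the distance by smooth functions close to
    it. *)

Definition cont {U : UniformSpace} (f : U -> R) : Prop := forall x, continuous f x.

Lemma cont_const {U : UniformSpace} (c : R) : cont (fun _ : U => c).
Proof. intros x; apply continuous_const. Qed.
Lemma cont_id : cont (fun x : R => x).
Proof. intros x; apply continuous_id. Qed.
Lemma cont_fst : cont (fun p : pt => fst p).
Proof. intros x; apply continuous_fst. Qed.
Lemma cont_snd : cont (fun p : pt => snd p).
Proof. intros x; apply continuous_snd. Qed.
Lemma cont_plus {U : UniformSpace} (f g : U -> R) :
  cont f -> cont g -> cont (fun x => f x + g x).
Proof. intros Hf Hg x; apply (continuous_plus f g x (Hf x) (Hg x)). Qed.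
Lemma cont_minus {U : UniformSpace} (f g : U -> R) :
  cont f -> cont g -> cont (fun x => f x - g x).
Proof. intros Hf Hg x; apply (continuous_minus f g x (Hf x) (Hg x)). Qed.
Lemma cont_opp {U : UniformSpace} (f : U -> R) : cont f -> cont (fun x => - f x).
Proof. intros Hf x; apply (continuous_opp f x (Hf x)). Qed.
Lemma cont_mult {U : UniformSpace} (f g : U -> R) :
  cont f -> cont g -> cont (fun x => f x * g x).
Proof. intros Hf Hg x; apply (continuous_mult f g x (Hf x) (Hg x)). Qed.
Lemma cont_pow {U : UniformSpace} (f : U -> R) n : cont f -> cont (fun x => f x ^ n).
Proof.
  intros Hf; induction n as [|n IH]; simpl.
  - apply cont_const.
  - apply cont_mult; assumption.
Qed.
Lemma cont_comp {U : UniformSpace} (h : R -> R) (f : U -> R) :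
  cont h -> cont f -> cont (fun x => h (f x)).
Proof. intros Hh Hf x; apply (continuous_comp f h); [apply Hf | apply Hh]. Qed.
Lemma cont_comp2 {U : UniformSpace} (f : pt -> R) (u v : U -> R) :
  cont f -> cont u -> cont v -> cont (fun x => f (u x, v x)).
Proof.
  intros Hf Hu Hv x.
  apply (continuous_comp_2 u v (fun a b => f (a, b)) x (Hu x) (Hv x)).
  apply continuous_ext with f; [intros [a b]; reflexivity | apply Hf].
Qed.
Lemma cont_inv {U : UniformSpace} (f : U -> R) :
  cont f -> (forall x, f x <> 0) -> cont (fun x => / f x).
Proof.
  intros Hf H x; apply (continuous_comp f Rinv); [apply Hf|].
  apply continuous_Rinv, H.
Qed.
Lemma cont_div {U : UniformSpace} (f g : U -> R) :
  cont f -> cont g -> (forall x, g x <> 0) -> cont (fun x => f x / g x).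
Proof. intros Hf Hg H; apply cont_mult; [assumption | apply cont_inv; assumption]. Qed.
Lemma cont_sqrt {U : UniformSpace} (f : U -> R) : cont f -> cont (fun x => sqrt (f x)).
Proof. intros Hf; apply (cont_comp sqrt); [intros x; apply continuous_sqrt | exact Hf]. Qed.
Lemma cont_sin {U : UniformSpace} (f : U -> R) : cont f -> cont (fun x => sin (f x)).
Proof. intros Hf; apply (cont_comp sin); [intros x; apply continuous_sin | exact Hf]. Qed.
Lemma cont_cos {U : UniformSpace} (f : U -> R) : cont f -> cont (fun x => cos (f x)).
Proof. intros Hf; apply (cont_comp cos); [intros x; apply continuous_cos | exact Hf]. Qed.
Lemma cont_exp {U : UniformSpace} (f : U -> R) : cont f -> cont (fun x => exp (f x)).
Proof. intros Hf; apply (cont_comp exp); [intros x; apply continuous_exp | exact Hf]. Qed.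
Lemma cont_Rabs {U : UniformSpace} (f : U -> R) : cont f -> cont (fun x => Rabs (f x)).
Proof. intros Hf; apply (cont_comp Rabs); [intros x; apply continuous_Rabs | exact Hf]. Qed.
Lemma cont_ex_derive (f : R -> R) : (forall x, ex_derive f x) -> cont f.
Proof. intros H x; apply (@ex_derive_continuous R_AbsRing R_NormedModule), H. Qed.
Lemma cont_ext {U : UniformSpace} (f g : U -> R) :
  (forall x, f x = g x) -> cont f -> cont g.
Proof. intros E Hf x; apply continuous_ext with f; [exact E | apply Hf]. Qed.
Lemma Rmax_Rabs x y : Rmax x y = (x + y + Rabs (x - y)) / 2.
Proof. unfold Rmax, Rabs; destruct (Rle_dec x y), (Rcase_abs (x - y)); lra. Qed.
Lemma cont_Rmax {U : UniformSpace} (f g : U -> R) :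
  cont f -> cont g -> cont (fun x => Rmax (f x) (g x)).
Proof.
  intros Hf Hg; apply cont_ext with (fun x => (f x + g x + Rabs (f x - g x)) / 2).
  - intros x; symmetry; apply Rmax_Rabs.
  - apply cont_div; [|apply cont_const|intros _; lra].
    apply cont_plus; [apply cont_plus; assumption|].
    apply cont_Rabs, cont_minus; assumption.
Qed.
Lemma cont_arcsinh {U : UniformSpace} (f : U -> R) : cont f -> cont (fun x => arcsinh (f x)).
Proof.
  intros Hf; apply (cont_comp arcsinh); [|exact Hf].
  apply cont_ex_derive; intros x; eexists.
  apply is_derive_Reals, derivable_pt_lim_arcsinh.
Qed.

(** Integrands are kept continuous on their whole space, so that integrability is a syntactic check;
    nonvanishing denominators remain as goals. *)
Ltac cont_tac := repeat (lazymatch goal with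
  | |- cont (fun _ => ?c) => apply cont_const
  | |- cont (fun x => x) => apply cont_id
  | |- cont (fun x => fst x) => apply cont_fst
  | |- cont (fun x => snd x) => apply cont_snd
  | |- cont (fun x => @?f x + @?g x) => apply (cont_plus f g)
  | |- cont (fun x => @?f x - @?g x) => apply (cont_minus f g)
  | |- cont (fun x => @?f x * @?g x) => apply (cont_mult f g)
  | |- cont (fun x => @?f x / @?g x) => apply (cont_div f g)
  | |- cont (fun x => - @?f x) => apply (cont_opp f)
  | |- cont (fun x => / @?f x) => apply (cont_inv f)
  | |- cont (fun x => @?f x ^ ?n) => apply (cont_pow f n)
  | |- cont (fun x => sqrt (@?f x)) => apply (cont_sqrt f)
  | |- cont (fun x => sin (@?f x)) => apply (cont_sin f)
  | |- cont (fun x => cos (@?f x)) => apply (cont_cos f)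
  | |- cont (fun x => exp (@?f x)) => apply (cont_exp f)
  | |- cont (fun x => Rabs (@?f x)) => apply (cont_Rabs f)
  | |- cont (fun x => Rmax (@?f x) (@?g x)) => apply (cont_Rmax f g)
  | |- cont (fun x => arcsinh (@?f x)) => apply (cont_arcsinh f)
  | H : cont ?h |- cont ?h => exact H
  | H : cont ?h |- cont (fun x => ?h (@?u x, @?v x)) => apply (cont_comp2 h u v); [exact H| |]
  | H : cont ?h |- cont (fun x => ?h (@?u x)) => apply (cont_comp h u); [exact H|]
  | _ => assumption
  end; cbv beta).

(** An equality between integrals may be typed in the carrier of a normed module, which [ring] and
    [field] do not recognise; it is restated in [R]. *)
Ltac inR := match goal with |- ?a = ?b => change (@eq R a b) end; apply Rminus_diag_uniq.

Lemma exI (f : R -> R) a b : cont f -> ex_RInt f a b.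
Proof. intros H; apply (ex_RInt_continuous (V := R_CompleteNormedModule)); intros z _; apply H. Qed.

Lemma I_plus (f g : R -> R) a b : cont f -> cont g ->
  RInt (fun x => f x + g x) a b = RInt f a b + RInt g a b.
Proof. intros Hf Hg; apply (RInt_plus f g); apply exI; assumption. Qed.
Lemma I_minus (f g : R -> R) a b : cont f -> cont g ->
  RInt (fun x => f x - g x) a b = RInt f a b - RInt g a b.
Proof. intros Hf Hg; apply (RInt_minus f g); apply exI; assumption. Qed.
Lemma I_scal c (f : R -> R) a b : cont f ->
  RInt (fun x => c * f x) a b = c * RInt f a b.
Proof. intros Hf; apply (RInt_scal f); apply exI; assumption. Qed.
Lemma I_const c a b : RInt (fun _ : R => c) a b = (b - a) * c.
Proof. apply (RInt_const (V := R_CompleteNormedModule)). Qed.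
Lemma I_ext (f g : R -> R) a b : a <= b ->
  (forall x, a <= x <= b -> f x = g x) -> RInt f a b = RInt g a b.
Proof.
  intros Hab H; apply RInt_ext; intros x.
  rewrite Rmin_left, Rmax_right by assumption; intros; apply H; lra.
Qed.
Lemma I_le (f g : R -> R) a b : a <= b -> cont f -> cont g ->
  (forall x, a <= x <= b -> f x <= g x) -> RInt f a b <= RInt g a b.
Proof. intros; apply RInt_le; auto using exI; intros; apply H2; lra. Qed.
Lemma I_ge0 (f : R -> R) a b : a <= b -> cont f ->
  (forall x, a <= x <= b -> 0 <= f x) -> 0 <= RInt f a b.
Proof.
  intros Hab Hf H.
  replace 0 with (RInt (fun _ : R => 0) a b) by (rewrite I_const; apply Rmult_0_r).
  apply I_le; auto using @cont_const.
Qed.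
Lemma I_chasles (f : R -> R) a b c : cont f ->
  RInt f a b + RInt f b c = RInt f a c.
Proof. intros; apply (RInt_Chasles f); apply exI; assumption. Qed.
Lemma I_comp (f g dg : R -> R) a b : cont f -> cont dg ->
  (forall x, is_derive g x (dg x)) ->
  RInt (fun y => dg y * f (g y)) a b = RInt f (g a) (g b).
Proof. intros Hf Hdg Hg; apply (RInt_comp f g dg); auto. Qed.
Lemma I_shift (f : R -> R) v a b : cont f ->
  RInt (fun x => f (x + v)) a b = RInt f (a + v) (b + v).
Proof.
  intros Hf.
  rewrite <- (I_comp f (fun x => x + v) (fun _ => 1)); cont_tac.
  - apply RInt_ext; intros; inR; ring.
  - intros x; auto_derive; [exact I | ring].
Qed.
Lemma I_swap (f : R -> R) a b : cont f -> RInt f b a = - RInt f a b.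
Proof. intros Hf; symmetry; apply (opp_RInt_swap f), exI, Hf. Qed.
Lemma I_refl (f : R -> R) v a b : cont f ->
  RInt (fun x => f (v - x)) a b = RInt f (v - b) (v - a).
Proof.
  intros Hf.
  rewrite (I_swap f (v - a)) by assumption.
  rewrite <- (I_comp f (fun x => v - x) (fun _ => -1)); cont_tac.
  - rewrite I_scal by cont_tac. inR; ring.
  - intros x; auto_derive; [exact I | ring].
Qed.
Lemma I_derive (f df : R -> R) a b : (forall x, is_derive f x (df x)) -> cont df ->
  RInt df a b = f b - f a.
Proof.
  intros Hf Hdf; apply is_RInt_unique.
  apply (is_RInt_derive f df); intros; [apply Hf | apply Hdf].
Qed.
Lemma derive_I (f : R -> R) a x : cont f -> is_derive (fun t => RInt f a t) x (f x).
Proof.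
  intros Hf; apply (is_derive_RInt f _ a x).
  - apply filter_forall; intros t; apply (RInt_correct (V := R_CompleteNormedModule)), exI, Hf.
  - apply Hf.
Qed.

Lemma cont_2d (f : pt -> R) : cont f -> forall x y, continuity_2d_pt (fun u v => f (u, v)) x y.
Proof.
  intros Hf x y; apply continuity_2d_pt_filterlim.
  apply continuous_ext with (f := f) (g := fun z => f (fst z, snd z)) (x := (x, y)).
  - intros [a b]; reflexivity.
  - apply Hf.
Qed.

Lemma cont_param (f : pt -> R) a b : cont f -> cont (fun y : R => RInt (fun x => f (x, y)) a b).
Proof.
  assert (W : forall (f : pt -> R) a b, a <= b -> cont f ->
    cont (fun y : R => RInt (fun x => f (x, y)) a b)).
  { clear; intros f a b Hab Hf y.
    apply continuity_pt_filterlim; intros eps Heps.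
    (* The summand 1 keeps the estimate strict and covers [a = b]. *)
    assert (He : 0 < eps / (b - a + 1)) by (apply Rdiv_lt_0_compat; lra).
    destruct (uniform_continuity_2d (fun u v => f (u, v)) a b (y - 1) (y + 1)
      (fun u v _ _ => cont_2d f Hf u v) (mkposreal _ He)) as [d Hd]; simpl in Hd.
    exists (Rmin d 1); split; [apply Rmin_pos; [apply d | lra]|].
    intros z [_ Hz]; unfold dist in *; simpl in *; unfold Rdist in *.
    assert (Hz1 := Rlt_le_trans _ _ _ Hz (Rmin_l _ _)).
    assert (Hz2 := Rlt_le_trans _ _ _ Hz (Rmin_r _ _)).
    rewrite <- I_minus by cont_tac.
    apply Rle_lt_trans with ((b - a) * (eps / (b - a + 1))).
    - apply (abs_RInt_le_const (fun x => f (x, z) - f (x, y)) a b _ Hab).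
      + apply exI; cont_tac.
      + intros t Ht. apply Rlt_le, (Hd t y t z); try lra.
        * apply Rabs_def2 in Hz2; lra.
        * rewrite Rminus_diag, Rabs_R0; apply d.
    - apply Rmult_lt_reg_r with (b - a + 1); [lra|].
      field_simplify; [|lra]. nra. }
  intros Hf; destruct (Rle_dec a b) as [H|H]; [apply W; assumption|].
  apply cont_ext with (fun y => - RInt (fun x => f (x, y)) b a).
  - intros y; rewrite I_swap by cont_tac; inR; ring.
  - apply cont_opp, W; [lra | assumption].
Qed.

Lemma cont_param2 (f : pt -> R) a b : cont f -> cont (fun x : R => RInt (fun y => f (x, y)) a b).
Proof.
  intros Hf; apply (cont_param (fun p => f (snd p, fst p))).
  cont_tac.
Qed.

(** As functions of the upper limit [d], both sides have as derivative the integral of [f] along a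
    horizontal segment, and both vanish at [d = c]. *)
Lemma fubini (f : pt -> R) a b c d : cont f ->
  RInt (fun x => RInt (fun y => f (x, y)) c d) a b =
  RInt (fun y => RInt (fun x => f (x, y)) a b) c d.
Proof.
  intros Hf.
  assert (D1 : forall t, is_derive (fun t => RInt (fun x => RInt (fun y => f (x, y)) c t) a b) t
     (RInt (fun x => f (x, t)) a b)).
  { intros t.
    assert (E : forall x u, is_derive (fun z => RInt (fun y => f (x, y)) c z) u (f (x, u))).
    { intros x u; apply (derive_I (fun y => f (x, y))); cont_tac. }
    replace (RInt (fun x => f (x, t)) a b) with
      (RInt (fun x => Derive (fun z => RInt (fun y => f (x, y)) c z) t) a b).
    2:{ apply RInt_ext; intros x _; apply is_derive_unique, E. }
    apply (is_derive_RInt_param (fun z x => RInt (fun y => f (x, y)) c z)).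
    - apply filter_forall; intros z x _; eexists; apply E.
    - intros x _; apply continuity_2d_pt_ext with (f := fun u v => f (v, u)).
      + intros u v; symmetry; apply is_derive_unique, E.
      + apply (cont_2d (fun p => f (snd p, fst p))); cont_tac.
    - apply filter_forall; intros z; apply exI, cont_param2, Hf. }
  assert (D2 := I_derive _ _ c d D1 (cont_param f a b Hf)).
  etransitivity; [|symmetry; exact D2].
  assert (Z : RInt (fun x => RInt (fun y => f (x, y)) c c) a b = 0).
  { etransitivity; [|apply (Rmult_0_r (b - a))]; rewrite <- I_const.
    apply RInt_ext; intros x _; apply (RInt_point (V := R_CompleteNormedModule)). }
  cbv beta; rewrite Z; symmetry; apply Rminus_0_r.
Qed.

(** * Bernstein polynomials and an integral over the sphere *)

Lemma I_abs_le (f g : R -> R) a b : a <= b -> cont f -> cont g ->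
  (forall x, a <= x <= b -> Rabs (f x) <= g x) -> Rabs (RInt f a b) <= RInt g a b.
Proof.
  intros Hab Hf Hg H; apply Rabs_le; split.
  - apply Rle_trans with (RInt (fun x => -1 * g x) a b).
    + rewrite I_scal by assumption. apply Req_le; inR; ring.
    + apply I_le; cont_tac; intros x Hx; specialize (H x Hx); apply Rabs_le_between in H; lra.
  - apply I_le; cont_tac; intros x Hx; specialize (H x Hx); apply Rabs_le_between in H; lra.
Qed.

(* [bern n g x] is the expectation of [g] under the binomial law with
   parameters [n], [x]; in [x] it is the Bernstein polynomial with nodal values [g k]. *)
Fixpoint bern (n : nat) (g : nat -> R) (x : R) : R :=
  match n with
  | O => g O
  | S m => x * bern m (fun k => g (S k)) x + (1 - x) * bern m g x
  end.

Lemma bern_le n : forall g h x, 0 <= x <= 1 ->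
  (forall k, (k <= n)%nat -> g k <= h k) -> bern n g x <= bern n h x.
Proof.
  induction n as [|n IH]; intros g h x Hx H; simpl; [apply H; lia|].
  assert (H1 := IH (fun k => g (S k)) (fun k => h (S k)) x Hx).
  assert (H2 := IH g h x Hx).
  apply Rplus_le_compat; apply Rmult_le_compat_l; try lra.
  - apply H1; intros k Hk; apply H; lia.
  - apply H2; intros k Hk; apply H; lia.
Qed.

Lemma bern_ext n : forall g h x, (forall k, g k = h k) -> bern n g x = bern n h x.
Proof.
  induction n as [|n IH]; intros g h x E; simpl; [apply E|].
  rewrite (IH _ _ x E), (IH (fun k => g (S k)) (fun k => h (S k)) x); [reflexivity|].
  intros k; apply E.
Qed.

(** Variance plus squared bias of a binomial variable. The free centre [c] makes the induction
    close, since a success shifts it to [c - 1]. *)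
Lemma bern_quadratic n : forall a b c x,
  bern n (fun k => a + b * (INR k - c) ^ 2) x =
  a + b * (INR n * x * (1 - x) + (INR n * x - c) ^ 2).
Proof.
  induction n as [|n IH]; intros a b c x; [simpl; ring|].
  change (x * bern n (fun k => a + b * (INR (S k) - c) ^ 2) x
          + (1 - x) * bern n (fun k => a + b * (INR k - c) ^ 2) x =
          a + b * (INR (S n) * x * (1 - x) + (INR (S n) * x - c) ^ 2)).
  rewrite IH, S_INR.
  replace (bern n (fun k => a + b * (INR (S k) - c) ^ 2) x)
    with (bern n (fun k => a + b * (INR k - (c - 1)) ^ 2) x).
  - rewrite IH; ring.
  - apply bern_ext; intros k; rewrite S_INR; ring.
Qed.

(** Chebyshev's argument: [g] lies between two parabolas around [fx], the operator is monotone, and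
    the variance is at most [n]. The quadratic term in the hypothesis lets each application supply
    its own modulus of continuity. *)
Lemma bern_approx n g x fx eps K : 0 <= x <= 1 -> (0 < n)%nat -> 0 <= K ->
  (forall k, (k <= n)%nat -> Rabs (fx - g k) <= eps + K * (INR k / INR n - x) ^ 2) ->
  Rabs (fx - bern n g x) <= eps + K / INR n.
Proof.
  intros Hx Hn HK H.
  assert (HN : 0 < INR n) by (apply lt_0_INR; exact Hn).
  assert (V : K / INR n ^ 2 * (INR n * x * (1 - x) + (INR n * x - INR n * x) ^ 2) <= K / INR n).
  { replace (K / INR n ^ 2 * (INR n * x * (1 - x) + (INR n * x - INR n * x) ^ 2))
      with (K / INR n * (x * (1 - x))) by (field; lra).
    rewrite <- (Rmult_1_r (K / INR n)) at 2; apply Rmult_le_compat_l; [|nra].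
    apply Rdiv_le_0_compat; assumption. }
  assert (U : forall k, K * (INR k / INR n - x) ^ 2 = K / INR n ^ 2 * (INR k - INR n * x) ^ 2).
  { intros k; field; lra. }
  assert (H1 := bern_le n g (fun k => fx + eps + K / INR n ^ 2 * (INR k - INR n * x) ^ 2) x Hx).
  assert (H2 := bern_le n
    (fun k => fx - eps + - (K / INR n ^ 2) * (INR k - INR n * x) ^ 2) g x Hx).
  rewrite bern_quadratic in H1, H2.
  apply Rabs_le; split.
  - enough (bern n g x <= fx + eps + K / INR n) by lra.
    eapply Rle_trans; [apply H1|lra].
    intros k Hk; specialize (H k Hk); rewrite U in H; apply Rabs_le_between in H; lra.
  - enough (fx - eps - K / INR n <= bern n g x) by lra.
    eapply Rle_trans; [|apply H2]; [lra|].
    intros k Hk; specialize (H k Hk); rewrite U in H; apply Rabs_le_between in H; lra.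
Qed.

Lemma cont_continuity_pt (f : R -> R) : cont f -> forall x, continuity_pt f x.
Proof. intros H x; apply continuity_pt_filterlim, H. Qed.

Lemma archimed_div K eps : 0 < eps -> exists n, (0 < n)%nat /\ K / INR n <= eps.
Proof.
  intros He; destruct (INR_unbounded (Rabs K / eps)) as [n Hn].
  assert (H0 : 0 <= Rabs K / eps) by (apply Rdiv_le_0_compat; [apply Rabs_pos | lra]).
  assert (Hp : 0 < INR n) by lra.
  exists n; split; [apply INR_lt; simpl; lra|].
  apply Rmult_le_reg_r with (INR n); [lra|].
  replace (K / INR n * INR n) with K by (field; lra).
  apply Rle_trans with (Rabs K); [apply Rle_abs|].
  replace (Rabs K) with (eps * (Rabs K / eps)) by (field; lra).
  apply Rmult_le_compat_l; lra.
Qed.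

Lemma weierstrass (f : R -> R) eps : cont f -> 0 < eps ->
  exists n g, forall x, 0 <= x <= 1 -> Rabs (f x - bern n g x) <= eps.
Proof.
  intros Hf He.
  assert (He2 : 0 < eps / 2) by lra.
  destruct (@Heine_cor2 f 0 1 (fun x _ => cont_continuity_pt f Hf x) (mkposreal _ He2))
    as [d Hd]; simpl in Hd.
  destruct (continuity_ab_maj (fun x => Rabs (f x)) 0 1 Rle_0_1) as [m [Hm _]].
  { intros c _; apply (cont_continuity_pt (fun x => Rabs (f x))); cont_tac. }
  set (M := Rabs (f m)) in *.
  assert (HM : 0 <= M) by apply Rabs_pos.
  assert (dp := cond_pos d).
  (* With this constant the parabola exceeds the trivial bound [2 * M] wherever uniform continuity
     gives nothing, at distance at least [d]. *)
  set (K := 2 * M / d ^ 2).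
  assert (HK : 0 <= K) by (apply Rdiv_le_0_compat; [lra | apply pow_lt; lra]).
  destruct (archimed_div K (eps / 2) He2) as [n [Hn HKn]].
  exists n, (fun k => f (INR k / INR n)); intros x Hx.
  apply Rle_trans with (eps / 2 + K / INR n); [|lra].
  apply bern_approx; auto.
  intros k Hk.
  assert (HN : 0 < INR n) by (apply lt_0_INR; exact Hn).
  assert (Hk1 : 0 <= INR k / INR n <= 1).
  { split; [apply Rdiv_le_0_compat; [apply pos_INR | lra]|].
    apply Rmult_le_reg_r with (INR n); [lra|].
    replace (INR k / INR n * INR n) with (INR k) by (field; lra).
    rewrite Rmult_1_l; apply le_INR; exact Hk. }
  set (z := INR k / INR n) in *.
  assert (P : 0 <= K * (z - x) ^ 2) by (apply Rmult_le_pos; [exact HK | apply pow2_ge_0]).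
  destruct (Rlt_dec (Rabs (x - z)) d) as [L|L].
  - specialize (Hd x z Hx Hk1 L); lra.
  - apply Rle_trans with (K * (z - x) ^ 2); [|lra].
    apply Rle_trans with (2 * M).
    + assert (A := Hm x Hx); assert (B := Hm z Hk1); cbv beta in A, B.
      unfold Rminus; eapply Rle_trans; [apply Rabs_triang|]; rewrite Rabs_Ropp; unfold M in *; lra.
    + apply Rle_trans with (K * d ^ 2); [apply Req_le; unfold K; field; lra|].
      apply Rmult_le_compat_l; [exact HK|].
      rewrite <- (pow2_abs (z - x)), Rabs_minus_sym.
      apply pow_incr; lra.
Qed.

(** The arguments are functions on all of [R], but the norm only sees [[0, 1]]; so such a functional
    depends only on the restriction to [[0, 1]]. *)
Definition bounded_linear (L : (R -> R) -> R) : Prop :=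
  (forall f g : R -> R, cont f -> cont g -> L (fun x => f x + g x) = L f + L g) /\
  (forall c (f : R -> R), cont f -> L (fun x => c * f x) = c * L f) /\
  exists M, forall (f g : R -> R) eps, cont f -> cont g ->
    (forall x, 0 <= x <= 1 -> Rabs (f x - g x) <= eps) -> Rabs (L f - L g) <= M * eps.

Lemma bounded_linear_ext L f g : bounded_linear L -> cont f -> cont g ->
  (forall x, 0 <= x <= 1 -> f x = g x) -> L f = L g.
Proof.
  intros [_ [_ [M HM]]] Hf Hg E.
  apply Rminus_diag_uniq, Rabs_eq_0, Rle_antisym; [|apply Rabs_pos].
  rewrite <- (Rmult_0_r M); apply HM; auto.
  intros x Hx; rewrite E by assumption; rewrite Rminus_diag, Rabs_R0; lra.
Qed.

Lemma cont_bern n : forall g, cont (bern n g).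
Proof.
  induction n as [|n IH]; intros g; simpl; [apply cont_const|].
  assert (H1 := IH g); assert (H2 := IH (fun k => g (S k))); cont_tac.
Qed.

Lemma bounded_linear_eq L1 L2 : bounded_linear L1 -> bounded_linear L2 ->
  (forall k, L1 (fun x => x ^ k) = L2 (fun x => x ^ k)) ->
  forall f, cont f -> L1 f = L2 f.
Proof.
  intros B1 B2 Hmon f Hf.
  (* The factor [x ^ i] strengthens the induction, because each step of the Bernstein recursion
     multiplies by [x] or [1 - x]. *)
  assert (P : forall n g i, L1 (fun x => x ^ i * bern n g x) = L2 (fun x => x ^ i * bern n g x)).
  { induction n as [|n IH]; intros g i.
    - assert (S : forall L, bounded_linear L ->
        L (fun x => x ^ i * bern 0 g x) = g O * L (fun x => x ^ i)).
      { intros L HL; destruct HL as [A [B C]] eqn:E.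
        rewrite <- B by cont_tac.
        apply bounded_linear_ext; [exact HL | simpl; cont_tac | cont_tac|].
        intros x _; simpl; ring. }
      rewrite !S, Hmon by assumption; reflexivity.
    - assert (C1 := cont_bern n g); assert (C2 := cont_bern n (fun k => g (S k))).
      assert (S : forall L, bounded_linear L ->
        L (fun x => x ^ i * bern (S n) g x) =
        (L (fun x => x ^ S i * bern n (fun k => g (S k)) x) + L (fun x => x ^ i * bern n g x))
        + -1 * L (fun x => x ^ S i * bern n g x)).
      { intros L HL; destruct HL as [A [B C]] eqn:E.
        set (f1 := fun x => x ^ S i * bern n (fun k => g (S k)) x).
        set (f2 := fun x => x ^ i * bern n g x).
        set (f3 := fun x => x ^ S i * bern n g x).
        assert (D1 : cont f1) by (unfold f1; cont_tac).
        assert (D2 : cont f2) by (unfold f2; cont_tac).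
        assert (D3 : cont f3) by (unfold f3; cont_tac).
        rewrite <- (B (-1) f3 D3), <- (A f1 f2 D1 D2).
        rewrite <- (A (fun x => f1 x + f2 x) (fun x => -1 * f3 x)) by cont_tac.
        apply bounded_linear_ext; [exact HL | | cont_tac|].
        - assert (C3 := cont_bern (S n) g); cont_tac.
        - intros x _; unfold f1, f2, f3; simpl; ring. }
      rewrite !S, !IH by assumption; reflexivity. }
  assert (Q : forall n g, L1 (bern n g) = L2 (bern n g)).
  { intros n g; assert (C1 := cont_bern n g).
    transitivity (L1 (fun x => x ^ 0 * bern n g x)).
    { apply bounded_linear_ext; auto; [cont_tac | intros x _; simpl; ring]. }
    rewrite P; apply bounded_linear_ext; auto; [cont_tac | intros x _; simpl; ring]. }
  destruct B1 as [A1 [S1 [M1 HM1]]], B2 as [A2 [S2 [M2 HM2]]].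
  apply cond_eq; intros eps He.
  set (M := Rabs M1 + Rabs M2 + 1).
  assert (a1 := Rle_abs M1); assert (a2 := Rle_abs M2).
  assert (b1 := Rabs_pos M1); assert (b2 := Rabs_pos M2).
  assert (Hd : 0 < eps / M) by (apply Rdiv_lt_0_compat; unfold M; lra).
  destruct (weierstrass f (eps / M) Hf Hd) as [n [g Hg]].
  assert (C1 := cont_bern n g).
  specialize (HM1 f (bern n g) _ Hf C1 Hg); specialize (HM2 f (bern n g) _ Hf C1 Hg).
  rewrite Q in HM1.
  replace (L1 f - L2 f) with ((L1 f - L2 (bern n g)) - (L2 f - L2 (bern n g))) by ring.
  eapply Rle_lt_trans; [apply Rabs_triang|]; rewrite Rabs_Ropp.
  apply Rle_lt_trans with (M1 * (eps / M) + M2 * (eps / M)); [lra|].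
  apply Rlt_le_trans with (M * (eps / M)).
  - rewrite <- Rmult_plus_distr_r; apply Rmult_lt_compat_r; [exact Hd | unfold M; lra].
  - apply Req_le; field; unfold M; lra.
Qed.

(** * The symmetric bilinear form on the sphere *)

Definition sphere_int (Phi k : R -> R) : R :=
  RInt (fun t => sin t * k (cos t) * RInt (fun x => Phi (sin t * sin x)) 0 PI) 0 (PI / 2).

Lemma cont_sphere_inner Phi : cont Phi -> cont (fun t : R => RInt (fun x => Phi (sin t * sin x)) 0 PI).
Proof.
  intros H; apply (cont_param2 (fun p => Phi (sin (fst p) * sin (snd p)))); cont_tac.
Qed.

Lemma sin_half_pi_bounds t : 0 <= t <= PI / 2 -> 0 <= sin t <= 1 /\ 0 <= cos t <= 1.
Proof.
  intros Ht; assert (P := PI_RGT_0).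
  repeat split; try apply SIN_bound; try apply COS_bound.
  - apply sin_ge_0; lra.
  - apply cos_ge_0; lra.
Qed.

Lemma sin_prod_bounds t x : 0 <= t <= PI / 2 -> 0 <= x <= PI -> 0 <= sin t * sin x <= 1.
Proof.
  intros Ht Hx; destruct (sin_half_pi_bounds t Ht) as [H _].
  assert (0 <= sin x <= 1) by (split; [apply sin_ge_0; lra | apply SIN_bound]).
  nra.
Qed.

Lemma bounded_linear_sphere_int_r Phi : cont Phi -> bounded_linear (sphere_int Phi).
Proof.
  intros HPhi; assert (HI := cont_sphere_inner Phi HPhi); assert (P := PI_RGT_0).
  unfold sphere_int; repeat split.
  - intros f g Hf Hg; rewrite <- I_plus by cont_tac.
    apply RInt_ext; intros; inR; ring.
  - intros c f Hf; rewrite <- I_scal by cont_tac.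
    apply RInt_ext; intros; inR; ring.
  - exists (RInt (fun t => Rabs (sin t * RInt (fun x => Phi (sin t * sin x)) 0 PI)) 0 (PI / 2)).
    intros f g eps Hf Hg H; rewrite <- I_minus, Rmult_comm, <- I_scal by cont_tac.
    apply I_abs_le; [lra | cont_tac | cont_tac |].
    intros t Ht.
    replace (sin t * f (cos t) * RInt (fun x : R => Phi (sin t * sin x)) 0 PI -
      sin t * g (cos t) * RInt (fun x : R => Phi (sin t * sin x)) 0 PI) with
      ((f (cos t) - g (cos t)) * (sin t * RInt (fun x : R => Phi (sin t * sin x)) 0 PI))
      by (inR; ring).
    rewrite Rabs_mult; apply Rmult_le_compat_r; [apply Rabs_pos|].
    apply H, sin_half_pi_bounds, Ht.
Qed.

Lemma bounded_linear_sphere_int_l k : cont k -> bounded_linear (fun Phi => sphere_int Phi k).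
Proof.
  intros Hk; assert (P := PI_RGT_0).
  unfold sphere_int; repeat split.
  - intros f g Hf Hg; assert (If := cont_sphere_inner f Hf); assert (Ig := cont_sphere_inner g Hg).
    rewrite <- I_plus by cont_tac.
    apply RInt_ext; intros; rewrite I_plus by cont_tac; inR; ring.
  - intros c f Hf; assert (If := cont_sphere_inner f Hf); rewrite <- I_scal by cont_tac.
    apply RInt_ext; intros; rewrite I_scal by cont_tac; inR; ring.
  - exists (RInt (fun t => Rabs (sin t * k (cos t)) * PI) 0 (PI / 2)).
    intros f g eps Hf Hg H; assert (If := cont_sphere_inner f Hf); assert (Ig := cont_sphere_inner g Hg).
    rewrite <- I_minus, Rmult_comm, <- I_scal by cont_tac.
    apply I_abs_le; [lra | cont_tac | cont_tac |].
    intros t Ht.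
    rewrite <- Rmult_minus_distr_l, <- I_minus, Rabs_mult by cont_tac.
    rewrite (Rmult_comm eps), Rmult_assoc.
    apply Rmult_le_compat_l; [apply Rabs_pos|].
    apply Rle_trans with (RInt (fun _ => eps) 0 PI); [|rewrite I_const; apply Req_le; ring].
    apply I_abs_le; [lra | cont_tac | cont_tac |].
    intros x Hx; apply H, sin_prod_bounds; assumption.
Qed.

Lemma cos_sqr t : cos t * cos t = 1 - sin t * sin t.
Proof. assert (E := sin2_cos2 t); unfold Rsqr in E; lra. Qed.

(** Integration by parts: the difference of the two sides is the integral of the derivative of
    [- sin ^ (p + 1) * cos ^ (q + 1)], which vanishes at [0] and [PI / 2]. *)
Lemma sin_cos_moment_sin p q :
  INR (p + q + 2) * RInt (fun t => sin t ^ (p + 2) * cos t ^ q) 0 (PI / 2) =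
  INR (p + 1) * RInt (fun t => sin t ^ p * cos t ^ q) 0 (PI / 2).
Proof.
  apply Rminus_diag_uniq; rewrite <- !I_scal, <- I_minus by cont_tac.
  rewrite (I_derive (fun t => - (sin t ^ S p * cos t ^ S q))); [| |cont_tac].
  - rewrite cos_PI2, sin_0; simpl; ring.
  - intros t; auto_derive; [exact I|].
    change (match p with 0%nat => 1 | S _ => INR p + 1 end) with (INR (S p)).
    change (match q with 0%nat => 1 | S _ => INR q + 1 end) with (INR (S q)).
    rewrite !S_INR, pow_add, !plus_INR; change (INR 2) with 2; change (INR 1) with 1.
    transitivity (- (INR p + 1) * (sin t ^ p * cos t ^ q) * (cos t * cos t)
      + (INR q + 1) * (sin t ^ p * cos t ^ q) * (sin t * sin t)); [ring|].
    rewrite cos_sqr; ring.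
Qed.

Lemma sin_cos_moment_cos p q :
  INR (p + q + 2) * RInt (fun t => sin t ^ p * cos t ^ (q + 2)) 0 (PI / 2) =
  INR (q + 1) * RInt (fun t => sin t ^ p * cos t ^ q) 0 (PI / 2).
Proof.
  assert (E : RInt (fun t => sin t ^ p * cos t ^ (q + 2)) 0 (PI / 2) =
    RInt (fun t => sin t ^ p * cos t ^ q) 0 (PI / 2)
    - RInt (fun t => sin t ^ (p + 2) * cos t ^ q) 0 (PI / 2)).
  { rewrite <- I_minus by cont_tac; apply RInt_ext; intros t _; inR.
    rewrite !pow_add; simpl.
    transitivity (sin t ^ p * cos t ^ q * (cos t * cos t - (1 - sin t * sin t))); [ring|].
    rewrite cos_sqr; ring. }
  rewrite E, Rmult_minus_distr_l, sin_cos_moment_sin, !plus_INR; simpl; inR; ring.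
Qed.

Lemma sin_moment m :
  INR (m + 2) * RInt (fun x => sin x ^ (m + 2)) 0 PI =
  INR (m + 1) * RInt (fun x => sin x ^ m) 0 PI.
Proof.
  apply Rminus_diag_uniq; rewrite <- !I_scal, <- I_minus by cont_tac.
  rewrite (I_derive (fun t => - (sin t ^ S m * cos t))); [| |cont_tac].
  - rewrite sin_PI, sin_0; simpl; ring.
  - intros t; auto_derive; [exact I|].
    change (match m with 0%nat => 1 | S _ => INR m + 1 end) with (INR (S m)).
    rewrite !S_INR, pow_add, !plus_INR; change (INR 2) with 2; change (INR 1) with 1.
    transitivity (- (INR m + 1) * sin t ^ m * (cos t * cos t)
      + sin t ^ m * (sin t * sin t)); [ring|].
    rewrite cos_sqr; ring.
Qed.

Lemma sphere_int_monomial m j :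
  sphere_int (fun z => z ^ m) (fun z => z ^ j) =
  RInt (fun t => sin t ^ (m + 1) * cos t ^ j) 0 (PI / 2) * RInt (fun x => sin x ^ m) 0 PI.
Proof.
  unfold sphere_int; rewrite Rmult_comm, <- I_scal by cont_tac.
  apply RInt_ext; intros t _.
  rewrite (RInt_ext _ (fun x => sin t ^ m * sin x ^ m)).
  - rewrite I_scal, pow_add by cont_tac; inR; ring.
  - intros x _; apply Rpow_mult_distr.
Qed.

(** Both sides are multiplied by [(m + 1) / (m + j + 3)]: on the left as the product of
    [(m + 2) / (m + j + 3)] and [(m + 1) / (m + 2)], on the right at once. *)
Lemma sphere_int_monomial_step m j :
  sphere_int (fun z => z ^ m) (fun z => z ^ j) = sphere_int (fun z => z ^ j) (fun z => z ^ m) ->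
  sphere_int (fun z => z ^ (m + 2)) (fun z => z ^ j) =
  sphere_int (fun z => z ^ j) (fun z => z ^ (m + 2)).
Proof.
  rewrite !sphere_int_monomial; intros H.
  assert (A := sin_cos_moment_sin (m + 1) j); assert (B := sin_moment m).
  assert (C := sin_cos_moment_cos (j + 1) m).
  replace (m + 1 + 2)%nat with (m + 2 + 1)%nat in A by lia.
  replace (INR (m + 1 + j + 2)) with (INR m + 1 + INR j + (1 + 1)) in A
    by (rewrite !plus_INR; reflexivity).
  replace (INR (j + 1 + m + 2)) with (INR m + 1 + INR j + (1 + 1)) in C
    by (rewrite !plus_INR; simpl; ring).
  replace (INR (m + 1 + 1)) with (INR m + 1 + 1) in A by (rewrite !plus_INR; reflexivity).
  replace (INR (m + 2)) with (INR m + (1 + 1)) in B by (rewrite !plus_INR; reflexivity).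
  replace (INR (m + 1)) with (INR m + 1) in B, C by (rewrite !plus_INR; reflexivity).
  assert (pm := pos_INR m); assert (pj := pos_INR j).
  apply Rmult_eq_reg_l with ((INR m + 1 + INR j + (1 + 1)) * (INR m + (1 + 1))); [|nra].
  transitivity (((INR m + 1 + INR j + (1 + 1)) *
    RInt (fun t => sin t ^ (m + 2 + 1) * cos t ^ j) 0 (PI / 2)) *
    ((INR m + (1 + 1)) * RInt (fun x => sin x ^ (m + 2)) 0 PI)); [inR; ring|].
  rewrite A, B.
  transitivity ((INR m + 1 + 1) * (INR m + 1) *
    (RInt (fun t => sin t ^ (m + 1) * cos t ^ j) 0 (PI / 2) * RInt (fun x => sin x ^ m) 0 PI));
    [inR; ring|].
  rewrite H.
  transitivity ((INR m + (1 + 1)) * RInt (fun x => sin x ^ j) 0 PI *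
    ((INR m + 1) * RInt (fun t => sin t ^ (j + 1) * cos t ^ m) 0 (PI / 2))); [inR; ring|].
  rewrite <- C; inR; ring.
Qed.

Lemma sphere_int_monomial_sym m j :
  sphere_int (fun z => z ^ m) (fun z => z ^ j) = sphere_int (fun z => z ^ j) (fun z => z ^ m).
Proof.
  (* Among exponents 0 and 1 this is the only case with content; both sides equal [PI / 2]. *)
  assert (E10 : sphere_int (fun z => z ^ 1) (fun z => z ^ 0) =
                sphere_int (fun z => z ^ 0) (fun z => z ^ 1)).
  { rewrite !sphere_int_monomial.
    assert (A := sin_cos_moment_sin 0 0).
    assert (B : RInt (fun x => sin x ^ 1) 0 PI = 2).
    { rewrite (I_derive (fun x => - cos x)); [| |cont_tac].
      - rewrite cos_PI, cos_0; lra.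
      - intros x; auto_derive; [exact I | ring]. }
    assert (C : RInt (fun t => sin t ^ (0 + 1) * cos t ^ 1) 0 (PI / 2) = / 2).
    { rewrite (I_derive (fun t => sin t ^ 2 / 2)); [| |cont_tac].
      - rewrite sin_PI2, sin_0; lra.
      - intros x; auto_derive; [exact I | simpl; field]. }
    assert (D : RInt (fun x => sin x ^ 0) 0 PI = PI) by (simpl; rewrite I_const; ring).
    assert (D' : RInt (fun t => sin t ^ 0 * cos t ^ 0) 0 (PI / 2) = PI / 2)
      by (simpl; rewrite I_const; ring).
    rewrite B, C, D; rewrite D' in A.
    change (1 + 1)%nat with (0 + 2)%nat; simpl in A |- *.
    change (RInt (fun t => sin t * (sin t * 1) * 1) 0 (PI / 2) * 2 = / 2 * PI).
    lra. }
  assert (base : forall m j, (m <= 1)%nat -> (j <= 1)%nat ->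
    sphere_int (fun z => z ^ m) (fun z => z ^ j) = sphere_int (fun z => z ^ j) (fun z => z ^ m)).
  { intros [|[|a]] [|[|b]] Ha Hb; try lia; auto. }
  assert (two : forall (P : nat -> Prop), (forall i, (i <= 1)%nat -> P i) ->
    (forall i, P i -> P (i + 2)%nat) -> forall i, P i).
  { intros P H0 H2 i; enough (P i /\ P (S i)) by tauto.
    induction i as [|i [IH1 IH2]]; [split; apply H0; lia|].
    split; [exact IH2|]; specialize (H2 i IH1); replace (S (S i)) with (i + 2)%nat by lia; exact H2. }
  revert m; apply (two (fun m => sphere_int (fun z => z ^ m) (fun z => z ^ j) =
    sphere_int (fun z => z ^ j) (fun z => z ^ m))); [|intros i; apply sphere_int_monomial_step].
  intros m Hm; revert j; apply (two (fun j => sphere_int (fun z => z ^ m) (fun z => z ^ j) =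
    sphere_int (fun z => z ^ j) (fun z => z ^ m))); [intros; apply base; assumption|].
  intros j H; symmetry; apply sphere_int_monomial_step; symmetry; exact H.
Qed.

(* [sphere_int Phi k] is the integral of [Phi n3 * k n1] over a quarter of the unit
   sphere in polar coordinates around the first axis; the reflection exchanging the
   first and third axes preserves area. *)
Lemma sphere_int_sym Phi k : cont Phi -> cont k -> sphere_int Phi k = sphere_int k Phi.
Proof.
  intros HPhi Hk; revert k Hk.
  apply (bounded_linear_eq (sphere_int Phi) (fun k => sphere_int k Phi));
    [apply bounded_linear_sphere_int_r, HPhi | apply bounded_linear_sphere_int_l, HPhi |].
  intros j; revert Phi HPhi.
  apply (bounded_linear_eq (fun Phi => sphere_int Phi (fun x => x ^ j)) (sphere_int (fun x => x ^ j)));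
    [apply bounded_linear_sphere_int_l; cont_tac | apply bounded_linear_sphere_int_r; cont_tac |].
  intros m; apply sphere_int_monomial_sym.
Qed.

(** * Great circles *)

(** With [s = sin x] and [c = cos x], the quotient [n / D] is the tangent of the difference between
    [atan (k * tan x)] and [x]. It has no poles, as [D > 0]. The identity computes the derivative of
    the resulting primitive; [n'] and [D'] are the derivatives of [n] and [D]. *)
Lemma atan_tan_deriv_identity s c k : s * s + c * c = 1 -> 0 < k ->
  let n := (k - 1) * (s * c) in
  let D := c * c + k * (s * s) in
  let n' := (k - 1) * (c * c - s * s) in
  let D' := 2 * (k - 1) * (s * c) in
  (1 + (n' * D - n * D') / D ^ 2 / (1 + (n / D) ^ 2)) / k = / (1 + (k ^ 2 - 1) * (s * s)).
Proof.
  intros E Hk n D n' D'.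
  assert (E2 : c * c = 1 - s * s) by lra.
  assert (Hs : 0 <= s * s) by nra; assert (Hc : 0 <= c * c) by nra.
  assert (HD : 0 < D) by (unfold D; nra).
  assert (HQ : 0 < 1 + (k ^ 2 - 1) * (s * s)).
  { replace (1 + (k ^ 2 - 1) * (s * s)) with (c * c + k ^ 2 * (s * s)) by lra.
    assert (0 < k ^ 2) by nra.
    destruct (Req_dec (s * s) 0) as [Z|Z]; [rewrite Z; lra|].
    assert (0 < k ^ 2 * (s * s)) by (apply Rmult_lt_0_compat; lra). lra. }
  assert (A : D ^ 2 + n ^ 2 = 1 + (k ^ 2 - 1) * (s * s)).
  { unfold D, n.
    replace ((c * c + k * (s * s)) ^ 2 + ((k - 1) * (s * c)) ^ 2) with
      ((c * c + k * (s * s)) ^ 2 + (k - 1) ^ 2 * (s * s) * (c * c)) by ring.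
    rewrite E2; ring. }
  assert (B : n' * D - n * D' = (k - 1) * (c * c - k * (s * s))).
  { unfold D, n, D', n'.
    replace ((k - 1) * (c * c - s * s) * (c * c + k * (s * s)) - (k - 1) * (s * c) * (2 * (k - 1) * (s * c)))
    with ((k - 1) * ((c * c - s * s) * (c * c + k * (s * s)) - 2 * (k - 1) * (s * s) * (c * c))) by ring.
    rewrite E2; ring. }
  replace ((n' * D - n * D') / D ^ 2 / (1 + (n / D) ^ 2)) with ((n' * D - n * D') / (D ^ 2 + n ^ 2)).
  2:{ field. repeat split; nra. }
  rewrite A, B, E2. field; split; lra.
Qed.

Lemma RInt_inv_one_plus_sin2 u : -1 < u ->
  RInt (fun x => / (1 + u * sin x ^ 2)) 0 PI = PI / sqrt (1 + u).
Proof.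
  intros Hu; set (k := sqrt (1 + u)).
  assert (Hk : 0 < k) by (apply sqrt_lt_R0; lra).
  assert (Ek : k ^ 2 = 1 + u) by (unfold k; rewrite pow2_sqrt; lra).
  assert (Hb : forall x, 0 <= sin x ^ 2 <= 1).
  { intros x; assert (H := SIN_bound x); nra. }
  (* [x + atan (...)] is a smooth branch of [atan (k * tan x)]. *)
  rewrite (I_derive (fun x => (x + atan ((k - 1) * (sin x * cos x) /
    (cos x * cos x + k * (sin x * sin x)))) / k)).
  - assert (Z : forall a b, (k - 1) * (0 * a) / b = 0) by (intros; unfold Rdiv; ring).
    rewrite sin_PI, sin_0, !Z, atan_0; inR; field; lra.
  - intros x.
    assert (E := sin2_cos2 x); unfold Rsqr in E.
    assert (HD : 0 < cos x * cos x + k * (sin x * sin x)) by nra.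
    replace (/ (1 + u * sin x ^ 2)) with (/ (1 + (k ^ 2 - 1) * (sin x * sin x)))
      by (rewrite Ek; f_equal; ring).
    rewrite <- (atan_tan_deriv_identity (sin x) (cos x) k E Hk); cbv zeta.
    auto_derive; [lra|].
    field; repeat split; try lra.
    set (n := (k - 1) * (sin x * cos x)); nra.
  - cont_tac; intros x; specialize (Hb x); set (v := sin x ^ 2) in *.
    destruct (Rlt_dec v 1); [|replace v with 1 by lra; lra].
    assert (0 <= (1 + u) * v) by (apply Rmult_le_pos; lra); lra.
Qed.

Lemma I_period (f : R -> R) P a : cont f -> (forall x, f (x + P) = f x) ->
  RInt f a (a + P) = RInt f 0 P.
Proof.
  intros Hf HP.
  assert (E : RInt f P (a + P) = RInt f 0 a).
  { rewrite <- (Rplus_0_l P) at 1; rewrite <- I_shift by assumption.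
    apply RInt_ext; intros; apply HP. }
  assert (H1 := I_chasles f a 0 (a + P) Hf); assert (H2 := I_chasles f 0 P (a + P) Hf).
  assert (H3 := I_swap f 0 a Hf). rewrite E in H2. lra.
Qed.

Definition A_invariant (f : pt -> R) : Prop := forall x y, f (x + PI, - y) = f (x, y).

(** A lower bound for the systole in a form that can be applied to a single loop, without the
    infimum. *)
Definition loops_ge (beta : R) (f : pt -> R) (sigma : R) : Prop :=
  forall c1 c2, noncontractible_loop beta c1 c2 -> sigma <= curve_length f c1 c2.

Definition circle_int (f : pt -> R) (y : R) : R := RInt (fun x => f (x, y)) 0 (2 * PI).

Lemma cont_circle_int f : cont f -> cont (circle_int f).
Proof. intros Hf; apply cont_param, Hf. Qed.

Lemma A_invariant_2PI f x y : A_invariant f -> f (x + 2 * PI, y) = f (x, y).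
Proof.
  intros H; rewrite <- (H x y), <- (H (x + PI) (- y)), Ropp_involutive.
  f_equal; f_equal; ring.
Qed.

Lemma circle_int_shift f a y : cont f -> A_invariant f ->
  RInt (fun x => f (x + a, y)) 0 (2 * PI) = circle_int f y.
Proof.
  intros Hf HA; unfold circle_int.
  rewrite (I_shift (fun x => f (x, y))) by cont_tac.
  rewrite Rplus_0_l, Rplus_comm; apply (I_period (fun x => f (x, y))); [cont_tac|].
  intros x; apply A_invariant_2PI, HA.
Qed.

Lemma loop_of (beta : R) (c1 c2 d1 d2 : R -> R) g :
  (forall t, is_derive c1 t (d1 t)) -> (forall t, is_derive c2 t (d2 t)) ->
  cont d1 -> cont d2 -> in_Gamma beta g -> g (0, 0) <> (0, 0) ->
  (c1 1, c2 1) = g (c1 0, c2 0) ->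
  noncontractible_loop beta c1 c2 /\
  forall psi, curve_length psi c1 c2 =
    RInt (fun t => psi (c1 t, c2 t) * sqrt (d1 t ^ 2 + d2 t ^ 2)) 0 1.
Proof.
  intros H1 H2 C1 C2 Hg Hn E.
  assert (E1 : forall t, Derive c1 t = d1 t) by (intros; apply is_derive_unique, H1).
  assert (E2 : forall t, Derive c2 t = d2 t) by (intros; apply is_derive_unique, H2).
  split; [split|].
  - split; intros t; split; try (eexists; eauto; fail).
    + apply continuous_ext with d1; [intros; symmetry; apply E1 | apply C1].
    + apply continuous_ext with d2; [intros; symmetry; apply E2 | apply C2].
  - exists g; repeat split; auto; intros Z; apply Hn; rewrite Z; reflexivity.
  - intros psi; apply RInt_ext; intros t _; rewrite E1, E2; reflexivity.
Qed.

Lemma one_plus_sqr_pos x : 0 < 1 + x ^ 2.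
Proof. nra. Qed.

Lemma is_derive_arcsinh (u : R -> R) du x : is_derive u x du ->
  is_derive (fun t => arcsinh (u t)) x (du / sqrt (1 + u x ^ 2)).
Proof.
  intros H; unfold Rdiv; rewrite (Rplus_comm 1).
  apply (is_derive_comp arcsinh u x); [|exact H].
  apply is_derive_Reals, derivable_pt_lim_arcsinh.
Qed.

(* The curve is a great semicircle of the round sphere in Mercator coordinates. *)
Lemma great_circle_length beta f sigma b x0 : cont f -> loops_ge beta f sigma ->
  sigma <= RInt (fun x => f (x0 + x, arcsinh (b * sin x)) *
                 (sqrt (1 + b ^ 2) / sqrt (1 + (b * sin x) ^ 2))) 0 PI.
Proof.
  intros Hf Hs; assert (P := PI_RGT_0).
  assert (Q : forall t, 0 < sqrt (1 + (b * sin t) ^ 2))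
    by (intros; apply sqrt_lt_R0, one_plus_sqr_pos).
  assert (CD : cont (fun t => PI * (b * cos (PI * t)) / sqrt (1 + (b * sin (PI * t)) ^ 2))).
  { cont_tac; intros t; specialize (Q (PI * t)); lra. }
  destruct (loop_of beta (fun t => x0 + PI * t) (fun t => arcsinh (b * sin (PI * t)))
    (fun _ => PI) (fun t => PI * (b * cos (PI * t)) / sqrt (1 + (b * sin (PI * t)) ^ 2))
    (fun p => isoA p)) as [HL HE]; auto.
  - intros t; auto_derive; [exact I | ring].
  - intros t; apply (is_derive_arcsinh (fun t => b * sin (PI * t))).
    auto_derive; [exact I | ring].
  - cont_tac.
  - apply (Gamma_A beta (fun p => p)), Gamma_id.
  - unfold isoA; simpl; intros E; injection E; lra.
  - unfold isoA; simpl; rewrite Rmult_1_r, Rmult_0_r, sin_PI, sin_0, Rmult_0_r, arcsinh_0.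
    f_equal; ring.
  - specialize (Hs _ _ HL); rewrite HE in Hs; eapply Rle_trans; [exact Hs|].
    assert (C : cont (fun x : R => f (x0 + x, arcsinh (b * sin x)) *
                 (sqrt (1 + b ^ 2) / sqrt (1 + (b * sin x) ^ 2)))).
    { cont_tac; intros t; specialize (Q t); lra. }
    assert (R := I_comp _ (fun t => PI * t) (fun _ => PI) 0 1 C (cont_const PI)).
    cbv beta in R; rewrite Rmult_0_r, Rmult_1_r in R.
    rewrite <- R by (intros; auto_derive; [exact I | ring]).
    apply Req_le, RInt_ext; intros t _.
    set (r := 1 + (b * sin (PI * t)) ^ 2).
    assert (Hr : 0 < r) by apply one_plus_sqr_pos.
    replace (PI ^ 2 + (PI * (b * cos (PI * t)) / sqrt r) ^ 2) with (PI ^ 2 * ((1 + b ^ 2) / r)).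
    + rewrite sqrt_mult_alt, sqrt_pow2, sqrt_div_alt by nra; inR; ring.
    + unfold Rdiv; rewrite Rpow_mult_distr, pow_inv, pow2_sqrt by lra.
      assert (E := cos_sqr (PI * t)).
      replace (1 + b ^ 2) with (r + b ^ 2 * (cos (PI * t) * cos (PI * t)))
        by (rewrite E; unfold r; ring).
      field; lra.
Qed.

(** Rotating the semicircle through all [x0] leaves only the integrals of [f] over horizontal
    circles, so the remaining problem concerns one function of the height. *)
Lemma great_circle_avg beta f sigma b : cont f -> A_invariant f -> loops_ge beta f sigma ->
  2 * PI * sigma <= RInt (fun x => circle_int f (arcsinh (b * sin x)) *
                 (sqrt (1 + b ^ 2) / sqrt (1 + (b * sin x) ^ 2))) 0 PI.
Proof.
  intros Hf HA Hs; assert (P := PI_RGT_0).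
  assert (Q : forall t, 0 < sqrt (1 + (b * sin t) ^ 2))
    by (intros; apply sqrt_lt_R0, one_plus_sqr_pos).
  set (h := fun p : pt => f (fst p + snd p, arcsinh (b * sin (snd p))) *
                 (sqrt (1 + b ^ 2) / sqrt (1 + (b * sin (snd p)) ^ 2))).
  assert (C : cont h).
  { unfold h; cont_tac; intros t; apply Rgt_not_eq, Q. }
  apply Rle_trans with (RInt (fun x0 => RInt (fun x => h (x0, x)) 0 PI) 0 (2 * PI)).
  - apply Rle_trans with (RInt (fun _ => sigma) 0 (2 * PI)); [rewrite I_const; lra|].
    apply I_le; [lra | cont_tac | apply cont_param2, C |].
    intros x0 _; exact (great_circle_length beta f sigma b x0 Hf Hs).
  - rewrite fubini by assumption; apply Req_le, RInt_ext; intros x _; unfold h; cbn [fst snd].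
    rewrite <- (circle_int_shift f x) by assumption.
    rewrite (Rmult_comm (RInt (fun x1 => f (x1 + x, _)) _ _)), <- I_scal by cont_tac.
    apply RInt_ext; intros; apply Rmult_comm.
Qed.

Lemma phi0_cosh y : phi0 y = / cosh y.
Proof.
  unfold phi0, cosh; rewrite exp_Ropp.
  replace (exp (2 * y)) with (exp y * exp y) by (rewrite <- exp_plus; f_equal; ring).
  assert (H := exp_pos y); field; nra.
Qed.

Lemma cosh_pos y : 0 < cosh y.
Proof. unfold cosh; assert (H := exp_pos y); assert (H2 := exp_pos (- y)); lra. Qed.

Lemma cosh_sqr y : cosh y ^ 2 = 1 + sinh y ^ 2.
Proof.
  unfold cosh, sinh; rewrite exp_Ropp; assert (H := exp_pos y); field; lra.
Qed.

Lemma cosh_sqrt y : cosh y = sqrt (1 + sinh y ^ 2).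
Proof. rewrite <- cosh_sqr, sqrt_pow2; [reflexivity | apply Rlt_le, cosh_pos]. Qed.

Lemma phi0_arcsinh u : phi0 (arcsinh u) = / sqrt (1 + u ^ 2).
Proof. rewrite phi0_cosh, cosh_sqrt, sinh_arcsinh; reflexivity. Qed.

Lemma cont_phi0 : cont phi0.
Proof.
  unfold phi0; cont_tac; intros x; assert (H := exp_pos (2 * x)); lra.
Qed.

Lemma sinh_ge0 s : 0 <= s -> 0 <= sinh s.
Proof.
  intros [H|H]; [left; rewrite <- sinh_0; apply sinh_lt, H | rewrite <- H, sinh_0; lra].
Qed.

(* Averaging over the great circles of latitude at most [s], with the weight that the
   Abel inversion formula dictates; [sphere_int_sym] plays the role of that formula. *)
Lemma great_circle_transform (F : R -> R) s c : cont F -> 0 <= s ->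
  let a := sinh s in let C := cosh s in
  PI * C * RInt (fun y => F y * (phi0 y - c)) 0 s =
  sphere_int (fun z => F (arcsinh (a * z)) * (a / sqrt (1 + (a * z) ^ 2)))
             (fun z => C ^ 2 / (1 + a ^ 2 * Rabs (1 - z ^ 2)) - c * C).
Proof.
  intros HF Hs a C; assert (P := PI_RGT_0); assert (HC := cosh_pos s); fold C in HC.
  assert (Ha : 0 <= a) by (apply sinh_ge0, Hs).
  assert (EC : C ^ 2 = 1 + a ^ 2) by apply cosh_sqr.
  assert (Q : forall t, 0 < sqrt (1 + (a * t) ^ 2)) by (intros; apply sqrt_lt_R0, one_plus_sqr_pos).
  (* The absolute value makes the kernel continuous on all of [R]; on the range of integration
     [1 - z ^ 2] is nonnegative anyway. *)
  assert (Q2 : forall z, 0 < 1 + a ^ 2 * Rabs (1 - z ^ 2)).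
  { intros z; assert (0 <= a ^ 2 * Rabs (1 - z ^ 2)); [|lra].
    apply Rmult_le_pos; [apply pow2_ge_0 | apply Rabs_pos]. }
  rewrite sphere_int_sym.
  2:{ cont_tac; intros x; apply Rgt_not_eq, Q. }
  2:{ cont_tac; intros x; apply Rgt_not_eq, Q2. }
  unfold sphere_int.
  assert (I1 : forall t, 0 <= t <= PI / 2 ->
    RInt (fun x => C ^ 2 / (1 + a ^ 2 * Rabs (1 - (sin t * sin x) ^ 2)) - c * C) 0 PI =
    PI * C * (/ sqrt (1 + (a * cos t) ^ 2) - c)).
  { intros t Ht.
    (* Since [C ^ 2 = 1 + a ^ 2], the denominator of the kernel is [C ^ 2 * (1 + u * sin x ^ 2)],
       and the inner integral is elementary. *)
    set (u := - (a ^ 2 * sin t ^ 2 / C ^ 2)).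
    assert (Est : sin t ^ 2 = 1 - cos t ^ 2) by (assert (E := cos_sqr t); lra).
    assert (Eu : 1 + u = (1 + (a * cos t) ^ 2) / C ^ 2).
    { unfold u; rewrite EC, Est; field; nra. }
    assert (Hu : -1 < u).
    { assert (0 < 1 + u); [|lra]. rewrite Eu; apply Rdiv_lt_0_compat; [apply one_plus_sqr_pos | nra]. }
    transitivity (RInt (fun x => / (1 + u * sin x ^ 2) - c * C) 0 PI).
    - apply I_ext; [lra|]; intros x Hx.
      assert (H := sin_prod_bounds t x Ht Hx).
      rewrite Rabs_pos_eq by nra.
      f_equal; unfold u.
      replace (1 + a ^ 2 * (1 - (sin t * sin x) ^ 2)) with
         (C ^ 2 * (1 + - (a ^ 2 * sin t ^ 2 / C ^ 2) * sin x ^ 2)).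
      2:{ rewrite Rpow_mult_distr, EC; field; nra. }
      unfold Rdiv; rewrite Rinv_mult; rewrite <- Rmult_assoc, Rinv_r by nra; apply Rmult_1_l.
    - assert (C0 : cont (fun x : R => / (1 + u * sin x ^ 2))).
      { cont_tac; intros x; assert (H := SIN_bound x).
        assert (0 <= sin x ^ 2 <= 1) by nra; set (v := sin x ^ 2) in *.
        destruct (Rlt_dec v 1); [|replace v with 1 by lra; lra].
        assert (0 <= (1 + u) * v) by (apply Rmult_le_pos; lra); lra. }
      rewrite I_minus, RInt_inv_one_plus_sin2, I_const, Eu by (assumption || cont_tac).
      rewrite sqrt_div_alt, sqrt_pow2 by nra.
      inR; field; split; [apply Rgt_not_eq, Q | lra]. }
  transitivity (RInt (fun t => sin t * (F (arcsinh (a * cos t)) * (a / sqrt (1 + (a * cos t) ^ 2))) *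
     (PI * C * (/ sqrt (1 + (a * cos t) ^ 2) - c))) 0 (PI / 2)).
  2:{ apply I_ext; [lra|]; intros t Ht; rewrite I1 by assumption; reflexivity. }
  assert (CD : cont (fun t : R => - (a * sin t) / sqrt (1 + (a * cos t) ^ 2))).
  { cont_tac; intros x; apply Rgt_not_eq, Q. }
  assert (CG : cont (fun y : R => F y * (phi0 y - c))).
  { assert (H := cont_phi0); cont_tac. }
  (* The substitution is [sinh y = a * cos t]; it runs from [y = s] down to [y = 0], which accounts
     for the sign. *)
  assert (S := I_comp (fun y => F y * (phi0 y - c)) (fun t => arcsinh (a * cos t))
    (fun t => - (a * sin t) / sqrt (1 + (a * cos t) ^ 2)) 0 (PI / 2) CG CD).
  cbv beta in S; rewrite cos_PI2, cos_0, Rmult_0_r, Rmult_1_r, arcsinh_0 in S.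
  replace (arcsinh a) with s in S by (symmetry; apply arcsinh_sinh).
  rewrite (I_swap _ 0 s) in S by assumption.
  replace (RInt (fun y => F y * (phi0 y - c)) 0 s) with
    (-1 * RInt (fun y => - (a * sin y) / sqrt (1 + (a * cos y) ^ 2) *
        (F (arcsinh (a * cos y)) * (phi0 (arcsinh (a * cos y)) - c))) 0 (PI / 2)).
  - assert (H := cont_phi0).
    assert (CH : cont (fun y : R => - (a * sin y) / sqrt (1 + (a * cos y) ^ 2) *
        (F (arcsinh (a * cos y)) * (phi0 (arcsinh (a * cos y)) - c)))).
    { cont_tac; intros x; apply Rgt_not_eq, Q. }
    rewrite <- I_scal by exact CH.
    rewrite <- I_scal by (apply cont_mult; [apply cont_const | exact CH]).
    apply RInt_ext; intros t _; rewrite phi0_arcsinh; inR; unfold Rdiv; ring.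
  - rewrite S; [inR; ring|].
    intros t; apply (is_derive_arcsinh (fun t => a * cos t)).
    auto_derive; [exact I | ring].
Qed.

(** The transform is applied to [circle_int f] and to [phi0]. The averaged length bound compares the
    inner integrals for each [t], and integration against the nonnegative kernel preserves the
    inequality. The factor 2 arises because a circle has circumference [2 * PI] while a semicircle
    has spherical length [PI]. *)
Lemma great_circle_ineq beta f sigma s c : cont f -> A_invariant f -> loops_ge beta f sigma ->
  0 <= s -> 0 <= c <= phi0 s ->
  2 * sigma * RInt (fun y => phi0 y * (phi0 y - c)) 0 s <=
  RInt (fun y => circle_int f y * (phi0 y - c)) 0 s.
Proof.
  intros Hf HA HL Hs Hc; assert (P := PI_RGT_0).
  assert (HC := cosh_pos s); assert (HF := cont_circle_int f Hf).
  assert (Ha := sinh_ge0 s Hs).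
  assert (T1 := great_circle_transform (circle_int f) s c HF Hs).
  assert (T0 := great_circle_transform phi0 s c cont_phi0 Hs).
  cbv zeta in T1, T0; set (a := sinh s) in *; set (C := cosh s) in *.
  assert (EC : C ^ 2 = 1 + a ^ 2) by apply cosh_sqr.
  assert (Q : forall t, 0 < sqrt (1 + t ^ 2)) by (intros; apply sqrt_lt_R0, one_plus_sqr_pos).
  assert (Q2 : forall z, 0 < 1 + a ^ 2 * Rabs (1 - z ^ 2)).
  { intros z; assert (0 <= a ^ 2 * Rabs (1 - z ^ 2)); [|lra].
    apply Rmult_le_pos; [apply pow2_ge_0 | apply Rabs_pos]. }
  apply Rmult_le_reg_l with (PI * C); [nra|].
  rewrite T1.
  replace (PI * C * (2 * sigma * RInt (fun y => phi0 y * (phi0 y - c)) 0 s)) with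
    (2 * sigma * (PI * C * RInt (fun y => phi0 y * (phi0 y - c)) 0 s)) by (inR; ring).
  rewrite T0; clear T0 T1.
  assert (K1 : forall F, cont F -> cont (fun t : R => RInt (fun x =>
    F (arcsinh (a * (sin t * sin x))) * (a / sqrt (1 + (a * (sin t * sin x)) ^ 2))) 0 PI)).
  { intros F CF.
    apply (cont_sphere_inner (fun z => F (arcsinh (a * z)) * (a / sqrt (1 + (a * z) ^ 2)))).
    cont_tac; intros x; apply Rgt_not_eq, Q. }
  assert (K2 : cont (fun z : R => C ^ 2 / (1 + a ^ 2 * Rabs (1 - z ^ 2)) - c * C)).
  { cont_tac; intros x; apply Rgt_not_eq, Q2. }
  set (k := fun z : R => C ^ 2 / (1 + a ^ 2 * Rabs (1 - z ^ 2)) - c * C) in *.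
  assert (Kf := K1 _ HF); assert (K0 := K1 _ cont_phi0).
  unfold sphere_int.
  rewrite <- I_scal by cont_tac.
  apply I_le; [lra | cont_tac | cont_tac |].
  intros t Ht.
  (* The hypothesis [c <= phi0 s] enters here: it says [c * C <= 1], and the fraction in the kernel
     is at least 1. *)
  assert (Hk : 0 <= sin t * k (cos t)).
  { destruct (sin_half_pi_bounds t Ht) as [S1 S2].
    apply Rmult_le_pos; [lra|]; unfold k.
    rewrite Rabs_pos_eq by nra.
    assert (c * C <= 1).
    { rewrite phi0_cosh in Hc; fold C in Hc.
      replace 1 with (/ C * C) by (field; lra).
      apply Rmult_le_compat_r; lra. }
    assert (1 <= C ^ 2 / (1 + a ^ 2 * (1 - cos t ^ 2))); [|lra].
    assert (0 <= a ^ 2 * cos t ^ 2) by (rewrite <- Rpow_mult_distr; apply pow2_ge_0).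
    assert (0 <= a ^ 2 * (1 - cos t ^ 2)) by (apply Rmult_le_pos; nra).
    apply Rmult_le_reg_r with (1 + a ^ 2 * (1 - cos t ^ 2)); [lra|].
    replace (C ^ 2 / (1 + a ^ 2 * (1 - cos t ^ 2)) * (1 + a ^ 2 * (1 - cos t ^ 2))) with (C ^ 2)
      by (field; lra).
    rewrite EC; lra. }
  match goal with |- 2 * sigma * (_ * ?I0) <= _ * ?If =>
    assert (G : 2 * sigma * I0 <= If) end.
  2:{ eapply Rle_trans; [|apply Rmult_le_compat_l; [exact Hk | exact G]].
      apply Req_le; inR; ring. }
  set (b := a * sin t).
  assert (Qb := Q b).
  (* For [phi0] every semicircle has length exactly [PI], whatever its inclination [b]. *)
  assert (G0 : RInt (fun x => phi0 (arcsinh (a * (sin t * sin x))) *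
    (a / sqrt (1 + (a * (sin t * sin x)) ^ 2))) 0 PI = a * PI / sqrt (1 + b ^ 2)).
  { transitivity (RInt (fun x => a * / (1 + b ^ 2 * sin x ^ 2)) 0 PI).
    - apply RInt_ext; intros x _; rewrite phi0_arcsinh.
      replace (a * (sin t * sin x)) with (b * sin x) by (unfold b; ring).
      assert (E := pow2_sqrt (1 + (b * sin x) ^ 2) (Rlt_le _ _ (one_plus_sqr_pos _))).
      rewrite <- Rpow_mult_distr; assert (q := Q (b * sin x)).
      replace (a * / (1 + (b * sin x) ^ 2)) with (a * / (sqrt (1 + (b * sin x) ^ 2) ^ 2))
        by (rewrite E; reflexivity).
      inR; field; lra.
    - rewrite I_scal.
      + rewrite RInt_inv_one_plus_sin2 by nra; unfold Rdiv; inR; ring.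
      + cont_tac; intros x; rewrite <- Rpow_mult_distr.
        apply Rgt_not_eq, one_plus_sqr_pos. }
  rewrite G0.
  assert (M := great_circle_avg beta f sigma b Hf HA HL).
  apply Rmult_le_reg_r with (sqrt (1 + b ^ 2)); [lra|].
  apply Rle_trans with (a * (2 * PI * sigma)); [apply Req_le; field; lra|].
  apply Rle_trans with (a * RInt (fun x => circle_int f (arcsinh (b * sin x)) *
    (sqrt (1 + b ^ 2) / sqrt (1 + (b * sin x) ^ 2))) 0 PI); [apply Rmult_le_compat_l; assumption|].
  apply Req_le.
  assert (CA : cont (fun x : R => circle_int f (arcsinh (b * sin x)) *
    (sqrt (1 + b ^ 2) / sqrt (1 + (b * sin x) ^ 2)))).
  { cont_tac; intros x; apply Rgt_not_eq, Q. }
  assert (CB : cont (fun x : R => circle_int f (arcsinh (a * (sin t * sin x))) *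
    (a / sqrt (1 + (a * (sin t * sin x)) ^ 2)))).
  { cont_tac; intros x; apply Rgt_not_eq, Q. }
  rewrite Rmult_comm with (r2 := sqrt (1 + b ^ 2)), <- !I_scal by assumption.
  apply RInt_ext; intros x _.
  replace (a * (sin t * sin x)) with (b * sin x) by (unfold b; ring).
  inR; unfold Rdiv; ring.
Qed.

(** * The profile of [phi_beta] *)

(** Distance from [y] to the multiples of [P]. For [P = 2 * beta] it is convertible to the argument
    that [phi_beta_ext] passes to [phi_beta_base]; for [P = 4 * beta] it yields the folding map. *)
Definition lattice_dist (P y : R) : R :=
  let t := y - P * IZR (Int_part (y / P)) in Rmin t (P - t).

Lemma lattice_dist_spec P y : 0 < P ->
  exists t k, 0 <= t <= P / 2 /\ (y = P * IZR k + t \/ y = P * IZR k - t) /\ lattice_dist P y = t.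
Proof.
  intros HP; unfold lattice_dist.
  destruct (base_Int_part (y / P)) as [H1 H2]; set (k := Int_part (y / P)) in *.
  assert (E : y = P * (y / P)) by (field; lra).
  set (t := y - P * IZR k).
  assert (Ht : 0 <= t <= P) by (unfold t; rewrite E; nra).
  destruct (Rle_dec t (P - t)) as [L|L].
  - exists t, k; rewrite Rmin_left by assumption; repeat split; try lra; left; unfold t; ring.
  - exists (P - t), (k + 1)%Z; rewrite Rmin_right by lra; rewrite plus_IZR.
    repeat split; try lra; right; unfold t; ring.
Qed.

Lemma IZR_sign k : IZR k <= -1 \/ IZR k = 0 \/ 1 <= IZR k.
Proof.
  destruct (Z_lt_le_dec k 0) as [H|H]; [left; apply IZR_le; lia|].
  destruct (Z.eq_dec k 0) as [->|N]; [right; left; reflexivity|].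
  right; right; apply IZR_le; lia.
Qed.

Lemma lattice_dist_le P y k : 0 < P -> lattice_dist P y <= Rabs (y - P * IZR k).
Proof.
  intros HP; destruct (lattice_dist_spec P y HP) as [t [j [Ht [E ->]]]].
  destruct (IZR_sign (j - k)) as [H|[H|H]]; rewrite minus_IZR in H.
  - assert (P * (IZR j - IZR k) <= P * -1) by (apply Rmult_le_compat_l; lra).
    rewrite <- Rabs_Ropp; eapply Rle_trans; [|apply Rle_abs]; destruct E; lra.
  - replace (IZR k) with (IZR j) by lra.
    destruct E as [E|E]; unfold Rabs; destruct Rcase_abs; lra.
  - assert (P * 1 <= P * (IZR j - IZR k)) by (apply Rmult_le_compat_l; lra).
    eapply Rle_trans; [|apply Rle_abs]; destruct E; lra.
Qed.

Lemma lattice_dist_unique P y t k : 0 < P -> 0 <= t <= P / 2 ->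
  (y = P * IZR k + t \/ y = P * IZR k - t) -> lattice_dist P y = t.
Proof.
  intros HP Ht E; apply Rle_antisym.
  - eapply Rle_trans; [apply (lattice_dist_le P y k HP)|].
    destruct E as [E|E]; rewrite E; unfold Rabs; destruct Rcase_abs; lra.
  - destruct (lattice_dist_spec P y HP) as [t' [j [Ht' [E' ->]]]].
    destruct (IZR_sign (j - k)) as [H|[H|H]]; rewrite minus_IZR in H.
    + assert (P * (IZR j - IZR k) <= P * -1) by (apply Rmult_le_compat_l; lra).
      destruct E, E'; lra.
    + assert (P * (IZR j - IZR k) = 0) by (rewrite H; ring).
      destruct E, E'; lra.
    + assert (P * 1 <= P * (IZR j - IZR k)) by (apply Rmult_le_compat_l; lra).
      destruct E, E'; lra.
Qed.

Lemma lattice_dist_bounds P y : 0 < P -> 0 <= lattice_dist P y <= P / 2.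
Proof. intros HP; destruct (lattice_dist_spec P y HP) as [t [k [Ht [_ ->]]]]; exact Ht. Qed.

Lemma lattice_dist_lipschitz P y z : 0 < P ->
  Rabs (lattice_dist P y - lattice_dist P z) <= Rabs (y - z).
Proof.
  intros HP.
  assert (W : forall y z, lattice_dist P y - lattice_dist P z <= Rabs (y - z)).
  { intros u v; destruct (lattice_dist_spec P v HP) as [t [k [Ht [E Et]]]].
    assert (A := lattice_dist_le P u k HP).
    assert (B : Rabs (v - P * IZR k) = t) by (destruct E; unfold Rabs; destruct Rcase_abs; lra).
    replace (u - P * IZR k) with ((u - v) + (v - P * IZR k)) in A by ring.
    assert (T := Rabs_triang (u - v) (v - P * IZR k)); lra. }
  apply Rabs_le; split; [|apply W].
  specialize (W z y); rewrite Rabs_minus_sym in W; lra.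
Qed.

Lemma lattice_dist_shift P y k : 0 < P -> lattice_dist P (y + P * IZR k) = lattice_dist P y.
Proof.
  intros HP; destruct (lattice_dist_spec P y HP) as [t [j [Ht [E ->]]]].
  apply lattice_dist_unique with (k := (j + k)%Z); auto; rewrite plus_IZR; destruct E; lra.
Qed.

Lemma lattice_dist_period P y : 0 < P -> lattice_dist P (y + P) = lattice_dist P y.
Proof. intros HP; rewrite <- (lattice_dist_shift P y 1 HP); f_equal; ring. Qed.

Lemma lattice_dist_opp P y : 0 < P -> lattice_dist P (- y) = lattice_dist P y.
Proof.
  intros HP; destruct (lattice_dist_spec P y HP) as [t [k [Ht [E ->]]]].
  apply lattice_dist_unique with (k := (- k)%Z); auto; rewrite opp_IZR; destruct E; lra.
Qed.

Lemma lattice_dist_small P y : 0 < P -> 0 <= y <= P / 2 -> lattice_dist P y = y.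
Proof. intros HP Hy; apply lattice_dist_unique with (k := 0%Z); auto; left; lra. Qed.

Lemma lattice_dist_half P y : 0 < P -> lattice_dist P (P / 2 - y) = P / 2 - lattice_dist P y.
Proof.
  intros HP; destruct (lattice_dist_spec P y HP) as [t [k [Ht [[E|E] ->]]]].
  - apply lattice_dist_unique with (k := (- k)%Z); [assumption | lra|]; rewrite opp_IZR; lra.
  - apply lattice_dist_unique with (k := (1 - k)%Z); [assumption | lra|]; rewrite minus_IZR; lra.
Qed.

Lemma lipschitz_cont (f : R -> R) : (forall x y, Rabs (f x - f y) <= Rabs (x - y)) -> cont f.
Proof.
  intros H x; apply continuity_pt_filterlim; intros eps He.
  exists eps; split; [exact He|]; intros z [_ Hz].
  unfold dist in *; simpl in *; unfold Rdist in *; eapply Rle_lt_trans; [apply H | exact Hz].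
Qed.

(** * Mercator functions and the thresholds *)

Lemma cosh_even y : cosh (- y) = cosh y.
Proof. unfold cosh; rewrite Ropp_involutive; f_equal; ring. Qed.

Lemma phi0_even y : phi0 (- y) = phi0 y.
Proof. rewrite !phi0_cosh, cosh_even; reflexivity. Qed.

Lemma phi0_pos y : 0 < phi0 y.
Proof. rewrite phi0_cosh; apply Rinv_0_lt_compat, cosh_pos. Qed.

Lemma phi0_0 : phi0 0 = 1.
Proof. rewrite phi0_cosh, cosh_0; apply Rinv_1. Qed.

Lemma sinh_le x y : x <= y -> sinh x <= sinh y.
Proof. intros [H|H]; [left; apply sinh_lt, H | subst; lra]. Qed.

Lemma cosh_incr x y : 0 <= x <= y -> cosh x <= cosh y.
Proof.
  intros H; rewrite !cosh_sqrt; apply sqrt_le_1_alt.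
  assert (A := sinh_ge0 x (proj1 H)); assert (B := sinh_le x y (proj2 H)); nra.
Qed.

Lemma phi0_decr x y : 0 <= x <= y -> phi0 y <= phi0 x.
Proof.
  intros H; rewrite !phi0_cosh; apply Rinv_le_contravar; [apply cosh_pos | apply cosh_incr, H].
Qed.

Lemma cosh_ge1 y : 1 <= cosh y.
Proof. rewrite cosh_sqrt, <- sqrt_1 at 1; apply sqrt_le_1_alt; nra. Qed.

Lemma phi0_le1 y : phi0 y <= 1.
Proof. rewrite phi0_cosh, <- Rinv_1; apply Rinv_le_contravar; [lra | apply cosh_ge1]. Qed.

Lemma is_derive_phi0 y : is_derive phi0 y (- sinh y / cosh y ^ 2).
Proof.
  apply is_derive_ext with (fun t => / cosh t); [intros; symmetry; apply phi0_cosh|].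
  apply is_derive_inv; [apply is_derive_Reals, derivable_pt_lim_cosh | apply Rgt_not_eq, cosh_pos].
Qed.

Lemma phi0_lipschitz x y : Rabs (phi0 x - phi0 y) <= Rabs (x - y).
Proof.
  destruct (MVT_gen phi0 y x (fun t => - sinh t / cosh t ^ 2)) as [z [_ E]].
  - intros; apply is_derive_phi0.
  - intros; apply cont_continuity_pt, cont_phi0.
  - rewrite E, Rabs_mult; rewrite <- (Rmult_1_l (Rabs (x - y))) at 2.
    apply Rmult_le_compat_r; [apply Rabs_pos|].
    assert (C := cosh_ge1 z); assert (S := cosh_sqr z).
    unfold Rdiv; rewrite Rabs_mult, Rabs_Ropp, (Rabs_pos_eq (/ _)) by (apply Rlt_le, Rinv_0_lt_compat; nra).
    apply Rmult_le_reg_r with (cosh z ^ 2); [nra|].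
    rewrite Rmult_assoc, Rinv_l by nra; unfold Rabs; destruct Rcase_abs; nra.
Qed.

(** The Gudermannian function, which converts Mercator ordinates into latitudes. *)
Lemma RInt_phi0 y : RInt phi0 0 y = atan (sinh y).
Proof.
  rewrite (I_derive (fun t => atan (sinh t))).
  - rewrite sinh_0, atan_0; apply Rminus_0_r.
  - intros t; rewrite phi0_cosh.
    replace (/ cosh t) with (cosh t * / (1 + sinh t ^ 2)).
    + apply (is_derive_comp atan sinh).
      * apply is_derive_Reals, derivable_pt_lim_atan.
      * apply is_derive_Reals, derivable_pt_lim_sinh.
    + rewrite <- cosh_sqr; field; apply Rgt_not_eq, cosh_pos.
  - apply cont_phi0.
Qed.

Lemma exp_beta0 : exp beta0 = 1 + sqrt 2.
Proof. apply exp_ln; assert (H := sqrt_pos 2); lra. Qed.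

Lemma exp_beta1 : exp beta1 = 2 + sqrt 3.
Proof. apply exp_ln; assert (H := sqrt_pos 3); lra. Qed.

(** [beta0] is the Mercator ordinate of latitude [PI / 4]: from there on, a vertical loop has
    spherical length at least [PI]. *)
Lemma sinh_beta0 : sinh beta0 = 1.
Proof.
  unfold sinh; rewrite exp_Ropp, exp_beta0.
  assert (H := sqrt_pos 2); assert (E := sqrt_sqrt 2 ltac:(lra)).
  apply Rmult_eq_reg_r with (2 * (1 + sqrt 2)); [|lra].
  field_simplify; [|lra]. nra.
Qed.

(** [beta1] is the ordinate of latitude [PI / 3], whose parallel circle has spherical length
    [PI]. *)
Lemma cosh_beta1 : cosh beta1 = 2.
Proof.
  unfold cosh; rewrite exp_Ropp, exp_beta1.
  assert (H := sqrt_pos 3); assert (E := sqrt_sqrt 3 ltac:(lra)).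
  apply Rmult_eq_reg_r with (2 * (2 + sqrt 3)); [|lra].
  field_simplify; [|lra]. nra.
Qed.

Lemma beta1_pos : 0 < beta1.
Proof. rewrite <- ln_1; apply ln_increasing; assert (H := sqrt_pos 3); lra. Qed.

Lemma beta0_lt_beta1 : beta0 < beta1.
Proof.
  apply ln_increasing; assert (H := sqrt_pos 2); [lra|].
  assert (sqrt 2 < sqrt 3) by (apply sqrt_lt_1_alt; lra); lra.
Qed.

Lemma phi0_ge_half y : 0 <= y <= beta1 -> / 2 <= phi0 y.
Proof. intros H; rewrite <- cosh_beta1, <- phi0_cosh; apply phi0_decr, H. Qed.

Lemma RInt_phi0_ge y : beta0 <= y -> PI / 4 <= RInt phi0 0 y.
Proof.
  intros H; rewrite RInt_phi0, <- atan_1, <- sinh_beta0.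
  destruct (sinh_le _ _ H) as [L|L]; [left; apply atan_increasing, L | rewrite L; lra].
Qed.

Lemma RInt_phi0_lt y : y < beta0 -> RInt phi0 0 y < PI / 4.
Proof.
  intros H; rewrite RInt_phi0, <- atan_1, <- sinh_beta0; apply atan_increasing, sinh_lt, H.
Qed.

(** [s_beta] is a value of the choice operator, so existence of a solution suffices. The
    intermediate value theorem applies: the left side is [beta > PI / 4] at [s = 0], and below
    [PI / 4] at [s = beta] because [beta < beta0]. *)
Lemma s_beta_spec beta : PI / 4 < beta < beta0 ->
  0 < s_beta beta < beta /\
  RInt phi0 0 (s_beta beta) + (beta - s_beta beta) * phi0 (s_beta beta) = PI / 4.
Proof.
  intros Hb; assert (P := PI_RGT_0); assert (C0 := cont_phi0).
  apply (epsilon_spec (inhabits 0) (fun s => 0 < s < beta /\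
     RInt phi0 0 s + (beta - s) * phi0 s = PI / 4)).
  set (h := fun s => RInt phi0 0 s + (beta - s) * phi0 s).
  assert (Ch : cont h).
  { assert (C1 : cont (fun s : R => RInt phi0 0 s)).
    { apply cont_ex_derive; intros s; eexists; apply derive_I, C0. }
    unfold h; cont_tac. }
  assert (h0 : h 0 = beta).
  { unfold h; rewrite RInt_phi0, sinh_0, atan_0, phi0_0; ring. }
  assert (hb : h beta < PI / 4).
  { unfold h; assert (L := RInt_phi0_lt beta (proj2 Hb)); rewrite Rminus_diag, Rmult_0_l; lra. }
  destruct (IVT_gen_consistent h 0 beta (PI / 4) Ch) as [s [Hs E]].
  { rewrite h0, Rmin_right, Rmax_left by lra; lra. }
  rewrite Rmin_left, Rmax_right in Hs by lra.
  exists s; split; [|exact E].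
  destruct (Req_dec s 0) as [->|N0]; [lra|].
  destruct (Req_dec s beta) as [->|N1]; [lra|]; lra.
Qed.

Definition capped (c y : R) : R := Rmax (phi0 y) c.

(* [s] is the latitude up to which [phi_beta] is spherical.  The alternative at the
   end says which loops besides great circles are shortest: the vertical ones
   ([beta < beta0]), or possibly the horizontal ones (then [c = 1/2]). *)
Definition is_profile (beta c s : R) : Prop :=
  (forall y, 0 <= y <= beta -> phi_beta_base beta y = capped c y) /\
  / 2 <= c /\ 0 <= s <= beta /\ (s = 0 \/ c <= phi0 s) /\
  (forall y, 0 < y < s -> c <= phi0 y) /\ (forall y, s < y < beta -> phi0 y <= c) /\
  (4 * RInt (capped c) 0 beta = PI \/ (c = / 2 /\ PI <= 4 * RInt (capped c) 0 beta)).

Lemma cont_capped c : cont (capped c).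
Proof. assert (H := cont_phi0); unfold capped; cont_tac. Qed.

Lemma RInt_capped beta c s : 0 <= s <= beta ->
  (forall y, 0 < y < s -> c <= phi0 y) -> (forall y, s < y < beta -> phi0 y <= c) ->
  RInt (capped c) 0 beta = RInt phi0 0 s + (beta - s) * c.
Proof.
  intros Hs H1 H2.
  rewrite <- (I_chasles (capped c) 0 s beta (cont_capped c)), <- I_const.
  f_equal; apply RInt_ext; intros y; rewrite Rmin_left, Rmax_right by lra; intros Hy; unfold capped.
  - apply Rmax_left, H1, Hy.
  - apply Rmax_right, H2, Hy.
Qed.

(** The four ranges of [beta] give for [(c, s)] the pairs [(PI / (4 * beta), 0)],
    [(phi0 s_beta, s_beta)], [(1/2, beta)] and [(1/2, beta1)]. In the first one [c] may exceed
    [phi0 0], hence the alternative [s = 0] in [is_profile]. *)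
Lemma profile_exists beta : 0 < beta -> exists c s, is_profile beta c s.
Proof.
  intros Hb; assert (P := PI_RGT_0); assert (B1 := beta1_pos); assert (B01 := beta0_lt_beta1).
  unfold is_profile, phi_beta_base.
  destruct (Rle_dec beta (PI / 4)) as [C1|C1].
  { set (c := PI / (4 * beta)).
    assert (Hc : 1 <= c).
    { unfold c; apply Rmult_le_reg_r with (4 * beta); [lra|].
      replace (PI / (4 * beta) * (4 * beta)) with PI by (field; lra); lra. }
    assert (M : forall y, phi0 y <= c) by (intros y; assert (H := phi0_le1 y); lra).
    exists c, 0; repeat split; try lra; auto.
    - intros y _; symmetry; apply Rmax_right, M.
    - intros y Hy; lra.
    - left; rewrite (RInt_capped beta c 0); [|lra|intros; lra|auto].
      rewrite RInt_phi0, sinh_0, atan_0; unfold c; field; lra. }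
  destruct (Rlt_dec beta beta0) as [C2|C2].
  { destruct (s_beta_spec beta ltac:(lra)) as [Hs E]; set (s := s_beta beta) in *.
    exists (phi0 s), s.
    assert (M1 : forall y, 0 <= y <= s -> phi0 s <= phi0 y) by (intros; apply phi0_decr; lra).
    assert (M2 : forall y, s <= y -> phi0 y <= phi0 s) by (intros; apply phi0_decr; lra).
    repeat split; try lra.
    - intros y Hy; unfold capped; destruct (Rle_dec y s);
        [rewrite Rmax_left | rewrite Rmax_right]; auto; [apply M1 | apply M2]; lra.
    - apply phi0_ge_half; lra.
    - intros; apply M1; lra.
    - intros; apply M2; lra.
    - left; rewrite (RInt_capped beta (phi0 s) s); [lra | lra | |].
      + intros; apply M1; lra.
      + intros; apply M2; lra. }
  destruct (Rle_dec beta beta1) as [C3|C3].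
  { exists (/ 2), beta.
    assert (M1 : forall y, 0 <= y <= beta -> / 2 <= phi0 y) by (intros; apply phi0_ge_half; lra).
    repeat split; try lra.
    - intros y Hy; unfold capped; rewrite Rmax_left; auto.
    - right; apply M1; lra.
    - intros; apply M1; lra.
    - intros; lra.
    - right; split; [reflexivity|].
      rewrite (RInt_capped beta (/ 2) beta); [|lra|intros; apply M1; lra|intros; lra].
      assert (R := RInt_phi0_ge beta ltac:(lra)); lra. }
  exists (/ 2), beta1.
  assert (M1 : forall y, 0 <= y <= beta1 -> / 2 <= phi0 y) by (intros; apply phi0_ge_half; lra).
  assert (M2 : forall y, beta1 <= y -> phi0 y <= / 2).
  { intros; rewrite <- cosh_beta1, <- phi0_cosh; apply phi0_decr; lra. }
  repeat split; try lra.
  - intros y Hy; unfold capped; destruct (Rle_dec y beta1);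
      [rewrite Rmax_left | rewrite Rmax_right]; auto; [apply M1 | |apply M2]; lra.
  - right; apply M1; lra.
  - intros; apply M1; lra.
  - intros; apply M2; lra.
  - right; split; [reflexivity|].
    rewrite (RInt_capped beta (/ 2) beta1); [|lra|intros; apply M1; lra|intros; apply M2; lra].
    assert (R := RInt_phi0_ge beta1 ltac:(lra)); lra.
Qed.

Lemma phi_beta_capped beta c s x y : 0 < beta -> is_profile beta c s ->
  phi_beta beta (x, y) = capped c (lattice_dist (2 * beta) y).
Proof.
  intros Hb [H _].
  change (phi_beta_base beta (lattice_dist (2 * beta) y) = capped c (lattice_dist (2 * beta) y)).
  apply H; assert (B := lattice_dist_bounds (2 * beta) y ltac:(lra)); lra.
Qed.

(** * The scalar product with [phi_beta] *)

Definition B_invariant (beta : R) (f : pt -> R) : Prop :=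
  forall x y, f (x, y + 4 * beta) = f (x, y).

Lemma Gamma_invariant_A beta f : Gamma_invariant beta f -> A_invariant f.
Proof. intros H x y; exact (H _ (Gamma_A beta _ (Gamma_id beta)) (x, y)). Qed.

Lemma Gamma_invariant_B beta f : Gamma_invariant beta f -> B_invariant beta f.
Proof. intros H x y; exact (H _ (Gamma_B beta _ (Gamma_id beta)) (x, y)). Qed.

Lemma AB_invariant_Gamma beta f : A_invariant f -> B_invariant beta f -> Gamma_invariant beta f.
Proof.
  intros HA HB g Hg; induction Hg as [|g _ IH|g _ IH|g _ IH|g _ IH]; intros p;
    try reflexivity; rewrite <- (IH p); destruct (g p) as [x y]; unfold isoA, isoAinv, isoB, isoBinv; simpl.
  - apply HA.
  - rewrite <- (HA (x - PI)), Ropp_involutive; f_equal; f_equal; ring.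
  - apply HB.
  - rewrite <- (HB x (y - 4 * beta)); f_equal; f_equal; ring.
Qed.

Definition half_shift (beta : R) (f : pt -> R) : pt -> R := fun p => f (fst p, snd p + 2 * beta).

(** The vertical translation by [2 * beta] normalizes the group: it commutes with [B] and conjugates
    [A] into [B A]. Since it exchanges the two invariant circles, statements about the circle
    [y = 0] carry over to [y = 2 * beta]. *)
Lemma in_Gamma_half_shift beta g : in_Gamma beta g ->
  exists g', in_Gamma beta g' /\
    forall x y, g' (x, y + 2 * beta) = (fst (g (x, y)), snd (g (x, y)) + 2 * beta).
Proof.
  intros Hg; induction Hg as [|g _ [g' [Hg' E]]|g _ [g' [Hg' E]]|g _ [g' [Hg' E]]|g _ [g' [Hg' E]]].
  - exists (fun p => p); split; [constructor | reflexivity].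
  - exists (fun p => isoB beta (isoA (g' p))); split; [repeat constructor; exact Hg'|].
    intros x y; rewrite E; unfold isoA, isoB; simpl; f_equal; ring.
  - exists (fun p => isoB beta (isoAinv (g' p))); split; [repeat constructor; exact Hg'|].
    intros x y; rewrite E; unfold isoAinv, isoB; simpl; f_equal; ring.
  - exists (fun p => isoB beta (g' p)); split; [repeat constructor; exact Hg'|].
    intros x y; rewrite E; unfold isoB; simpl; f_equal; ring.
  - exists (fun p => isoBinv beta (g' p)); split; [repeat constructor; exact Hg'|].
    intros x y; rewrite E; unfold isoBinv; simpl; f_equal; ring.
Qed.

Lemma loops_ge_half_shift beta f sigma : loops_ge beta f sigma ->
  loops_ge beta (half_shift beta f) sigma.
Proof.
  intros H c1 c2 [[HD HC] [g [Hg [Hn He]]]].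
  assert (D : forall t, is_derive (fun t => c2 t + 2 * beta) t (Derive c2 t)).
  { intros t; replace (Derive c2 t) with (Derive c2 t + 0) by ring.
    apply (is_derive_plus c2 (fun _ => 2 * beta)).
    - apply Derive_correct, HD.
    - apply (is_derive_const (K := R_AbsRing) (V := R_NormedModule)). }
  assert (D' : forall t, Derive (fun t => c2 t + 2 * beta) t = Derive c2 t)
    by (intros; apply is_derive_unique, D).
  destruct (in_Gamma_half_shift beta g Hg) as [g' [Hg' E]].
  replace (curve_length (half_shift beta f) c1 c2) with
    (curve_length f c1 (fun t => c2 t + 2 * beta)).
  - apply H; split; [split|].
    + intros t; split; [exact (proj1 (HD t)) | eexists; apply D].
    + intros t; split; [exact (proj1 (HC t))|].
      apply continuous_ext with (Derive c2); [intros; symmetry; apply D' | exact (proj2 (HC t))].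
    + exists g'; repeat split; auto.
      * intros Z; apply Hn; apply functional_extensionality; intros [x y].
        specialize (E x y); rewrite Z in E; injection E; intros E2 E1.
        destruct (g (x, y)) as [u v]; simpl in *; f_equal; lra.
      * rewrite E, <- He; reflexivity.
  - apply RInt_ext; intros t _; rewrite D'; reflexivity.
Qed.

(** Modulo [4 * b], the four arguments are the points at distance [u] from the centres [0] and
    [2 * b] of the two bands. *)
Lemma RInt_quarters (h : R -> R) b : cont h -> 0 <= b ->
  RInt h 0 (4 * b) = RInt (fun u => (h u + h (4 * b - u)) + (h (2 * b + u) + h (2 * b - u))) 0 b.
Proof.
  intros Hh Hb; rewrite !I_plus by cont_tac.
  rewrite !I_refl by assumption.
  assert (E : RInt (fun u => h (2 * b + u)) 0 b = RInt h (2 * b) (3 * b)).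
  { transitivity (RInt (fun u => h (u + 2 * b)) 0 b).
    - apply RInt_ext; intros; f_equal; ring.
    - rewrite I_shift by assumption; f_equal; ring. }
  rewrite E.
  replace (4 * b - b) with (3 * b) by ring; replace (4 * b - 0) with (4 * b) by ring.
  replace (2 * b - b) with b by ring; replace (2 * b - 0) with (2 * b) by ring.
  rewrite <- (I_chasles h 0 (3 * b) (4 * b)), <- (I_chasles h 0 (2 * b) (3 * b)),
    <- (I_chasles h 0 b (2 * b)) by assumption.
  inR; ring.
Qed.

Definition half_circle_int (f : pt -> R) (y : R) : R := RInt (fun x => f (x, y)) 0 PI.

(** [A] moves the second half of the circle at height [y] onto the first half at height [- y]. This
    links the fundamental domain, of width [PI], with full circles. *)
Lemma circle_int_halves f y : cont f -> A_invariant f ->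
  circle_int f y = half_circle_int f y + half_circle_int f (- y).
Proof.
  intros Hf HA; unfold circle_int, half_circle_int.
  rewrite <- (I_chasles (fun x => f (x, y)) 0 PI (2 * PI)) by cont_tac; f_equal.
  replace PI with (0 + PI) at 1 by ring; replace (2 * PI) with (PI + PI) by ring.
  rewrite <- (I_shift (fun x => f (x, y))) by cont_tac.
  apply RInt_ext; intros x _; rewrite <- (HA x (- y)), Ropp_involutive; reflexivity.
Qed.

Lemma half_shift_cont beta f : cont f -> cont (half_shift beta f).
Proof. intros Hf; unfold half_shift; cont_tac. Qed.

Lemma half_shift_A beta f : A_invariant f -> B_invariant beta f -> A_invariant (half_shift beta f).
Proof.
  intros HA HB x y; unfold half_shift; simpl.
  rewrite <- (HA x (y + 2 * beta)), <- (HB (x + PI) (- (y + 2 * beta))).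
  f_equal; f_equal; ring.
Qed.

Definition band_sum (beta : R) (f : pt -> R) (u : R) : R :=
  circle_int f u + circle_int (half_shift beta f) u.

Lemma cont_band_sum beta f : cont f -> cont (band_sum beta f).
Proof.
  intros Hf; assert (H1 := cont_circle_int f Hf).
  assert (H2 := cont_circle_int _ (half_shift_cont beta f Hf)).
  unfold band_sum; cont_tac.
Qed.

(** The weight [w] depends only on the distance [u] to the nearest invariant circle, and [v] is that
    dependence; integration over the surface thus becomes integration over one interval. *)
Lemma intK_bands beta f (v w : R -> R) : 0 <= beta -> cont f -> A_invariant f -> B_invariant beta f ->
  cont w -> (forall u, 0 <= u <= beta ->
    w u = v u /\ w (4 * beta - u) = v u /\ w (2 * beta + u) = v u /\ w (2 * beta - u) = v u) ->
  intK beta (fun p => f p * w (snd p)) = RInt (fun u => v u * band_sum beta f u) 0 beta.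
Proof.
  intros Hb Hf HA HB Hw Hv; unfold intK.
  rewrite (fubini (fun p => f p * w (snd p))) by cont_tac.
  assert (HG : cont (half_circle_int f)) by (apply cont_param, Hf).
  transitivity (RInt (fun y => w y * half_circle_int f y) 0 (4 * beta)).
  { apply RInt_ext; intros y _; unfold half_circle_int; rewrite <- I_scal by cont_tac.
    apply RInt_ext; intros x _; apply Rmult_comm. }
  rewrite RInt_quarters by (cont_tac || assumption).
  apply I_ext; [exact Hb|]; intros u Hu.
  destruct (Hv u Hu) as [E1 [E2 [E3 E4]]]; rewrite E1, E2, E3, E4.
  unfold band_sum; rewrite !circle_int_halves by auto using half_shift_cont, half_shift_A.
  assert (F1 : half_circle_int f (4 * beta - u) = half_circle_int f (- u)).
  { apply RInt_ext; intros x _; rewrite <- (HB x (- u)); f_equal; f_equal; ring. }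
  assert (F2 : half_circle_int (half_shift beta f) u = half_circle_int f (2 * beta + u)).
  { apply RInt_ext; intros x _; unfold half_shift; simpl; f_equal; f_equal; ring. }
  assert (F3 : half_circle_int (half_shift beta f) (- u) = half_circle_int f (2 * beta - u)).
  { apply RInt_ext; intros x _; unfold half_shift; simpl; f_equal; f_equal; ring. }
  rewrite F1, F2, F3; ring.
Qed.

Lemma vertical_ge beta f sigma : 0 < beta -> cont f -> loops_ge beta f sigma ->
  PI * sigma <= intK beta f.
Proof.
  intros Hb Hf HL; assert (P := PI_RGT_0).
  apply Rle_trans with (RInt (fun _ => sigma) 0 PI); [rewrite I_const; lra|].
  apply I_le; [lra | cont_tac | apply (cont_param2 f), Hf|].
  intros x _.
  destruct (loop_of beta (fun _ => x) (fun t => 4 * beta * t) (fun _ => 0) (fun _ => 4 * beta)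
    (fun p => isoB beta p)) as [H E].
  - intros t; auto_derive; [exact I | ring].
  - intros t; auto_derive; [exact I | ring].
  - cont_tac.
  - cont_tac.
  - apply (Gamma_B beta (fun p => p)), Gamma_id.
  - unfold isoB; simpl; intros Z; injection Z; lra.
  - unfold isoB; simpl; f_equal; ring.
  - specialize (HL _ _ H); rewrite E in HL; eapply Rle_trans; [exact HL|].
    assert (S := I_comp (fun y => f (x, y)) (fun t => 4 * beta * t) (fun _ => 4 * beta) 0 1
      ltac:(cont_tac) ltac:(cont_tac)).
    cbv beta in S; rewrite Rmult_0_r, Rmult_1_r in S.
    rewrite <- S by (intros; auto_derive; [exact I | ring]).
    apply Req_le, RInt_ext; intros t _.
    replace (0 ^ 2 + (4 * beta) ^ 2) with ((4 * beta) ^ 2) by ring.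
    rewrite sqrt_pow2 by lra; apply Rmult_comm.
Qed.

Lemma circle_int_ge beta f sigma y : cont f -> loops_ge beta f sigma -> sigma <= circle_int f y.
Proof.
  intros Hf HL; assert (P := PI_RGT_0).
  destruct (loop_of beta (fun t => 2 * PI * t) (fun _ => y) (fun _ => 2 * PI) (fun _ => 0)
    (fun p => isoA (isoA p))) as [H E].
  - intros t; auto_derive; [exact I | ring].
  - intros t; auto_derive; [exact I | ring].
  - cont_tac.
  - cont_tac.
  - apply (Gamma_A beta (fun p => isoA p)), (Gamma_A beta (fun p => p)), Gamma_id.
  - unfold isoA; simpl; intros Z; injection Z; lra.
  - unfold isoA; simpl; f_equal; ring.
  - specialize (HL _ _ H); rewrite E in HL; eapply Rle_trans; [exact HL|].
    assert (S := I_comp (fun x => f (x, y)) (fun t => 2 * PI * t) (fun _ => 2 * PI) 0 1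
      ltac:(cont_tac) ltac:(cont_tac)).
    cbv beta in S; rewrite Rmult_0_r, Rmult_1_r in S.
    unfold circle_int; rewrite <- S by (intros; auto_derive; [exact I | ring]).
    apply Req_le, RInt_ext; intros t _.
    replace ((2 * PI) ^ 2 + 0 ^ 2) with ((2 * PI) ^ 2) by ring.
    rewrite sqrt_pow2 by lra; apply Rmult_comm.
Qed.

Definition phi_cap (beta c y : R) : R := capped c (lattice_dist (2 * beta) y).

Lemma cont_phi_cap beta c : 0 < beta -> cont (phi_cap beta c).
Proof.
  intros Hb; apply (cont_comp (capped c)); [apply cont_capped|].
  apply lipschitz_cont; intros; apply lattice_dist_lipschitz; lra.
Qed.

Lemma phi_cap_small beta c u : 0 < beta -> 0 <= u <= beta -> phi_cap beta c u = capped c u.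
Proof. intros Hb Hu; unfold phi_cap; rewrite lattice_dist_small; auto; lra. Qed.

Lemma phi_cap_opp beta c y : 0 < beta -> phi_cap beta c (- y) = phi_cap beta c y.
Proof. intros Hb; unfold phi_cap; rewrite lattice_dist_opp; auto; lra. Qed.

Lemma phi_cap_period beta c y : 0 < beta -> phi_cap beta c (y + 2 * beta) = phi_cap beta c y.
Proof. intros Hb; unfold phi_cap; rewrite lattice_dist_period; auto; lra. Qed.

Lemma phi_cap_bands beta c u : 0 < beta -> 0 <= u <= beta ->
  phi_cap beta c u = capped c u /\ phi_cap beta c (4 * beta - u) = capped c u /\
  phi_cap beta c (2 * beta + u) = capped c u /\ phi_cap beta c (2 * beta - u) = capped c u.
Proof.
  intros Hb Hu; rewrite <- (phi_cap_small beta c u) by assumption; repeat split.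
  - rewrite <- (phi_cap_opp _ _ u), <- (phi_cap_period _ _ (- u)),
      <- (phi_cap_period _ _ (- u + _)) by assumption; f_equal; ring.
  - rewrite <- (phi_cap_period _ _ u) by assumption; f_equal; ring.
  - rewrite <- (phi_cap_opp _ _ u), <- (phi_cap_period _ _ (- u)) by assumption; f_equal; ring.
Qed.

Lemma phi_beta_cap beta c s : 0 < beta -> is_profile beta c s ->
  forall p, phi_beta beta p = phi_cap beta c (snd p).
Proof. intros Hb H [x y]; apply (phi_beta_capped beta c s); assumption. Qed.

Lemma L2dot_phi_beta beta c s f : 0 < beta -> is_profile beta c s ->
  cont f -> A_invariant f -> B_invariant beta f ->
  L2dot beta f (phi_beta beta) = RInt (fun u => capped c u * band_sum beta f u) 0 beta.
Proof.
  intros Hb Hp Hf HA HB.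
  rewrite <- (intK_bands beta f (capped c) (phi_cap beta c));
    auto using cont_phi_cap, phi_cap_bands; [|lra].
  unfold L2dot, intK; apply RInt_ext; intros x _; apply RInt_ext; intros y _.
  rewrite (phi_beta_cap beta c s) by assumption; reflexivity.
Qed.

Lemma phi_beta_invariant beta c s : 0 < beta -> is_profile beta c s ->
  cont (phi_beta beta) /\ A_invariant (phi_beta beta) /\ B_invariant beta (phi_beta beta).
Proof.
  intros Hb Hp; assert (E := phi_beta_cap beta c s Hb Hp); split; [|split].
  - apply cont_ext with (fun p => phi_cap beta c (snd p)); [intros; symmetry; apply E|].
    assert (H := cont_phi_cap beta c Hb); cont_tac.
  - intros x y; rewrite !E; simpl; apply phi_cap_opp, Hb.
  - intros x y; rewrite !E; simpl.
    replace (y + 4 * beta) with (y + 2 * beta + 2 * beta) by ring.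
    rewrite !phi_cap_period by assumption; reflexivity.
Qed.

Lemma L2dot_phi_beta_self beta c s : 0 < beta -> is_profile beta c s ->
  L2dot beta (phi_beta beta) (phi_beta beta) = 4 * PI * RInt (fun u => capped c u ^ 2) 0 beta.
Proof.
  intros Hb Hp; destruct (phi_beta_invariant beta c s Hb Hp) as [H1 [H2 H3]].
  assert (HC := cont_capped c).
  rewrite (L2dot_phi_beta beta c s), <- I_scal by (assumption || cont_tac).
  apply I_ext; [lra|]; intros u Hu.
  assert (E := phi_beta_cap beta c s Hb Hp).
  assert (E1 : circle_int (phi_beta beta) u = 2 * PI * capped c u).
  { unfold circle_int; transitivity (RInt (fun _ => capped c u) 0 (2 * PI)).
    - apply RInt_ext; intros; rewrite E; simpl; apply phi_cap_small; assumption.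
    - rewrite I_const; ring. }
  assert (E2 : circle_int (half_shift beta (phi_beta beta)) u = 2 * PI * capped c u).
  { unfold circle_int; transitivity (RInt (fun _ => capped c u) 0 (2 * PI)).
    - apply RInt_ext; intros; unfold half_shift; rewrite E; simpl.
      rewrite phi_cap_period by assumption; apply phi_cap_small; assumption.
    - rewrite I_const; ring. }
  unfold band_sum; rewrite E1, E2; ring.
Qed.

(** The integral inequality behind stability. The total mass of the loops is the squared norm of
    [phi_beta] divided by [PI], as [f = phi_beta] and [sigma = PI] must give equality. The weight is
    decomposed as [(phi0 - c) + c] with vertical loops, and as [phi0] on [[0, s]], [c] on
    [[s, beta]] with horizontal ones. *)
Lemma L2dot_phi_beta_ge beta c s f sigma : 0 < beta -> is_profile beta c s ->
  cont f -> A_invariant f -> B_invariant beta f -> loops_ge beta f sigma ->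
  sigma * (L2dot beta (phi_beta beta) (phi_beta beta) / PI) <= L2dot beta f (phi_beta beta).
Proof.
  intros Hb Hp Hf HA HB HL; assert (P := PI_RGT_0).
  rewrite (L2dot_phi_beta_self beta c s), (L2dot_phi_beta beta c s f) by assumption.
  destruct Hp as [_ [Hc [Hs [Hcs [Hlo [Hhi Hreg]]]]]].
  assert (C0 := cont_phi0); assert (CC := cont_capped c); assert (CS := cont_band_sum beta f Hf).
  assert (CI1 := cont_circle_int f Hf).
  assert (CI2 := cont_circle_int _ (half_shift_cont beta f Hf)).
  assert (SplitN : RInt (fun u => capped c u ^ 2) 0 beta =
    RInt (fun u => phi0 u ^ 2) 0 s + (beta - s) * c ^ 2).
  { rewrite <- (I_chasles _ 0 s beta) by cont_tac; rewrite <- I_const; f_equal;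
      apply RInt_ext; intros u; rewrite Rmin_left, Rmax_right by lra; intros Hu;
      unfold capped; [rewrite Rmax_left | rewrite Rmax_right]; auto. }
  assert (SplitF : RInt (fun u => capped c u * band_sum beta f u) 0 beta =
    RInt (fun u => phi0 u * band_sum beta f u) 0 s + c * RInt (band_sum beta f) s beta).
  { rewrite <- (I_chasles _ 0 s beta) by cont_tac; rewrite <- I_scal by cont_tac; f_equal;
      apply RInt_ext; intros u; rewrite Rmin_left, Rmax_right by lra; intros Hu;
      unfold capped; [rewrite Rmax_left | rewrite Rmax_right]; auto. }
  (* Great circles around both invariant circles together. For [s = 0] the bound [d <= phi0 s] may
     fail, but the integrals are empty. *)
  assert (GC : forall d, 0 <= d -> (s = 0 \/ d <= phi0 s) ->
    4 * sigma * RInt (fun y => phi0 y * (phi0 y - d)) 0 s <=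
    RInt (fun y => band_sum beta f y * (phi0 y - d)) 0 s).
  { intros d Hd [Z|Hds].
    - rewrite Z, !(RInt_point (V := R_CompleteNormedModule)); unfold zero; simpl; lra.
    - assert (G1 := great_circle_ineq beta f sigma s d Hf HA HL (proj1 Hs) (conj Hd Hds)).
      assert (G2 := great_circle_ineq beta (half_shift beta f) sigma s d
        (half_shift_cont _ _ Hf) (half_shift_A _ _ HA HB) (loops_ge_half_shift _ _ _ HL)
        (proj1 Hs) (conj Hd Hds)).
      rewrite (RInt_ext (fun y => band_sum beta f y * (phi0 y - d))
        (fun y => circle_int f y * (phi0 y - d) + circle_int (half_shift beta f) y * (phi0 y - d)))
        by (intros; unfold band_sum; inR; ring).
      rewrite I_plus by cont_tac; lra. }
  assert (ExpN : forall d, RInt (fun y => phi0 y * (phi0 y - d)) 0 s =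
    RInt (fun u => phi0 u ^ 2) 0 s - d * RInt phi0 0 s).
  { intros d; rewrite <- I_scal, <- I_minus by cont_tac; apply RInt_ext; intros; inR; ring. }
  assert (ExpF : forall d, RInt (fun y => band_sum beta f y * (phi0 y - d)) 0 s =
    RInt (fun u => phi0 u * band_sum beta f u) 0 s - d * RInt (band_sum beta f) 0 s).
  { intros d; rewrite <- I_scal, <- I_minus by cont_tac; apply RInt_ext; intros; inR; ring. }
  rewrite SplitN, SplitF.
  replace (sigma * (4 * PI * (RInt (fun u => phi0 u ^ 2) 0 s + (beta - s) * c ^ 2) / PI)) with
    (4 * sigma * (RInt (fun u => phi0 u ^ 2) 0 s + (beta - s) * c ^ 2)) by (inR; field; lra).
  destruct Hreg as [HV|[Hc2 _]].
  (* The vertical loops are counted [c] times; the defining equation of [c] makes the terms without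
     [f] add up to the squared norm. *)
  - assert (G := GC c ltac:(lra) Hcs); rewrite ExpN, ExpF in G.
    rewrite (RInt_capped beta c s) in HV by assumption.
    assert (V : PI * sigma <= RInt (band_sum beta f) 0 beta).
    { eapply Rle_trans; [apply (vertical_ge beta f sigma Hb Hf HL)|].
      apply Req_le; transitivity (intK beta (fun p => f p * 1)).
      - unfold intK; apply RInt_ext; intros x _; apply RInt_ext; intros y _; inR; ring.
      - rewrite (intK_bands beta f (fun _ => 1) (fun _ => 1)); auto using @cont_const; [|lra].
        apply RInt_ext; intros; apply Rmult_1_l. }
    rewrite <- (I_chasles (band_sum beta f) 0 s beta) in V by assumption.
    assert (V' := Rmult_le_compat_l c _ _ ltac:(lra) V).
    assert (HV' : c * (PI * sigma) = 4 * sigma * c * (RInt phi0 0 s + (beta - s) * c))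
      by (rewrite <- HV; inR; ring).
    rewrite HV' in V'. nra.
  (* The horizontal loops supply [2 * sigma] per unit height, which equals the required
     [4 * sigma * c] because [c = 1/2]. *)
  - assert (G := GC 0 ltac:(lra) (or_intror (Rlt_le _ _ (phi0_pos s)))).
    rewrite ExpN, ExpF in G.
    assert (Hh : (beta - s) * (2 * sigma) <= RInt (band_sum beta f) s beta).
    { rewrite <- I_const; apply I_le; [lra | cont_tac | cont_tac |]; intros y _.
      assert (A1 := circle_int_ge beta f sigma y Hf HL).
      assert (A2 := circle_int_ge beta _ sigma y (half_shift_cont _ _ Hf)
        (loops_ge_half_shift _ _ _ HL)).
      unfold band_sum; lra. }
    rewrite Hc2; nra.
Qed.

(** * Lower bounds for lengths *)

(** A function with nonpositive upper derivative does not increase, even if it is nowhere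
    differentiable. At the supremum of the times satisfying the bound with slope [eps], the estimate
    to the left shows that the supremum is attained, the one to the right that it is 1. *)
Lemma growth_le (D : R -> R) :
  (forall t eps, 0 <= t <= 1 -> 0 < eps -> exists d, 0 < d /\ forall t', Rabs (t' - t) < d ->
     (t <= t' -> D t' - D t <= eps * (t' - t)) /\ (t' <= t -> D t - D t' <= eps * (t - t'))) ->
  D 1 <= D 0.
Proof.
  intros H; apply le_epsilon; intros eps He.
  set (E := fun t => 0 <= t <= 1 /\ D t - D 0 <= eps * t).
  assert (E0 : E 0) by (unfold E; lra).
  destruct (completeness E) as [m [Hub Hlub]].
  { exists 1; intros t [Ht _]; lra. }
  { exists 0; exact E0. }
  assert (Hm0 : 0 <= m) by (apply Hub, E0).
  assert (Hm1 : m <= 1) by (apply Hlub; intros t [Ht _]; lra).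
  destruct (H m eps (conj Hm0 Hm1) He) as [d [Hd Hloc]].
  assert (Em : E m).
  { assert (X : exists t, E t /\ m - d < t).
    { apply NNPP; intros N.
      assert (m <= m - d); [|lra].
      apply Hlub; intros t Et; destruct (Rle_dec t (m - d)); [assumption|].
      exfalso; apply N; exists t; split; [exact Et | lra]. }
    destruct X as [t [Et Ht]]; assert (t <= m) by (apply Hub, Et).
    destruct Et as [Ht1 Et].
    destruct (Hloc t) as [_ L]; [apply Rabs_def1; lra|].
    split; [lra|]; specialize (L ltac:(lra)); lra. }
  destruct (Rlt_dec m 1) as [L|L].
  - exfalso; set (t := Rmin (m + d / 2) 1).
    assert (Ht : m < t <= m + d / 2 /\ t <= 1).
    { unfold t, Rmin; destruct Rle_dec; lra. }
    destruct (Hloc t) as [G _]; [apply Rabs_def1; lra|].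
    specialize (G ltac:(lra)); destruct Em as [_ Em].
    assert (t <= m); [|lra].
    apply Hub; split; lra.
  - replace m with 1 in Em by lra; destruct Em as [_ Em]; lra.
Qed.

(** A bound for the norm of the gradient that still makes sense at the kinks which folding
    creates. *)
Definition slope_le (Psi psi : pt -> R) : Prop :=
  forall p eps, 0 < eps -> exists d, 0 < d /\ forall q,
    Rabs (fst q - fst p) < d -> Rabs (snd q - snd p) < d ->
    Rabs (Psi q - Psi p) <= (psi p + eps) * sqrt ((fst q - fst p) ^ 2 + (snd q - snd p) ^ 2).

Lemma Rabs_le_norm a b : Rabs a <= sqrt (a ^ 2 + b ^ 2) /\ Rabs b <= sqrt (a ^ 2 + b ^ 2).
Proof.
  split; rewrite <- sqrt_Rsqr_abs; apply sqrt_le_1_alt; unfold Rsqr; nra.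
Qed.

Lemma norm_perturb a b e f : sqrt ((a + e) ^ 2 + (b + f) ^ 2) <= sqrt (a ^ 2 + b ^ 2) + Rabs e + Rabs f.
Proof.
  destruct (Rabs_le_norm a b) as [Ha Hb].
  assert (S2 := pow2_sqrt (a ^ 2 + b ^ 2) ltac:(nra)); set (S := sqrt (a ^ 2 + b ^ 2)) in *.
  assert (He := Rabs_pos e); assert (Hf := Rabs_pos f); assert (H0 : 0 <= S) by apply sqrt_pos.
  rewrite <- (sqrt_pow2 (S + Rabs e + Rabs f)) by lra.
  apply sqrt_le_1_alt.
  assert (P1 : a * e <= S * Rabs e).
  { eapply Rle_trans; [apply Rle_abs|]; rewrite Rabs_mult; apply Rmult_le_compat_r; assumption. }
  assert (P2 : b * f <= S * Rabs f).
  { eapply Rle_trans; [apply Rle_abs|]; rewrite Rabs_mult; apply Rmult_le_compat_r; assumption. }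
  assert (Q1 := pow2_abs e); assert (Q2 := pow2_abs f).
  assert (0 <= Rabs e * Rabs f) by (apply Rmult_le_pos; assumption).
  nra.
Qed.

Definition speed (c1 c2 : R -> R) (t : R) : R := sqrt (Derive c1 t ^ 2 + Derive c2 t ^ 2).

Lemma derivable_lim_mult (f : R -> R) t l eps : is_derive f t l -> 0 < eps ->
  exists d, 0 < d /\ forall h, Rabs h < d -> Rabs (f (t + h) - f t - l * h) <= eps * Rabs h.
Proof.
  intros H He; apply is_derive_Reals in H; destruct (H eps He) as [d Hd].
  exists d; split; [apply cond_pos|]; intros h Hh.
  destruct (Req_dec h 0) as [->|N].
  - rewrite Rplus_0_r, Rabs_R0, Rmult_0_r, Rmult_0_r, Rminus_diag, Rminus_0_r, Rabs_R0; lra.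
  - specialize (Hd h N Hh).
    replace (f (t + h) - f t - l * h) with (((f (t + h) - f t) / h - l) * h) by (field; exact N).
    rewrite Rabs_mult; apply Rmult_le_compat_r; [apply Rabs_pos | lra].
Qed.

Lemma slope_along_curve Psi psi c1 c2 t eps : slope_le Psi psi -> (forall p, 0 <= psi p) ->
  C1_curve c1 c2 -> 0 < eps ->
  exists d, 0 < d /\ forall h, Rabs h < d ->
    Rabs (Psi (c1 (t + h), c2 (t + h)) - Psi (c1 t, c2 t)) <=
    (psi (c1 t, c2 t) * speed c1 c2 t + eps) * Rabs h.
Proof.
  intros HP Hpos [HD _] He.
  set (m := psi (c1 t, c2 t)); set (v := speed c1 c2 t).
  assert (Hm : 0 <= m) by apply Hpos; assert (Hv : 0 <= v) by apply sqrt_pos.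
  (* Chosen so that [(m + e) * (v + 2 * e) <= m * v + eps]: [e] perturbs the slope once and the
     velocity in each coordinate. *)
  set (e := Rmin 1 (eps / (2 * m + v + 2))).
  assert (He1 : 0 < e) by (apply Rmin_pos; [lra | apply Rdiv_lt_0_compat; lra]).
  assert (He2 : (m + e) * (v + 2 * e) <= m * v + eps).
  { assert (A : e <= 1) by apply Rmin_l.
    assert (B : e * (2 * m + v + 2) <= eps).
    { apply Rle_trans with (eps / (2 * m + v + 2) * (2 * m + v + 2)).
      - apply Rmult_le_compat_r; [lra | apply Rmin_r].
      - apply Req_le; field; lra. }
    nra. }
  destruct (HP (c1 t, c2 t) e He1) as [d0 [Hd0 S]]; simpl in S; fold m in S.
  destruct (derivable_lim_mult c1 t _ e (Derive_correct _ _ (proj1 (HD t))) He1) as [d1 [Hd1 L1]].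
  destruct (derivable_lim_mult c2 t _ e (Derive_correct _ _ (proj2 (HD t))) He1) as [d2 [Hd2 L2]].
  set (l1 := Derive c1 t) in *; set (l2 := Derive c2 t) in *.
  set (M := Rabs l1 + Rabs l2 + 2).
  assert (pl1 := Rabs_pos l1); assert (pl2 := Rabs_pos l2).
  assert (Hd3 : 0 < d0 / M) by (apply Rdiv_lt_0_compat; unfold M; lra).
  exists (Rmin (d0 / M) (Rmin d1 d2)); split; [repeat apply Rmin_pos; assumption|].
  intros h Hh.
  assert (Hh0 := Rlt_le_trans _ _ _ Hh (Rmin_l _ _)).
  assert (Hh' := Rlt_le_trans _ _ _ Hh (Rmin_r _ _)).
  specialize (L1 h (Rlt_le_trans _ _ _ Hh' (Rmin_l _ _))).
  specialize (L2 h (Rlt_le_trans _ _ _ Hh' (Rmin_r _ _))).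
  set (r1 := c1 (t + h) - c1 t - l1 * h) in *; set (r2 := c2 (t + h) - c2 t - l2 * h) in *.
  assert (E1 : c1 (t + h) - c1 t = l1 * h + r1) by (unfold r1; ring).
  assert (E2 : c2 (t + h) - c2 t = l2 * h + r2) by (unfold r2; ring).
  assert (ph := Rabs_pos h).
  assert (eA : e <= 1) by apply Rmin_l.
  assert (bnd : forall l r, Rabs l + 1 <= M -> Rabs r <= e * Rabs h -> Rabs (l * h + r) < d0).
  { intros l r HM Hr; eapply Rle_lt_trans; [apply Rabs_triang|]; rewrite Rabs_mult.
    apply Rle_lt_trans with (M * Rabs h); [nra|].
    apply Rlt_le_trans with (M * (d0 / M)).
    - apply Rmult_lt_compat_l; [unfold M; lra | exact Hh0].
    - apply Req_le; field; unfold M; lra. }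
  eapply Rle_trans.
  - apply (S (c1 (t + h), c2 (t + h))); simpl; [rewrite E1 | rewrite E2]; apply bnd; auto; unfold M; lra.
  - simpl fst; simpl snd; rewrite E1, E2.
    apply Rle_trans with ((m + e) * ((v + 2 * e) * Rabs h)).
    + apply Rmult_le_compat_l; [lra|].
      eapply Rle_trans; [apply norm_perturb|].
      replace ((l1 * h) ^ 2 + (l2 * h) ^ 2) with (h² * (l1 ^ 2 + l2 ^ 2)) by (unfold Rsqr; ring).
      rewrite sqrt_mult_alt, sqrt_Rsqr_abs by apply Rle_0_sqr.
      change (sqrt (l1 ^ 2 + l2 ^ 2)) with v; lra.
    + rewrite <- Rmult_assoc; apply Rmult_le_compat_r; assumption.
Qed.

Lemma cont_length_integrand psi c1 c2 : cont psi -> C1_curve c1 c2 ->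
  cont (fun t => psi (c1 t, c2 t) * speed c1 c2 t).
Proof.
  intros Hc [HD HC].
  assert (A1 : cont c1) by (apply cont_ex_derive; intros; exact (proj1 (HD x))).
  assert (A2 : cont c2) by (apply cont_ex_derive; intros; exact (proj2 (HD x))).
  assert (A3 : cont (Derive c1)) by (intros x; exact (proj1 (HC x))).
  assert (A4 : cont (Derive c2)) by (intros x; exact (proj2 (HC x))).
  unfold speed; cont_tac.
Qed.

(** A function whose slope is at most the conformal factor is 1-Lipschitz for the metric, so its
    increment bounds the length from below. Each of the three kinds of deck transformation gets its
    own [Psi]. *)
Lemma eikonal Psi psi c1 c2 : slope_le Psi psi -> (forall p, 0 <= psi p) -> cont psi ->
  C1_curve c1 c2 ->
  Rabs (Psi (c1 1, c2 1) - Psi (c1 0, c2 0)) <= curve_length psi c1 c2.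
Proof.
  assert (W : forall Psi, slope_le Psi psi -> (forall p, 0 <= psi p) -> cont psi ->
    C1_curve c1 c2 -> Psi (c1 1, c2 1) - Psi (c1 0, c2 0) <= curve_length psi c1 c2).
  { clear Psi; intros Psi HS Hpos Hc HC.
    set (m := fun t => psi (c1 t, c2 t) * speed c1 c2 t).
    assert (Cm : cont m) by (apply cont_length_integrand; assumption).
    set (D := fun t => Psi (c1 t, c2 t) - RInt m 0 t).
    assert (G : D 1 <= D 0).
    { apply growth_le; intros t eps _ He.
      assert (He2 : 0 < eps / 2) by lra.
      destruct (slope_along_curve Psi psi c1 c2 t _ HS Hpos HC He2) as [d1 [Hd1 L1]].
      destruct (derivable_lim_mult _ t _ _ (derive_I m 0 t Cm) He2) as [d2 [Hd2 L2]].
      exists (Rmin d1 d2); split; [apply Rmin_pos; assumption|]; intros t' Ht'.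
      specialize (L1 _ (Rlt_le_trans _ _ _ Ht' (Rmin_l _ _))).
      specialize (L2 _ (Rlt_le_trans _ _ _ Ht' (Rmin_r _ _))).
      replace (t + (t' - t)) with t' in L1, L2 by ring.
      change (psi (c1 t, c2 t) * speed c1 c2 t) with (m t) in L1.
      apply Rabs_le_between in L1; apply Rabs_le_between in L2.
      cbv beta in L2; unfold D; split; intros Ht.
      - rewrite Rabs_pos_eq in L1, L2 by lra; lra.
      - rewrite Rabs_left1 in L1, L2 by lra; lra. }
    unfold D in G; rewrite (RInt_point (V := R_CompleteNormedModule)) in G.
    unfold zero in G; simpl in G; unfold curve_length.
    change (Psi (c1 1, c2 1) - Psi (c1 0, c2 0) <= RInt m 0 1); lra. }
  intros HS Hpos Hc HC; apply Rabs_le; split; [|apply W; assumption].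
  assert (X := W (fun p => - Psi p)); cbv beta in X.
  enough (- Psi (c1 1, c2 1) - - Psi (c1 0, c2 0) <= curve_length psi c1 c2) by lra.
  apply X; auto.
  intros p eps He; destruct (HS p eps He) as [d [Hd L]]; exists d; split; [exact Hd|].
  intros q H1 H2; replace (- Psi q - - Psi p) with (- (Psi q - Psi p)) by ring.
  rewrite Rabs_Ropp; auto.
Qed.

(** * Distance functions of the round sphere *)

Lemma is_derive_asin z : -1 < z < 1 -> is_derive asin z (/ sqrt (1 - z ^ 2)).
Proof.
  intros Hz; apply is_derive_Reals.
  replace (/ sqrt (1 - z ^ 2)) with (derive_pt asin z (derivable_pt_asin z Hz)).
  - apply (derive_pt_eq_1 _ _ _ (derivable_pt_asin z Hz)); reflexivity.
  - rewrite derive_pt_asin; unfold Rsqr, Rdiv; rewrite Rmult_1_l; f_equal; f_equal; ring.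
Qed.

(* Inner product in R^3 with the point of the unit sphere whose Mercator
   coordinates are [(x0, y0)], where [A = / cosh y0] and [B = tanh y0]. *)
Definition sphere_dot (A B x0 : R) (p : pt) : R :=
  (A * cos (fst p - x0) + B * sinh (snd p)) / cosh (snd p).

(** [sphere_dot] is the cosine of the distance to a fixed point, so its spherical gradient has the
    sine as norm. The left side is the squared Euclidean gradient multiplied by [cosh y ^ 2]. *)
Lemma sphere_dot_gradient A B x0 x y : A ^ 2 + B ^ 2 = 1 ->
  (A * sin (x - x0)) ^ 2 + ((B - A * cos (x - x0) * sinh y) / cosh y) ^ 2 =
  1 - sphere_dot A B x0 (x, y) ^ 2.
Proof.
  intros E; unfold sphere_dot; simpl fst; simpl snd.
  assert (C := cosh_pos y); assert (S := cosh_sqr y); assert (T := cos_sqr (x - x0)).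
  set (s := sin (x - x0)) in *; set (c := cos (x - x0)) in *.
  set (ch := cosh y) in *; set (sh := sinh y) in *.
  apply Rmult_eq_reg_r with (ch ^ 2); [|nra].
  transitivity (A ^ 2 * (s * s) * ch ^ 2 + (B - A * c * sh) ^ 2); [field; lra|].
  transitivity (ch ^ 2 - (A * c + B * sh) ^ 2); [|field; lra].
  rewrite S; replace (s * s) with (1 - c * c) by lra.
  assert (E' : B ^ 2 = 1 - A ^ 2) by lra.
  transitivity (A ^ 2 * (1 - c * c) * (1 + sh ^ 2) + B ^ 2 - 2 * B * A * c * sh
    + A ^ 2 * c ^ 2 * sh ^ 2); [ring|].
  transitivity (1 + sh ^ 2 - A ^ 2 * c ^ 2 - 2 * A * c * B * sh - B ^ 2 * sh ^ 2); [|ring].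
  rewrite E'; ring.
Qed.

Lemma cauchy_schwarz2 a b u v : Rabs (a * u + b * v) <= sqrt (a ^ 2 + b ^ 2) * sqrt (u ^ 2 + v ^ 2).
Proof.
  rewrite <- sqrt_mult_alt by nra; rewrite <- sqrt_Rsqr_abs; apply sqrt_le_1_alt.
  unfold Rsqr; assert (0 <= (a * v - b * u) ^ 2) by apply pow2_ge_0; nra.
Qed.

(** For [k = 1] the function would be [PI / 2] minus the spherical distance, not differentiable at
    two antipodal points. With [k < 1] the argument of [asin] stays inside [(-1, 1)], and the slope
    bound survives because [k * sqrt (1 - h ^ 2) <= sqrt (1 - (k * h) ^ 2)]. *)
Lemma slope_sphere A B x0 k : A ^ 2 + B ^ 2 = 1 -> 0 < k < 1 ->
  slope_le (fun p => asin (k * sphere_dot A B x0 p)) (fun p => phi0 (snd p)).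
Proof.
  (* The radius [eps] works since the mean value theorem evaluates [phi0] at a point between [y] and
     [y'], and [phi0] is 1-Lipschitz. *)
  intros E Hk [x y] eps He; exists eps; split; [exact He|]; intros [x' y'] _ Hy; simpl in Hy |- *.
  set (u := x' - x); set (v := y' - y) in *.
  set (X := fun t => x + t * u); set (Y := fun t => y + t * v).
  set (hx := fun t => - (A * sin (X t - x0)) / cosh (Y t)).
  set (hy := fun t => (B - A * cos (X t - x0) * sinh (Y t)) / cosh (Y t) ^ 2).
  set (H := fun t => sphere_dot A B x0 (X t, Y t)).
  assert (HH : forall t, H t ^ 2 <= 1).
  { intros t; assert (G := sphere_dot_gradient A B x0 (X t) (Y t) E).
    assert (0 <= (A * sin (X t - x0)) ^ 2) by apply pow2_ge_0.
    assert (0 <= ((B - A * cos (X t - x0) * sinh (Y t)) / cosh (Y t)) ^ 2) by apply pow2_ge_0.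
    unfold H; lra. }
  assert (DH : forall t, is_derive H t (hx t * u + hy t * v)).
  { intros t; unfold H, sphere_dot, hx, hy; simpl fst; simpl snd.
    assert (C := cosh_pos (Y t)).
    assert (D1 : is_derive (fun t => sinh (Y t)) t (v * cosh (Y t))).
    { apply (is_derive_comp sinh Y); [apply is_derive_Reals, derivable_pt_lim_sinh|].
      unfold Y; auto_derive; [exact I | ring]. }
    assert (D2 : is_derive (fun t => cosh (Y t)) t (v * sinh (Y t))).
    { apply (is_derive_comp cosh Y); [apply is_derive_Reals, derivable_pt_lim_cosh|].
      unfold Y; auto_derive; [exact I | ring]. }
    assert (D3 : is_derive (fun t => A * cos (X t - x0)) t (- (A * sin (X t - x0)) * u)).
    { unfold X; auto_derive; [exact I | unfold Rminus; ring]. }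
    assert (D4 : is_derive (fun t => A * cos (X t - x0) + B * sinh (Y t)) t
      (- (A * sin (X t - x0)) * u + B * (v * cosh (Y t)))).
    { apply (is_derive_plus (fun t => A * cos (X t - x0))); [exact D3|].
      apply (is_derive_scal (fun t => sinh (Y t))); exact D1. }
    assert (D5 := is_derive_div _ _ t _ _ D4 D2 (Rgt_not_eq _ _ C)).
    assert (S := cosh_sqr (Y t)).
    evar_last; [exact D5|]; cbv beta.
    set (ch := cosh (Y t)) in *; set (sh := sinh (Y t)) in *.
    transitivity ((- (A * sin (X t - x0)) * u) / ch +
      (B * (ch ^ 2 - sh ^ 2) - A * cos (X t - x0) * sh) / ch ^ 2 * v); [field; lra|].
    replace (ch ^ 2 - sh ^ 2) with 1 by lra; field; lra. }
  assert (range : forall t, -1 < k * H t < 1).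
  { intros t; specialize (HH t); assert (-1 <= H t <= 1) by nra; nra. }
  assert (DA : forall t, is_derive (fun t => asin (k * H t)) t
    (k * (hx t * u + hy t * v) * / sqrt (1 - (k * H t) ^ 2))).
  { intros t; apply (is_derive_comp asin (fun t => k * H t)).
    - apply is_derive_asin, range.
    - apply (is_derive_scal H), DH. }
  destruct (MVT_gen (fun t => asin (k * H t)) 0 1 _ (fun t _ => DA t)) as [t [Ht Et]].
  { intros t _; apply continuity_pt_filterlim.
    apply (@ex_derive_continuous R_AbsRing R_NormedModule (fun t => asin (k * H t))).
    eexists; apply DA. }
  rewrite Rmin_left, Rmax_right in Ht by lra.
  unfold H at 1 2, X at 1 2, Y at 1 2 in Et.
  rewrite !Rmult_0_l, !Rmult_1_l, !Rplus_0_r, Rminus_0_r, Rmult_1_r in Et.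
  replace (x + u) with x' in Et by (unfold u; ring).
  replace (y + v) with y' in Et by (unfold v; ring).
  rewrite Et.
  set (n := sqrt (u ^ 2 + v ^ 2)).
  assert (Hn : 0 <= n) by apply sqrt_pos.
  assert (C := cosh_pos (Y t)).
  assert (Rt : 0 < sqrt (1 - (k * H t) ^ 2)).
  { apply sqrt_lt_R0; specialize (range t); nra. }
  apply Rle_trans with (phi0 (Y t) * n).
  - rewrite Rabs_mult, (Rabs_pos_eq (/ _)) by (apply Rlt_le, Rinv_0_lt_compat, Rt).
    apply Rmult_le_reg_r with (sqrt (1 - (k * H t) ^ 2)); [exact Rt|].
    rewrite Rmult_assoc, Rinv_l, Rmult_1_r by lra.
    rewrite Rabs_mult, (Rabs_pos_eq k) by lra.
    apply Rle_trans with (k * (sqrt (hx t ^ 2 + hy t ^ 2) * n)).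
    { apply Rmult_le_compat_l; [lra | apply cauchy_schwarz2]. }
    assert (G := sphere_dot_gradient A B x0 (X t) (Y t) E).
    change (sphere_dot A B x0 (X t, Y t)) with (H t) in G.
    assert (EG : hx t ^ 2 + hy t ^ 2 = (1 - H t ^ 2) * phi0 (Y t) ^ 2).
    { rewrite <- G, phi0_cosh; unfold hx, hy; field; lra. }
    rewrite EG, sqrt_mult_alt, sqrt_pow2 by (try apply Rlt_le, phi0_pos; specialize (HH t); lra).
    assert (Q : k * sqrt (1 - H t ^ 2) <= sqrt (1 - (k * H t) ^ 2)).
    { rewrite <- (sqrt_pow2 k) at 1 by lra; rewrite <- sqrt_mult_alt by nra.
      apply sqrt_le_1_alt; nra. }
    assert (0 <= phi0 (Y t) * n) by (apply Rmult_le_pos; [apply Rlt_le, phi0_pos | exact Hn]).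
    apply Rle_trans with (k * sqrt (1 - H t ^ 2) * (phi0 (Y t) * n)); [apply Req_le; ring|].
    rewrite (Rmult_comm (phi0 (Y t) * n)); apply Rmult_le_compat_r; assumption.
  - apply Rmult_le_compat_r; [exact Hn|].
    assert (L := phi0_lipschitz (Y t) y); apply Rabs_le_between in L.
    assert (Rabs (Y t - y) <= Rabs v); [|lra].
    unfold Y; replace (y + t * v - y) with (t * v) by ring.
    rewrite Rabs_mult, (Rabs_pos_eq t) by lra.
    rewrite <- (Rmult_1_l (Rabs v)) at 2; apply Rmult_le_compat_r; [apply Rabs_pos | lra].
Qed.

(** * Deck transformations, folding and the three kinds of loops *)

Lemma in_Gamma_form beta g : in_Gamma beta g -> exists j m : Z,
  (forall x y, g (x, y) = (x + 2 * IZR j * PI, y + 4 * beta * IZR m)) \/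
  (forall x y, g (x, y) = (x + (2 * IZR j + 1) * PI, - y + 4 * beta * IZR m)).
Proof.
  intros Hg; induction Hg as [|g _ [j [m [E|E]]]|g _ [j [m [E|E]]]|g _ [j [m [E|E]]]|g _ [j [m [E|E]]]].
  - exists 0%Z, 0%Z; left; intros; f_equal; ring.
  - exists j, (- m)%Z; right; intros; rewrite E; unfold isoA; simpl; rewrite opp_IZR; f_equal; ring.
  - exists (j + 1)%Z, (- m)%Z; left; intros; rewrite E; unfold isoA; simpl;
      rewrite opp_IZR, plus_IZR; f_equal; ring.
  - exists (j - 1)%Z, (- m)%Z; right; intros; rewrite E; unfold isoAinv; simpl;
      rewrite opp_IZR, minus_IZR; f_equal; ring.
  - exists j, (- m)%Z; left; intros; rewrite E; unfold isoAinv; simpl; rewrite opp_IZR; f_equal; ring.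
  - exists j, (m + 1)%Z; left; intros; rewrite E; unfold isoB; simpl; rewrite plus_IZR; f_equal; ring.
  - exists j, (m + 1)%Z; right; intros; rewrite E; unfold isoB; simpl; rewrite plus_IZR; f_equal; ring.
  - exists j, (m - 1)%Z; left; intros; rewrite E; unfold isoBinv; simpl; rewrite minus_IZR; f_equal; ring.
  - exists j, (m - 1)%Z; right; intros; rewrite E; unfold isoBinv; simpl; rewrite minus_IZR; f_equal; ring.
Qed.

(* Folds the plane onto the band [|y| <= beta] along the lines [y = beta + 2 beta k]. *)
Definition fold (beta y : R) : R := lattice_dist (4 * beta) (y + beta) - beta.

Lemma fold_lipschitz beta y z : 0 < beta -> Rabs (fold beta y - fold beta z) <= Rabs (y - z).
Proof.
  intros Hb; unfold fold.
  replace (lattice_dist (4 * beta) (y + beta) - beta - (lattice_dist (4 * beta) (z + beta) - beta))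
    with (lattice_dist (4 * beta) (y + beta) - lattice_dist (4 * beta) (z + beta)) by ring.
  replace (y - z) with ((y + beta) - (z + beta)) by ring.
  apply lattice_dist_lipschitz; lra.
Qed.

(** After folding, every element of the group with an odd power of [A] acts as the antipodal map. *)
Lemma fold_glide beta y m : 0 < beta -> fold beta (- y + 4 * beta * IZR m) = - fold beta y.
Proof.
  intros Hb; unfold fold.
  replace (- y + 4 * beta * IZR m + beta) with (4 * beta / 2 - (y + beta) + 4 * beta * IZR m) by field.
  rewrite lattice_dist_shift, lattice_dist_half by lra; field.
Qed.

Lemma Rabs_fold beta y : 0 < beta -> Rabs (fold beta y) = lattice_dist (2 * beta) y.
Proof.
  intros Hb; unfold fold; symmetry.
  destruct (lattice_dist_spec (4 * beta) (y + beta) ltac:(lra)) as [t [k [Ht [[E|E] ->]]]].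
  - apply lattice_dist_unique with (k := (2 * k)%Z); [lra | |].
    + split; [apply Rabs_pos | apply Rabs_le; lra].
    + rewrite mult_IZR; unfold Rabs; destruct Rcase_abs; [right | left]; lra.
  - apply lattice_dist_unique with (k := (2 * k - 1)%Z); [lra | |].
    + split; [apply Rabs_pos | apply Rabs_le; lra].
    + rewrite minus_IZR, mult_IZR; unfold Rabs; destruct Rcase_abs; [left | right]; lra.
Qed.

Lemma phi0_fold beta y : 0 < beta -> phi0 (fold beta y) = phi0 (lattice_dist (2 * beta) y).
Proof.
  intros Hb; rewrite <- Rabs_fold by exact Hb.
  unfold Rabs; destruct Rcase_abs; [rewrite phi0_even|]; reflexivity.
Qed.

Lemma cos_period_Z x k : cos (x + 2 * IZR k * PI) = cos x.
Proof.
  destruct (Z_le_gt_dec 0 k) as [H|H].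
  - rewrite <- (cos_period x (Z.to_nat k)), INR_IZR_INZ, Z2Nat.id by lia; reflexivity.
  - rewrite <- (cos_period _ (Z.to_nat (- k))); f_equal.
    rewrite INR_IZR_INZ, Z2Nat.id, opp_IZR by lia; ring.
Qed.

Lemma cos_odd_PI j : cos ((2 * IZR j + 1) * PI) = -1.
Proof.
  rewrite <- cos_PI, <- (cos_period_Z PI j); f_equal; ring.
Qed.

(** [A] and [B] are the coordinates of the folded initial point. Along the folded curve its inner
    product with the moving point goes from 1 to -1, so the approximate distance changes by
    [2 * asin k], which tends to [PI] as [k] tends to 1. *)
Lemma length_ge_PI_odd beta c c1 c2 j m : 0 < beta -> C1_curve c1 c2 ->
  c1 1 = c1 0 + (2 * IZR j + 1) * PI -> c2 1 = - c2 0 + 4 * beta * IZR m ->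
  PI <= curve_length (fun p => phi_cap beta c (snd p)) c1 c2.
Proof.
  intros Hb HC E1 E2.
  assert (P := PI_RGT_0); assert (Cc := cont_phi_cap beta c Hb).
  set (L := curve_length _ c1 c2).
  set (n0 := fold beta (c2 0)).
  set (A := / cosh n0); set (B := sinh n0 / cosh n0).
  assert (C := cosh_pos n0); assert (S := cosh_sqr n0).
  assert (EAB : A ^ 2 + B ^ 2 = 1).
  { unfold A, B; transitivity ((1 + sinh n0 ^ 2) / cosh n0 ^ 2); [field; lra|].
    rewrite <- S; field; nra. }
  assert (key : forall k, 0 < k < 1 -> 2 * asin k <= L).
  { intros k Hk.
    set (Psi := fun p : pt => asin (k * sphere_dot A B (c1 0) (fst p, fold beta (snd p)))).
    (* Folding does not increase distances, and [phi0] at the folded height is at most [phi_cap]. *)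
    assert (HS : slope_le Psi (fun p => phi_cap beta c (snd p))).
    { intros [x y] eps He.
      destruct (slope_sphere A B (c1 0) k EAB Hk (x, fold beta y) eps He) as [d [Hd HL]].
      exists d; split; [exact Hd|]; intros [x' y'] Hx Hy; cbn [fst snd] in *.
      assert (F := fold_lipschitz beta y' y Hb).
      eapply Rle_trans; [apply (HL (x', fold beta y')); cbn [fst snd]; [exact Hx | lra]|]; cbn [fst snd].
      assert (p0 := phi0_pos (fold beta y)).
      apply Rmult_le_compat; [lra | apply sqrt_pos | |].
      - apply Rplus_le_compat_r; rewrite phi0_fold by exact Hb; apply Rmax_l.
      - apply sqrt_le_1_alt, Rplus_le_compat_l.
        rewrite <- (pow2_abs (fold beta y' - fold beta y)), <- (pow2_abs (y' - y)).
        apply pow_incr; split; [apply Rabs_pos | exact F]. }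
    assert (R := eikonal Psi (fun p => phi_cap beta c (snd p)) c1 c2 HS).
    assert (R' := R ltac:(intros p; apply Rle_trans with (phi0 (lattice_dist (2 * beta) (snd p)));
       [apply Rlt_le, phi0_pos | apply Rmax_l]) ltac:(cont_tac) HC).
    fold L in R'; unfold Psi in R'; simpl fst in R'; simpl snd in R'.
    rewrite E2, fold_glide in R' by exact Hb; fold n0 in R'; unfold sphere_dot in R'.
    simpl fst in R'; simpl snd in R'.
    rewrite E1 in R'; replace (c1 0 + (2 * IZR j + 1) * PI - c1 0) with ((2 * IZR j + 1) * PI) in R' by ring.
    rewrite cos_odd_PI, Rminus_diag, cos_0, cosh_even in R'.
    assert (Es : sinh (- n0) = - sinh n0) by (unfold sinh; rewrite Ropp_involutive; field).
    rewrite Es in R'.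
    assert (Z1 : (A * 1 + B * sinh n0) / cosh n0 = 1).
    { transitivity (A ^ 2 + B ^ 2); [unfold A, B; field; lra | exact EAB]. }
    assert (Z2 : (A * -1 + B * - sinh n0) / cosh n0 = -1).
    { transitivity (- ((A * 1 + B * sinh n0) / cosh n0)); [field; lra | rewrite Z1; reflexivity]. }
    rewrite Z1, Z2 in R'.
    replace (k * -1) with (- k) in R' by ring; rewrite Rmult_1_r, asin_opp in R'.
    rewrite <- Rabs_Ropp in R'; eapply Rle_trans; [|exact R'].
    eapply Rle_trans; [|apply Rle_abs]; lra. }
  destruct (Rle_dec PI L) as [H|H]; [exact H|exfalso].
  (* If [L < PI], then [2 * th] is the mean of [Rmax 0 L] and [PI], hence larger than [L], while
     [th] stays inside [(0, PI / 2)]; so [k = sin th] contradicts [key]. *)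
  set (th := (Rmax 0 L + PI) / 4).
  assert (M := Rmax_l 0 L); assert (M2 := Rmax_r 0 L).
  assert (M3 : Rmax 0 L < PI) by (apply Rmax_lub_lt; lra).
  assert (Hth : 0 < th < PI / 2) by (unfold th; lra).
  assert (K := key (sin th)).
  rewrite asin_sin in K by lra.
  assert (2 * th <= L); [|unfold th in *; lra].
  apply K; split; [apply sin_gt_0; lra|].
  rewrite <- sin_PI2; apply sin_increasing_1; lra.
Qed.

Lemma phi_cap_ge beta c y : c <= phi_cap beta c y.
Proof. apply Rmax_r. Qed.

Lemma RInt_phi_cap beta c : 0 < beta -> RInt (phi_cap beta c) 0 (4 * beta) = 4 * RInt (capped c) 0 beta.
Proof.
  intros Hb; assert (Cc := cont_capped c).
  rewrite RInt_quarters by (apply cont_phi_cap || lra; assumption).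
  rewrite <- I_scal by assumption; apply I_ext; [lra|]; intros u Hu.
  destruct (phi_cap_bands beta c u Hb Hu) as [-> [-> [-> ->]]]; ring.
Qed.

(** Only the vertical motion is measured: [Psi] is the primitive of the profile, and its increment
    is an integral over at least one full period. *)
Lemma length_ge_vertical beta c c1 c2 m : 0 < beta -> 0 <= c -> C1_curve c1 c2 -> m <> 0%Z ->
  c2 1 = c2 0 + 4 * beta * IZR m ->
  4 * RInt (capped c) 0 beta <= curve_length (fun p => phi_cap beta c (snd p)) c1 c2.
Proof.
  intros Hb Hc HC Hm E; assert (Cc := cont_phi_cap beta c Hb).
  set (Psi := fun p : pt => RInt (phi_cap beta c) 0 (snd p)).
  assert (Hge : forall y, 0 <= phi_cap beta c y).
  { intros y; eapply Rle_trans; [exact Hc | apply phi_cap_ge]. }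
  assert (HS : slope_le Psi (fun p => phi_cap beta c (snd p))).
  { intros [x y] eps He.
    destruct (derivable_lim_mult _ y _ _ (derive_I _ 0 y Cc) He) as [d [Hd L]].
    exists d; split; [exact Hd|]; intros [x' y'] _ Hy; simpl in *.
    specialize (L _ Hy); replace (y + (y' - y)) with y' in L by ring.
    apply Rle_trans with ((phi_cap beta c y + eps) * Rabs (y' - y)).
    - replace (Psi (x', y') - Psi (x, y)) with
       ((RInt (phi_cap beta c) 0 y' - RInt (phi_cap beta c) 0 y - phi_cap beta c y * (y' - y))
        + phi_cap beta c y * (y' - y)) by (unfold Psi; simpl; inR; ring).
      eapply Rle_trans; [apply Rabs_triang|].
      rewrite (Rabs_mult (phi_cap beta c y)), (Rabs_pos_eq (phi_cap beta c y)) by apply Hge; lra.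
    - apply Rmult_le_compat_l; [specialize (Hge y); lra|].
      rewrite !Rmult_1_r.
      destruct (Rabs_le_norm (x' - x) (y' - y)) as [_ H]; simpl in H; rewrite !Rmult_1_r in H; exact H. }
  assert (R := eikonal Psi (fun p => phi_cap beta c (snd p)) c1 c2 HS (fun p => Hge (snd p))
     ltac:(cont_tac) HC).
  eapply Rle_trans; [|exact R]; unfold Psi; simpl.
  replace (RInt (phi_cap beta c) 0 (c2 1) - RInt (phi_cap beta c) 0 (c2 0)) with
    (RInt (phi_cap beta c) (c2 0) (c2 1))
    by (rewrite <- (I_chasles (phi_cap beta c) 0 (c2 0) (c2 1) Cc); inR; ring).
  rewrite E; clear R E.
  assert (W : forall a n, 1 <= IZR n ->
    4 * RInt (capped c) 0 beta <= RInt (phi_cap beta c) a (a + 4 * beta * IZR n)).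
  { intros a n Hn; rewrite <- RInt_phi_cap by exact Hb.
    rewrite <- (I_period (phi_cap beta c) (4 * beta) a) by
     (try assumption; intros y; replace (y + 4 * beta) with (y + 2 * beta + 2 * beta) by ring;
      rewrite !phi_cap_period by exact Hb; reflexivity).
    rewrite <- (I_chasles (phi_cap beta c) a (a + 4 * beta) (a + 4 * beta * IZR n)) by assumption.
    assert (0 <= RInt (phi_cap beta c) (a + 4 * beta) (a + 4 * beta * IZR n)); [|lra].
    apply I_ge0; auto; nra. }
  destruct (IZR_sign m) as [H|[H|H]].
  - rewrite (I_swap (phi_cap beta c)), Rabs_Ropp by assumption; eapply Rle_trans; [|apply Rle_abs].
    assert (W' := W (c2 0 + 4 * beta * IZR m) (- m)%Z); rewrite opp_IZR in W'.
    replace (c2 0 + 4 * beta * IZR m + 4 * beta * - IZR m) with (c2 0) in W' by ring.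
    apply W'; lra.
  - apply eq_IZR in H; contradiction.
  - eapply Rle_trans; [|apply Rle_abs]; apply W, H.
Qed.

(** The test function [x / 2] has slope [1/2 <= c], and the loop moves by at least [2 * PI] in
    [x]. *)
Lemma length_ge_horizontal beta c c1 c2 j : 0 < beta -> / 2 <= c -> C1_curve c1 c2 -> j <> 0%Z ->
  c1 1 = c1 0 + 2 * IZR j * PI ->
  PI <= curve_length (fun p => phi_cap beta c (snd p)) c1 c2.
Proof.
  intros Hb Hc HC Hj E; assert (Cc := cont_phi_cap beta c Hb); assert (P := PI_RGT_0).
  assert (HS : slope_le (fun p => / 2 * fst p) (fun p => phi_cap beta c (snd p))).
  { intros [x y] eps He; exists 1; split; [lra|]; intros [x' y'] _ _; simpl.
    rewrite <- Rmult_minus_distr_l, Rabs_mult, (Rabs_pos_eq (/ 2)) by lra.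
    assert (G := phi_cap_ge beta c y).
    apply Rmult_le_compat; [lra | apply Rabs_pos | lra |].
    rewrite !Rmult_1_r.
    destruct (Rabs_le_norm (x' - x) (y' - y)) as [H _]; simpl in H; rewrite !Rmult_1_r in H; exact H. }
  assert (R := eikonal _ (fun p => phi_cap beta c (snd p)) c1 c2 HS).
  eapply Rle_trans; [|apply R; [|cont_tac|exact HC]].
  - simpl; rewrite E.
    destruct (IZR_sign j) as [H|[H|H]].
    + rewrite <- Rabs_Ropp; eapply Rle_trans; [|apply Rle_abs]; nra.
    + apply eq_IZR in H; contradiction.
    + eapply Rle_trans; [|apply Rle_abs]; nra.
  - intros p; assert (G := phi_cap_ge beta c (snd p)); lra.
Qed.

Lemma phi_beta_loops beta c s : 0 < beta -> is_profile beta c s -> loops_ge beta (phi_beta beta) PI.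
Proof.
  intros Hb Hp c1 c2 [HC [g [Hg [Hn He]]]].
  replace (curve_length (phi_beta beta) c1 c2) with
    (curve_length (fun p => phi_cap beta c (snd p)) c1 c2).
  2:{ apply RInt_ext; intros t _; rewrite (phi_beta_cap beta c s) by assumption; reflexivity. }
  destruct Hp as [_ [Hc [_ [_ [_ [_ Hreg]]]]]].
  destruct (in_Gamma_form beta g Hg) as [j [m [E|E]]]; rewrite E in He; injection He; intros E2 E1.
  - destruct (Z.eq_dec j 0) as [Hj|Hj]; [|apply (length_ge_horizontal beta c c1 c2 j); assumption].
    destruct (Z.eq_dec m 0) as [Hm|Hm].
    + exfalso; apply Hn, functional_extensionality; intros [x y].
      rewrite E, Hj, Hm; f_equal; ring.
    + eapply Rle_trans; [|apply (length_ge_vertical beta c c1 c2 m); auto; lra].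
      destruct Hreg as [H|[_ H]]; lra.
  - apply (length_ge_PI_odd beta c c1 c2 j m); assumption.
Qed.

(** * Systole and stability *)

Lemma noncontractible_loop_exists beta : exists c1 c2, noncontractible_loop beta c1 c2.
Proof.
  assert (P := PI_RGT_0).
  exists (fun t => PI * t), (fun _ => 0).
  destruct (loop_of beta (fun t => PI * t) (fun _ => 0) (fun _ => PI) (fun _ => 0)
    (fun p => isoA p)) as [H _]; [| | cont_tac | cont_tac | | | | exact H].
  - intros t; auto_derive; [exact I | ring].
  - intros t; auto_derive; [exact I | ring].
  - apply (Gamma_A beta (fun p => p)), Gamma_id.
  - unfold isoA; simpl; intros Z; injection Z; lra.
  - unfold isoA; simpl; f_equal; ring.
Qed.

Lemma curve_length_ge0 f c1 c2 : cont f -> (forall p, 0 <= f p) -> C1_curve c1 c2 ->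
  0 <= curve_length f c1 c2.
Proof.
  intros Hf Hp HC; apply (I_ge0 (fun t => f (c1 t, c2 t) * speed c1 c2 t)); [lra| |].
  - apply cont_length_integrand; assumption.
  - intros t _; apply Rmult_le_pos; [apply Hp | apply sqrt_pos].
Qed.

Lemma curve_length_le f g K c1 c2 : cont f -> cont g -> (forall p, f p <= K * g p) ->
  C1_curve c1 c2 -> curve_length f c1 c2 <= K * curve_length g c1 c2.
Proof.
  intros Hf Hg H HC.
  assert (C1 := cont_length_integrand f c1 c2 Hf HC).
  assert (C2 := cont_length_integrand g c1 c2 Hg HC).
  change (RInt (fun t => f (c1 t, c2 t) * speed c1 c2 t) 0 1 <=
    K * RInt (fun t => g (c1 t, c2 t) * speed c1 c2 t) 0 1).
  rewrite <- I_scal by exact C2.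
  apply I_le; [lra | exact C1 | apply cont_mult; [apply cont_const | exact C2] |].
  intros t _; rewrite <- Rmult_assoc; apply Rmult_le_compat_r; [apply sqrt_pos | apply H].
Qed.

(** The infimum in [sys] is an extended real, and [real] sends infinite values to 0. A loop exists
    and lengths are nonnegative, so the infimum is finite and [real] is harmless. *)
Lemma sys_spec beta f : cont f -> (forall p, 0 <= f p) ->
  loops_ge beta f (sys beta f) /\ (forall sigma, loops_ge beta f sigma -> sigma <= sys beta f).
Proof.
  intros Hf Hp; unfold sys.
  set (E := fun L => exists c1 c2, noncontractible_loop beta c1 c2 /\ L = curve_length f c1 c2).
  destruct (Glb_Rbar_correct E) as [Hlb Hglb].
  assert (B0 : is_lb_Rbar E (Finite 0)).
  { intros L [c1 [c2 [[HC _] ->]]]; simpl; apply curve_length_ge0; assumption. }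
  assert (Fin : exists l, Glb_Rbar E = Finite l).
  { destruct (noncontractible_loop_exists beta) as [c1 [c2 HL]].
    assert (H1 : Rbar_le (Glb_Rbar E) (Finite (curve_length f c1 c2))) by (apply Hlb; exists c1, c2; auto).
    assert (H2 := Hglb _ B0).
    destruct (Glb_Rbar E) as [l| |]; simpl in *; [exists l; reflexivity | contradiction..]. }
  destruct Fin as [l El]; rewrite El in *; simpl; split.
  - intros c1 c2 HL; apply (Hlb (curve_length f c1 c2)); exists c1, c2; auto.
  - intros sigma Hs; apply (Hglb (Finite sigma)); intros L [c1 [c2 [HL ->]]]; apply Hs, HL.
Qed.

Lemma sys_compare beta f g K : cont f -> cont g -> (forall p, 0 <= f p) -> (forall p, 0 <= g p) ->
  0 < K -> (forall p, f p <= K * g p) -> sys beta f <= K * sys beta g.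
Proof.
  intros Hf Hg Pf Pg HK H.
  destruct (sys_spec beta f Hf Pf) as [Lf _]; destruct (sys_spec beta g Hg Pg) as [_ Gg].
  assert (sys beta f / K <= sys beta g).
  { apply Gg; intros c1 c2 HL.
    apply Rmult_le_reg_l with K; [exact HK|].
    replace (K * (sys beta f / K)) with (sys beta f) by (field; lra).
    eapply Rle_trans; [apply Lf, HL|]; apply curve_length_le; auto; apply HL. }
  apply Rmult_le_compat_l with (r := K) in H0; [|lra].
  replace (K * (sys beta f / K)) with (sys beta f) in H0 by (field; lra); exact H0.
Qed.

Lemma sys_phi_beta beta c s : 0 < beta -> is_profile beta c s -> sys beta (phi_beta beta) = PI.
Proof.
  intros Hb Hp; assert (P := PI_RGT_0).
  assert (E := phi_beta_cap beta c s Hb Hp).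
  destruct (phi_beta_invariant beta c s Hb Hp) as [H1 [H2 H3]].
  assert (HL := phi_beta_loops beta c s Hb Hp).
  destruct Hp as [_ [Hc [_ [_ [_ [_ Hreg]]]]]].
  assert (H0 : forall p, 0 <= phi_beta beta p).
  { intros p; rewrite E; assert (G := phi_cap_ge beta c (snd p)); lra. }
  destruct (sys_spec beta (phi_beta beta) H1 H0) as [L G].
  apply Rle_antisym; [|apply G, HL].
  (* Loops of length [PI]: the vertical ones, averaged over [x], in the first case; in the second
     the equator [b = 0], where [phi_beta = phi0 0 = 1]. *)
  destruct Hreg as [HV|[Hc2 _]].
  - assert (V := vertical_ge beta _ _ Hb H1 L).
    apply Rmult_le_reg_l with PI; [lra|]; eapply Rle_trans; [exact V|].
    apply Req_le; unfold intK.
    transitivity ((PI - 0) * RInt (phi_cap beta c) 0 (4 * beta)).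
    + rewrite <- I_const.
      apply RInt_ext; intros x _; apply RInt_ext; intros y _; apply E.
    + rewrite RInt_phi_cap, HV by exact Hb; ring.
  - assert (V := great_circle_length beta _ _ 0 0 H1 L).
    eapply Rle_trans; [exact V|]; apply Req_le.
    transitivity (RInt (fun _ => 1) 0 PI); [|rewrite I_const; ring].
    apply RInt_ext; intros x _; rewrite E; simpl snd.
    rewrite !Rmult_0_l, arcsinh_0, phi_cap_small by lra.
    unfold capped; rewrite phi0_0, Rmax_left by lra.
    replace (1 + 0 ^ 2) with 1 by ring; rewrite sqrt_1; inR; field.
Qed.

Lemma cont_intK_inner beta h : cont h -> cont (fun x : R => RInt (fun y => h (x, y)) 0 (4 * beta)).
Proof. apply cont_param2. Qed.

Lemma intK_plus beta f g : cont f -> cont g ->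
  intK beta (fun p => f p + g p) = intK beta f + intK beta g.
Proof.
  intros Hf Hg; assert (A := cont_intK_inner beta f Hf); assert (B := cont_intK_inner beta g Hg).
  unfold intK; rewrite <- I_plus by assumption.
  apply RInt_ext; intros x _; rewrite I_plus by cont_tac; reflexivity.
Qed.

Lemma intK_scal beta k f : cont f -> intK beta (fun p => k * f p) = k * intK beta f.
Proof.
  intros Hf; assert (A := cont_intK_inner beta f Hf).
  unfold intK; rewrite <- I_scal by assumption.
  apply RInt_ext; intros x _; rewrite I_scal by cont_tac; reflexivity.
Qed.

Lemma intK_ext beta f g : (forall p, f p = g p) -> intK beta f = intK beta g.
Proof. intros H; unfold intK; apply RInt_ext; intros x _; apply RInt_ext; intros y _; apply H. Qed.

Lemma intK_le beta f g : 0 < beta -> cont f -> cont g -> (forall p, f p <= g p) ->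
  intK beta f <= intK beta g.
Proof.
  intros Hb Hf Hg H; assert (P := PI_RGT_0).
  apply I_le; [lra | apply cont_intK_inner, Hf | apply cont_intK_inner, Hg |].
  intros x _; apply I_le; [lra | cont_tac | cont_tac |]; intros; apply H.
Qed.

Lemma L2dot_sub_scal beta f g k : cont f -> cont g ->
  L2dot beta (fun p => f p - k * g p) (fun p => f p - k * g p) =
  area beta f - 2 * k * L2dot beta f g + k ^ 2 * L2dot beta g g.
Proof.
  intros Hf Hg; unfold L2dot, area.
  rewrite (intK_ext beta _ (fun p => f p ^ 2 + ((-2 * k) * (f p * g p) + k ^ 2 * (g p * g p))))
    by (intros; ring).
  rewrite !intK_plus, !intK_scal by cont_tac; ring.
Qed.

(** * Vanishing integrals, the fundamental domain and positivity *)

Lemma RInt_eq0 (h : R -> R) a b : a < b -> cont h -> (forall x, a <= x <= b -> 0 <= h x) ->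
  RInt h a b = 0 -> forall x, a <= x <= b -> h x = 0.
Proof.
  intros Hab Hh Hp HI x Hx.
  destruct (Hp x Hx) as [Hpos|]; [exfalso | auto].
  assert (C := cont_continuity_pt h Hh x).
  destruct (C (h x / 2) ltac:(lra)) as [d [Hd HC]].
  set (u := Rmax a (x - d / 2)); set (v := Rmin b (x + d / 2)).
  assert (Huv : a <= u /\ u < v /\ v <= b /\ x - d / 2 <= u /\ v <= x + d / 2).
  { unfold u, v, Rmax, Rmin; destruct Rle_dec, Rle_dec; lra. }
  assert (L : (v - u) * (h x / 2) <= RInt h u v).
  { rewrite <- I_const; apply I_le; [lra | cont_tac | assumption |]; intros z Hz.
    destruct (Req_dec x z) as [->|N]; [lra|].
    assert (D : R_dist (h z) (h x) < h x / 2).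
    { apply (HC z); split; [split; [exact I | exact N]|].
      simpl; unfold R_dist; apply Rabs_def1; lra. }
    unfold R_dist in D; apply Rabs_def2 in D; lra. }
  assert (A := I_ge0 h a u ltac:(lra) Hh ltac:(intros; apply Hp; lra)).
  assert (B := I_ge0 h v b ltac:(lra) Hh ltac:(intros; apply Hp; lra)).
  rewrite <- (I_chasles h a u b), <- (I_chasles h u v b) in HI by assumption.
  assert (0 < (v - u) * (h x / 2)) by (apply Rmult_lt_0_compat; lra).
  lra.
Qed.

Lemma intK_eq0 beta h : 0 < beta -> cont h -> (forall p, 0 <= h p) -> intK beta h = 0 ->
  forall x y, 0 <= x <= PI -> 0 <= y <= 4 * beta -> h (x, y) = 0.
Proof.
  intros Hb Hh Hp HI x y Hx Hy; assert (P := PI_RGT_0).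
  apply (RInt_eq0 (fun y => h (x, y)) 0 (4 * beta)); auto; [lra | cont_tac|].
  apply (RInt_eq0 (fun x => RInt (fun y => h (x, y)) 0 (4 * beta)) 0 PI); auto.
  - apply cont_intK_inner, Hh.
  - intros z _; apply I_ge0; [lra | cont_tac | auto].
Qed.

Lemma mod_exists P x : 0 < P -> exists r k, 0 <= r <= P /\ x = r + P * IZR k.
Proof.
  intros HP; destruct (base_Int_part (x / P)) as [H1 H2].
  exists (x - P * IZR (Int_part (x / P))), (Int_part (x / P)); split; [|ring].
  assert (E : x = P * (x / P)) by (field; lra); rewrite E at 1 3; nra.
Qed.

Lemma period_Z (h : R -> R) P : (forall x, h (x + P) = h x) -> forall k x, h (x + P * IZR k) = h x.
Proof.
  intros H; assert (N : forall n x, h (x + P * INR n) = h x).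
  { induction n as [|n IH]; intros x; [simpl; f_equal; ring|].
    rewrite <- (IH x), <- (H (x + P * INR n)), S_INR; f_equal; ring. }
  intros k x; destruct (Z_le_gt_dec 0 k) as [Hk|Hk].
  - rewrite <- (N (Z.to_nat k) x), INR_IZR_INZ, Z2Nat.id by lia; reflexivity.
  - rewrite <- (N (Z.to_nat (- k))); f_equal.
    rewrite INR_IZR_INZ, Z2Nat.id, opp_IZR by lia; ring.
Qed.

(** The representative is chosen before [f], so that two invariant functions can be compared at the
    same point. *)
Lemma fundamental_domain beta p : 0 < beta -> exists x y, 0 <= x <= PI /\ 0 <= y <= 4 * beta /\
  forall f, A_invariant f -> B_invariant beta f -> f p = f (x, y).
Proof.
  intros Hb; destruct p as [x y]; assert (P := PI_RGT_0).
  destruct (mod_exists (2 * PI) x ltac:(lra)) as [r [k [Hr Ex]]].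
  assert (X : exists x' y', 0 <= x' <= PI /\ forall f, A_invariant f -> f (x, y) = f (x', y')).
  { assert (R : forall f, A_invariant f -> f (x, y) = f (r, y)).
    { intros f HA; rewrite Ex; apply (period_Z (fun x => f (x, y))).
      intros; apply A_invariant_2PI, HA. }
    destruct (Rle_dec r PI) as [L|L].
    - exists r, y; split; [lra | exact R].
    - exists (r - PI), (- y); split; [lra|]; intros f HA; rewrite (R f HA).
      rewrite <- (HA (r - PI) (- y)), Ropp_involutive; f_equal; f_equal; ring. }
  destruct X as [x' [y' [Hx' X]]].
  destruct (mod_exists (4 * beta) y' ltac:(lra)) as [t [m [Ht Ey]]].
  exists x', t; repeat split; try lra; intros f HA HB.
  rewrite (X f HA), Ey; apply (period_Z (fun y => f (x', y))); intros; apply HB.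
Qed.

Lemma positive_min beta f : 0 < beta -> cont f -> (forall p, 0 < f p) ->
  A_invariant f -> B_invariant beta f -> exists d, 0 < d /\ forall p, d <= f p.
Proof.
  intros Hb Hf Hp HA HB.
  (* The radius is also made at most [f (x, y) / 2]; the uniform radius from compactness is then
     itself a lower bound for [f]. *)
  assert (L : forall x y, exists d : posreal, d <= f (x, y) / 2 /\
    forall x' y', Rabs (x' - x) < d -> Rabs (y' - y) < d -> f (x, y) / 2 < f (x', y')).
  { intros x y; assert (H := Hp (x, y)).
    assert (H2 : 0 < f (x, y) / 2) by lra.
    destruct (cont_2d f Hf x y (mkposreal _ H2)) as [d Hd]; simpl in Hd.
    assert (Hm : 0 < Rmin d (f (x, y) / 2)) by (apply Rmin_pos; [apply cond_pos | lra]).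
    exists (mkposreal _ Hm); simpl; split; [apply Rmin_r|]; intros x' y' Hx Hy.
    assert (G := Hd x' y' (Rlt_le_trans _ _ _ Hx (Rmin_l _ _)) (Rlt_le_trans _ _ _ Hy (Rmin_l _ _))).
    apply Rabs_def2 in G; lra. }
  set (delta := fun x y => proj1_sig (constructive_indefinite_description _ (L x y))).
  destruct (compactness_value_2d 0 PI 0 (4 * beta) delta) as [d Hd].
  exists d; split; [apply cond_pos|]; intros p.
  destruct (fundamental_domain beta p Hb) as [x [y [Hx [Hy E]]]]; rewrite (E f HA HB).
  apply Rnot_lt_le; intros N; apply (Hd x y Hx Hy).
  intros [u [v [_ [_ [H1 [H2 H3]]]]]]; revert H1 H2 H3; unfold delta.
  destruct (constructive_indefinite_description _ (L u v)) as [e [He1 He2]]; simpl.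
  intros H1 H2 H3; specialize (He2 x y H1 H2); lra.
Qed.

Lemma phi_beta_bounds beta c s p : 0 < beta -> is_profile beta c s ->
  / 2 <= phi_beta beta p <= Rmax 1 c.
Proof.
  intros Hb Hp; rewrite (phi_beta_cap beta c s) by assumption.
  destruct Hp as [_ [Hc _]]; split.
  - eapply Rle_trans; [exact Hc | apply phi_cap_ge].
  - unfold phi_cap, capped; apply Rmax_lub; [|apply Rmax_r].
    eapply Rle_trans; [apply phi0_le1 | apply Rmax_l].
Qed.

Lemma area_L2dot beta f : area beta f = L2dot beta f f.
Proof. apply intK_ext; intros; ring. Qed.

Lemma phi_beta_norm_pos beta c s : 0 < beta -> is_profile beta c s ->
  0 < L2dot beta (phi_beta beta) (phi_beta beta).
Proof.
  intros Hb Hp; destruct (phi_beta_invariant beta c s Hb Hp) as [H1 _]; assert (P := PI_RGT_0).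
  apply Rlt_le_trans with (intK beta (fun _ => / 4)).
  - unfold intK; rewrite (RInt_ext _ (fun _ => (4 * beta - 0) * / 4)) by (intros; apply I_const).
    rewrite I_const; apply Rmult_lt_0_compat; lra.
  - apply intK_le; [exact Hb | cont_tac | cont_tac |].
    intros p; assert (B := phi_beta_bounds beta c s p Hb Hp); nra.
Qed.

Lemma conf_factor_cont beta phi : conf_factor beta phi ->
  cont phi /\ (forall p, 0 < phi p) /\ A_invariant phi /\ B_invariant beta phi.
Proof.
  intros [HS [Hp HG]]; repeat split; auto.
  - exact (HS O).
  - apply (Gamma_invariant_A beta), HG.
  - apply Gamma_invariant_B, HG.
Qed.

(** By compactness [phi_beta] is at most a constant multiple of [phi], and the systole of [phi_beta]
    is [PI]. This makes the divisions by the squared systole meaningful. *)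
Lemma sys_pos beta c s phi : 0 < beta -> is_profile beta c s -> conf_factor beta phi ->
  0 < sys beta phi.
Proof.
  intros Hb Hp Hphi; destruct (conf_factor_cont beta phi Hphi) as [Hf [Hpos [HA HB]]].
  destruct (positive_min beta phi Hb Hf Hpos HA HB) as [d [Hd Hmin]].
  destruct (phi_beta_invariant beta c s Hb Hp) as [H1 _]; assert (P := PI_RGT_0).
  assert (M := Rmax_l 1 c).
  assert (HK : 0 < Rmax 1 c / d) by (apply Rdiv_lt_0_compat; lra).
  assert (S : sys beta (phi_beta beta) <= Rmax 1 c / d * sys beta phi).
  { apply sys_compare; auto.
    - intros p; assert (B := phi_beta_bounds beta c s p Hb Hp); lra.
    - intros p; apply Rlt_le, Hpos.
    - intros p; assert (B := phi_beta_bounds beta c s p Hb Hp).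
      apply Rle_trans with (Rmax 1 c / d * d); [|apply Rmult_le_compat_l; [lra | apply Hmin]].
      replace (Rmax 1 c / d * d) with (Rmax 1 c) by (field; lra); lra. }
  rewrite (sys_phi_beta beta c s) in S by assumption.
  apply Rmult_lt_reg_l with (Rmax 1 c / d); [exact HK | lra].
Qed.

Lemma alpha_phi_beta beta c s : 0 < beta -> is_profile beta c s ->
  alpha_sys beta (phi_beta beta) = L2dot beta (phi_beta beta) (phi_beta beta) / PI ^ 2.
Proof.
  intros Hb Hp; unfold alpha_sys; rewrite (sys_phi_beta beta c s), area_L2dot by assumption; reflexivity.
Qed.

Lemma alpha_stability beta c s phi : 0 < beta -> is_profile beta c s -> conf_factor beta phi ->
  L2dot beta (fun p => phi p - proj_phi_beta beta phi p)
             (fun p => phi p - proj_phi_beta beta phi p) / (sys beta phi) ^ 2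
    <= alpha_sys beta phi - alpha_sys beta (phi_beta beta).
Proof.
  intros Hb Hp Hphi; destruct (conf_factor_cont beta phi Hphi) as [Hf [Hpos [HA HB]]].
  assert (Hs := sys_pos beta c s phi Hb Hp Hphi); assert (P := PI_RGT_0).
  assert (HE := phi_beta_norm_pos beta c s Hb Hp).
  destruct (phi_beta_invariant beta c s Hb Hp) as [H1 _].
  destruct (sys_spec beta phi Hf (fun p => Rlt_le _ _ (Hpos p))) as [HL _].
  assert (K := L2dot_phi_beta_ge beta c s phi _ Hb Hp Hf HA HB HL).
  rewrite (alpha_phi_beta beta c s) by assumption; unfold alpha_sys, proj_phi_beta.
  rewrite (L2dot_sub_scal beta phi (phi_beta beta)) by assumption.
  set (E := L2dot beta (phi_beta beta) (phi_beta beta)) in *.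
  set (D := L2dot beta phi (phi_beta beta)) in *.
  set (S := sys beta phi) in *; set (a := area beta phi).
  (* This is Pythagoras; the remaining inequality is the square of [K] divided by [E * S ^ 2]. *)
  replace ((a - 2 * (D / E) * D + (D / E) ^ 2 * E) / S ^ 2) with (a / S ^ 2 - D ^ 2 / (E * S ^ 2))
    by (field; lra).
  enough (E / PI ^ 2 <= D ^ 2 / (E * S ^ 2)) by lra.
  replace (E / PI ^ 2) with ((S * (E / PI)) ^ 2 / (E * S ^ 2)) by (field; lra).
  apply Rmult_le_compat_r; [apply Rlt_le, Rinv_0_lt_compat; apply Rmult_lt_0_compat; [lra | nra]|].
  apply pow_incr; split; [|exact K].
  apply Rmult_le_pos; [lra | apply Rdiv_le_0_compat; lra].
Qed.

Lemma L2dot_self_ge0 beta f : 0 < beta -> cont f -> 0 <= L2dot beta f f.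
Proof.
  intros Hb Hf; assert (H : intK beta (fun _ => 0) <= L2dot beta f f).
  { apply intK_le; [exact Hb | cont_tac | cont_tac | intros p; nra]. }
  eapply Rle_trans; [|exact H]; apply Req_le; unfold intK.
  rewrite (RInt_ext _ (fun _ => (4 * beta - 0) * 0)) by (intros; apply I_const).
  rewrite I_const; ring.
Qed.

(** * Smooth approximation of [phi_beta] *)

(** A class closed under products and differentiation, which is what the recursion of [Ck] asks
    for. *)
Inductive trig_poly (w : R) : (R -> R) -> Prop :=
| trig_const c : trig_poly w (fun _ => c)
| trig_cos : trig_poly w (fun y => cos (w * y))
| trig_sin : trig_poly w (fun y => sin (w * y))
| trig_plus u v : trig_poly w u -> trig_poly w v -> trig_poly w (fun y => u y + v y)
| trig_mult u v : trig_poly w u -> trig_poly w v -> trig_poly w (fun y => u y * v y).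

Lemma trig_poly_derive w u : trig_poly w u ->
  exists u', trig_poly w u' /\ forall y, is_derive u y (u' y).
Proof.
  intros H; induction H as [c| | |u v Hu [u' [Tu Du]] Hv [v' [Tv Dv]]|u v Hu [u' [Tu Du]] Hv [v' [Tv Dv]]].
  - exists (fun _ => 0); split; [constructor|]; intros y; auto_derive; [exact I | ring].
  - exists (fun y => - w * sin (w * y)); split.
    + apply (trig_mult w (fun _ => - w) (fun y => sin (w * y))); constructor.
    + intros y; auto_derive; [exact I | ring].
  - exists (fun y => w * cos (w * y)); split.
    + apply (trig_mult w (fun _ => w) (fun y => cos (w * y))); constructor.
    + intros y; auto_derive; [exact I | ring].
  - exists (fun y => u' y + v' y); split; [constructor; assumption|].
    intros y; apply (is_derive_plus u v); auto.
  - exists (fun y => u' y * v y + u y * v' y); split; [repeat constructor; assumption|].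
    intros y; apply (is_derive_mult u v); auto; intros; apply Rmult_comm.
Qed.

Lemma trig_poly_smooth w u : trig_poly w u -> smooth (fun p => u (snd p)).
Proof.
  intros H n; revert u H; induction n as [|n IH]; intros u H;
    destruct (trig_poly_derive w u H) as [u' [Tu Du]];
    assert (Cu : cont u) by (apply cont_ex_derive; intros; eexists; apply Du);
    assert (C2 : cont (fun p : pt => u (snd p))) by cont_tac.
  - exact C2.
  - split; [exact C2|split; [|split]].
    + intros p; simpl; split; [apply ex_derive_const | eexists; apply Du].
    + replace (dx (fun p => u (snd p))) with (fun _ : pt => 0).
      * apply (IH (fun _ => 0)); constructor.
      * apply functional_extensionality; intros p; unfold dx; simpl; symmetry; apply Derive_const.
    + replace (dy (fun p => u (snd p))) with (fun p : pt => u' (snd p)).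
      * apply IH, Tu.
      * apply functional_extensionality; intros p; unfold dy; simpl; symmetry.
        apply is_derive_unique, Du.
Qed.

Lemma trig_poly_bern w u n : trig_poly w u -> forall g, trig_poly w (fun y => bern n g (u y)).
Proof.
  intros Hu; induction n as [|n IH]; intros g; simpl; [constructor|].
  apply (trig_plus w (fun y => u y * _) (fun y => (1 - u y) * _)).
  - apply (trig_mult w u (fun y => bern n (fun k => g (S k)) (u y))); auto.
  - apply (trig_mult w (fun y => 1 - u y) (fun y => bern n g (u y))); auto.
    replace (fun y => 1 - u y) with (fun y => 1 + (-1) * u y)
      by (apply functional_extensionality; intros; ring).
    apply (trig_plus w (fun _ => 1) (fun y => -1 * u y)); [constructor|].
    apply (trig_mult w (fun _ => -1) u); [constructor | exact Hu].
Qed.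

(** With [h = x / 2], [sin x = 2 * sin h * cos h]; on [[0, PI / 4]] the cosine is at least [q], so
    [sin h >= q * h], and [2 * q ^ 2 = 1]. *)
Lemma sin_ge_half x : 0 <= x <= PI / 2 -> x / 2 <= sin x.
Proof.
  intros Hx; assert (P := PI_RGT_0).
  set (h := x / 2); assert (Hh : 0 <= h <= PI / 4) by (unfold h; lra).
  set (q := cos (PI / 4)).
  assert (Hq : 0 <= q /\ q * q = / 2).
  { unfold q; split; [apply cos_ge_0; lra|].
    rewrite cos_PI4; assert (S := sqrt_sqrt 2 ltac:(lra)); assert (S2 := sqrt_lt_R0 2 ltac:(lra)).
    apply Rmult_eq_reg_r with (sqrt 2 * sqrt 2); [|lra].
    transitivity 1; [field; lra | rewrite S; field]. }
  assert (C : forall z, 0 <= z <= PI / 4 -> q <= cos z) by (intros; apply cos_decr_1; lra).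
  destruct (MVT_gen sin 0 h cos) as [z [Hz E]].
  - intros; apply is_derive_Reals, derivable_pt_lim_sin.
  - intros; apply continuity_sin.
  - rewrite Rmin_left, Rmax_right in Hz by lra.
    rewrite sin_0, !Rminus_0_r in E.
    assert (S : q * h <= sin h) by (rewrite E; apply Rmult_le_compat_r; [lra | apply C; lra]).
    replace x with (2 * h) by (unfold h; field); rewrite sin_2a.
    assert (C' := C h Hh).
    assert (q * h * q <= sin h * cos h) by (apply Rmult_le_compat; nra).
    nra.
Qed.

(** Hölder continuity of [acos] with exponent 1/2. For half difference [d] and mean [m], the cosines
    differ by [2 * sin d * sin m], and [sin m >= sin d >= d / 2] because [m] lies between [d] and
    [PI - d]. *)
Lemma cos_gap a b : 0 <= a <= PI -> 0 <= b <= PI -> (a - b) ^ 2 <= 8 * Rabs (cos a - cos b).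
Proof.
  assert (W : forall a b, 0 <= a <= b -> b <= PI -> (a - b) ^ 2 <= 8 * Rabs (cos a - cos b)).
  { clear; intros a b Ha Hb; assert (P := PI_RGT_0).
    rewrite form2.
    set (d := (b - a) / 2); set (m := (a + b) / 2).
    replace ((a - b) / 2) with (- d) by (unfold d; field); rewrite sin_neg.
    assert (Hd : 0 <= d <= PI / 2) by (unfold d; lra).
    assert (S1 := sin_ge_half d Hd).
    assert (S2 : sin d <= sin m).
    { destruct (Rle_dec m (PI / 2)) as [L|L].
      - apply sin_incr_1; unfold d, m in *; lra.
      - rewrite <- (sin_PI_x m); apply sin_incr_1; unfold d, m in *; lra. }
    replace (-2 * - sin d * sin m) with (2 * (sin d * sin m)) by ring.
    eapply Rle_trans; [|apply Rmult_le_compat_l; [lra | apply Rle_abs]].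
    replace ((a - b) ^ 2) with (4 * (d * d)) by (unfold d; field).
    assert (d / 2 * (d / 2) <= sin d * sin m) by (apply Rmult_le_compat; lra).
    lra. }
  intros Ha Hb; destruct (Rle_dec a b) as [L|L]; [apply W; lra|].
  replace ((a - b) ^ 2) with ((b - a) ^ 2) by ring; rewrite Rabs_minus_sym; apply W; lra.
Qed.

Lemma capped_lipschitz c x y : Rabs (capped c x - capped c y) <= Rabs (x - y).
Proof.
  eapply Rle_trans; [|apply phi0_lipschitz]; unfold capped.
  generalize (phi0 x) (phi0 y); intros a b.
  unfold Rmax; destruct (Rle_dec a c), (Rle_dec b c); unfold Rabs;
    repeat destruct Rcase_abs; lra.
Qed.

(** The approximation is a Bernstein polynomial in [(1 - cos (w * y)) / 2]. Its nodal values are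
    values of the profile, so as an average it keeps the lower bound [1/2], and as a function of the
    cosine it is invariant. *)
Lemma smooth_approx beta c s eps : 0 < beta -> is_profile beta c s -> 0 < eps ->
  exists phi, conf_factor beta phi /\ forall p, Rabs (phi_beta beta p - phi p) <= eps.
Proof.
  intros Hb Hp He; assert (P := PI_RGT_0).
  set (r := beta / PI); assert (Hr : 0 < r) by (apply Rdiv_lt_0_compat; lra).
  set (e := eps / 2); assert (He' : 0 < e) by (unfold e; lra).
  (* For the distance [d] of the heights belonging to [z] and [u y], [cos_gap] gives
     [d ^ 4 <= 256 * r ^ 4 * (z - u y) ^ 2]. Where [d > e], it follows that
     [d <= K * (z - u y) ^ 2], the form required by [bern_approx]. *)
  set (K := 256 * r ^ 4 / e ^ 3).
  assert (HK : 0 <= K).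
  { apply Rdiv_le_0_compat; [|apply pow_lt, He'].
    apply Rmult_le_pos; [lra | apply Rlt_le, pow_lt, Hr]. }
  destruct (archimed_div K e He') as [n [Hn HKn]].
  assert (HN : 0 < INR n) by (apply lt_0_INR; exact Hn).
  set (w := PI / beta).
  set (u := fun y => (1 - cos (w * y)) / 2).
  set (g := fun k => capped c (r * acos (1 - 2 * (INR k / INR n)))).
  assert (Hu : forall y, 0 <= u y <= 1) by (intros y; unfold u; assert (H := COS_bound (w * y)); lra).
  assert (Hc : / 2 <= c) by apply Hp.
  exists (fun p => bern n g (u (snd p))); split; [split; [|split]|].
  - apply (trig_poly_smooth w (fun y => bern n g (u y))), trig_poly_bern.
    replace u with (fun y => / 2 + - / 2 * cos (w * y))
      by (apply functional_extensionality; intros; unfold u; field).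
    apply (trig_plus w (fun _ => / 2) (fun y => - / 2 * cos (w * y))); [constructor|].
    apply (trig_mult w (fun _ => - / 2) (fun y => cos (w * y))); constructor.
  - intros p; apply Rlt_le_trans with (/ 2); [lra|].
    assert (B := bern_le n (fun k => / 2 + 0 * (INR k - 0) ^ 2) g (u (snd p)) (Hu _)).
    rewrite bern_quadratic, Rmult_0_l, Rplus_0_r in B; apply B.
    intros k _; rewrite Rmult_0_l, Rplus_0_r; eapply Rle_trans; [exact Hc | apply Rmax_r].
  - apply AB_invariant_Gamma.
    + intros x y; simpl; unfold u; rewrite Ropp_mult_distr_r_reverse, cos_neg; reflexivity.
    + intros x y; simpl; unfold u.
      replace (w * (y + 4 * beta)) with (w * y + 2 * IZR 2 * PI) by (unfold w; field; lra).
      rewrite cos_period_Z; reflexivity.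
  - intros p; rewrite (phi_beta_cap beta c s) by assumption.
    generalize (snd p); clear p; intros y.
    apply Rle_trans with (e + K / INR n); [|unfold e in *; lra].
    apply bern_approx; auto.
    intros k Hk.
    assert (Hk1 : 0 <= INR k / INR n <= 1).
    { split; [apply Rdiv_le_0_compat; [apply pos_INR | lra]|].
      apply Rmult_le_reg_r with (INR n); [lra|].
      replace (INR k / INR n * INR n) with (INR k) by (field; lra).
      rewrite Rmult_1_l; apply le_INR; exact Hk. }
    set (z := INR k / INR n) in *; unfold g; fold z.
    unfold phi_cap.
    assert (HT := lattice_dist_bounds (2 * beta) y ltac:(lra)).
    assert (Ecos : cos (w * y) = cos (w * lattice_dist (2 * beta) y)).
    { destruct (lattice_dist_spec (2 * beta) y ltac:(lra)) as [t [j [_ [[E|E] ->]]]].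
      - rewrite <- (cos_period_Z (w * t) j); f_equal; rewrite E; unfold w; field; lra.
      - rewrite <- cos_neg, <- (cos_period_Z (w * t) (- j)), opp_IZR; f_equal; rewrite E; unfold w; field; lra. }
    set (T := lattice_dist (2 * beta) y) in *.
    set (th := w * T); set (th' := acos (1 - 2 * z)).
    assert (Hth : 0 <= th <= PI).
    { assert (Hw : 0 < w) by (apply Rdiv_lt_0_compat; lra).
      unfold th; split; [apply Rmult_le_pos; lra|].
      apply Rle_trans with (w * beta); [apply Rmult_le_compat_l; lra | apply Req_le; unfold w; field; lra]. }
    assert (Hth' : 0 <= th' <= PI) by apply acos_bound.
    assert (Eth' : cos th' = 1 - 2 * z) by (apply cos_acos; lra).
    assert (Eth : cos th = 1 - 2 * u y) by (unfold u; rewrite Ecos; unfold th; field).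
    assert (G := cos_gap th th' Hth Hth'); rewrite Eth, Eth' in G.
    replace (1 - 2 * u y - (1 - 2 * z)) with (2 * (z - u y)) in G by ring.
    rewrite Rabs_mult, (Rabs_pos_eq 2) in G by lra.
    eapply Rle_trans; [apply capped_lipschitz|].
    replace (T - r * th') with (r * (th - th')) by (unfold r, th, w; field; lra).
    set (d := Rabs (r * (th - th'))).
    assert (Hd : d ^ 4 <= 256 * r ^ 4 * (z - u y) ^ 2).
    { replace (d ^ 4) with ((d ^ 2) ^ 2) by ring; unfold d; rewrite pow2_abs.
      replace (((r * (th - th')) ^ 2) ^ 2) with (r ^ 4 * ((th - th') ^ 2) ^ 2) by ring.
      rewrite <- (pow2_abs (z - u y)).
      replace (256 * r ^ 4 * Rabs (z - u y) ^ 2) with (r ^ 4 * (8 * (2 * Rabs (z - u y))) ^ 2) by ring.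
      apply Rmult_le_compat_l; [apply Rlt_le, pow_lt, Hr|].
      apply pow_incr; split; [apply pow2_ge_0 | exact G]. }
    assert (He3 : 0 < e ^ 3) by (apply pow_lt, He').
    assert (Q : 0 <= K * (z - u y) ^ 2) by (apply Rmult_le_pos; [exact HK | apply pow2_ge_0]).
    destruct (Rle_dec d e) as [L|L]; [lra|].
    apply Rle_trans with (K * (z - u y) ^ 2); [|lra].
    replace (K * (z - u y) ^ 2) with (256 * r ^ 4 * (z - u y) ^ 2 / e ^ 3) by (unfold K; field; lra).
    apply Rmult_le_reg_r with (e ^ 3); [exact He3|].
    replace (256 * r ^ 4 * (z - u y) ^ 2 / e ^ 3 * e ^ 3) with (256 * r ^ 4 * (z - u y) ^ 2)
      by (field; lra).
    eapply Rle_trans; [|exact Hd].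
    replace (d ^ 4) with (d * d ^ 3) by ring.
    apply Rmult_le_compat_l; [lra | apply pow_incr; lra].
Qed.

Lemma area_scal_le beta f g K : 0 < beta -> cont f -> cont g -> (forall p, 0 <= f p <= K * g p) ->
  area beta f <= K ^ 2 * area beta g.
Proof.
  intros Hb Hf Hg H; unfold area; rewrite <- intK_scal by cont_tac.
  apply intK_le; [exact Hb | cont_tac | cont_tac |].
  intros p; rewrite <- Rpow_mult_distr; apply pow_incr, H.
Qed.

Lemma alpha_approx beta c s eps : 0 < beta -> is_profile beta c s -> 0 < eps <= / 4 ->
  exists phi, conf_factor beta phi /\
    alpha_sys beta phi <= (1 + 16 * eps) * alpha_sys beta (phi_beta beta).
Proof.
  intros Hb Hp He; assert (P := PI_RGT_0).
  (* Since [phi_beta >= 1/2], an absolute error [eps / 2] is a relative error of at most [eps]. *)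
  destruct (smooth_approx beta c s (eps / 2) Hb Hp ltac:(lra)) as [phi [Hphi Happ]].
  exists phi; split; [exact Hphi|].
  destruct (conf_factor_cont beta phi Hphi) as [Hf [Hpos _]].
  destruct (phi_beta_invariant beta c s Hb Hp) as [H1 _].
  assert (Hs := sys_pos beta c s phi Hb Hp Hphi).
  assert (B : forall p, (1 - eps) * phi_beta beta p <= phi p <= (1 + eps) * phi_beta beta p).
  { intros p; assert (B := phi_beta_bounds beta c s p Hb Hp).
    specialize (Happ p); apply Rabs_le_between in Happ; nra. }
  assert (S : (1 - eps) * PI <= sys beta phi).
  { rewrite <- (sys_phi_beta beta c s Hb Hp).
    assert (C : sys beta (phi_beta beta) <= / (1 - eps) * sys beta phi).
    { apply sys_compare; auto.
      - intros p; assert (G := phi_beta_bounds beta c s p Hb Hp); lra.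
      - intros p; apply Rlt_le, Hpos.
      - apply Rinv_0_lt_compat; lra.
      - intros p; apply Rmult_le_reg_l with (1 - eps); [lra|].
        rewrite <- Rmult_assoc, Rinv_r, Rmult_1_l by lra; apply B. }
    apply Rmult_le_compat_l with (r := 1 - eps) in C; [|lra].
    rewrite <- Rmult_assoc, Rinv_r, Rmult_1_l in C by lra; exact C. }
  assert (A : area beta phi <= (1 + eps) ^ 2 * area beta (phi_beta beta)).
  { apply area_scal_le; auto; intros p; split; [apply Rlt_le, Hpos | apply B]. }
  assert (HE := phi_beta_norm_pos beta c s Hb Hp).
  unfold alpha_sys; rewrite (sys_phi_beta beta c s Hb Hp).
  rewrite <- area_L2dot in HE; set (E := area beta (phi_beta beta)) in *.
  apply Rle_trans with ((1 + eps) ^ 2 * E / ((1 - eps) * PI) ^ 2).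
  - apply Rmult_le_compat.
    + apply Rle_trans with (intK beta (fun _ => 0)).
      * unfold intK; rewrite (RInt_ext _ (fun _ => (4 * beta - 0) * 0)) by (intros; apply I_const).
        rewrite I_const; lra.
      * apply intK_le; [exact Hb | cont_tac | cont_tac | intros; apply pow2_ge_0].
    + apply Rlt_le, Rinv_0_lt_compat, pow_lt, Hs.
    + exact A.
    + apply Rinv_le_contravar; [apply pow_lt; nra|]; apply pow_incr; split; [nra | exact S].
  - replace ((1 + eps) ^ 2 * E / ((1 - eps) * PI) ^ 2) with
      ((1 + eps) ^ 2 / (1 - eps) ^ 2 * (E / PI ^ 2)) by (field; lra).
    apply Rmult_le_compat_r; [apply Rlt_le, Rdiv_lt_0_compat; nra|].
    assert (0 < (1 - eps) ^ 2) by (apply pow_lt; lra).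
    apply Rmult_le_reg_r with ((1 - eps) ^ 2); [lra|].
    replace ((1 + eps) ^ 2 / (1 - eps) ^ 2 * (1 - eps) ^ 2) with ((1 + eps) ^ 2) by (field; lra).
    (* Four times this product is [(1 + 16 * eps) * (1 - eps) ^ 2 - (1 + eps) ^ 2]. *)
    assert (0 <= eps * ((1 - 2 * eps) * (3 - 2 * eps)))
      by (repeat apply Rmult_le_pos; lra).
    nra.
Qed.

Lemma alpha_sys_C_phi_beta beta c s : 0 < beta -> is_profile beta c s ->
  alpha_sys_C beta = Finite (alpha_sys beta (phi_beta beta)).
Proof.
  intros Hb Hp; apply is_glb_Rbar_unique; split.
  - intros a [phi [Hphi ->]]; simpl.
    assert (St := alpha_stability beta c s phi Hb Hp Hphi).
    destruct (conf_factor_cont beta phi Hphi) as [Hf _].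
    destruct (phi_beta_invariant beta c s Hb Hp) as [H1 _].
    assert (0 <= L2dot beta (fun p => phi p - proj_phi_beta beta phi p)
             (fun p => phi p - proj_phi_beta beta phi p) / (sys beta phi) ^ 2); [|lra].
    apply Rdiv_le_0_compat; [|apply pow_lt, (sys_pos beta c s); assumption].
    apply L2dot_self_ge0; [exact Hb|]; unfold proj_phi_beta; cont_tac.
  - intros b Hlb.
    assert (A0 : 0 < alpha_sys beta (phi_beta beta)).
    { rewrite (alpha_phi_beta beta c s) by assumption.
      apply Rdiv_lt_0_compat; [apply (phi_beta_norm_pos beta c s); assumption | apply pow_lt, PI_RGT_0]. }
    set (a := alpha_sys beta (phi_beta beta)) in *.
    assert (X : forall eps, 0 < eps <= / 4 -> Rbar_le b (Finite ((1 + 16 * eps) * a))).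
    { intros eps He; destruct (alpha_approx beta c s eps Hb Hp He) as [phi [Hphi Hle]].
      eapply Rbar_le_trans; [apply Hlb; exists phi; split; [exact Hphi | reflexivity]|]; exact Hle. }
    destruct b as [r| |]; simpl in *; [|apply (X (/ 4)); lra | exact I].
    apply Rnot_lt_le; intros N.
    (* Then [16 * eps * a] is at most half of [r - a], so the approximation falls below the alleged
       lower bound [r]. *)
    set (eps := Rmin (/ 4) ((r - a) / (32 * a))).
    assert (He : 0 < eps <= / 4).
    { split; [apply Rmin_pos; [lra | apply Rdiv_lt_0_compat; lra] | apply Rmin_l]. }
    specialize (X eps He).
    assert (eps * (32 * a) <= r - a).
    { apply Rle_trans with ((r - a) / (32 * a) * (32 * a)); [|apply Req_le; field; lra].
      apply Rmult_le_compat_r; [lra | apply Rmin_r]. }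
    nra.
Qed.

Theorem theorem2p5 (beta : R) (phi : pt -> R) :
  0 < beta -> conf_factor beta phi ->
  alpha_sys_C beta = Finite (alpha_sys beta (phi_beta beta)) /\
  L2dot beta (fun p => phi p - proj_phi_beta beta phi p)
             (fun p => phi p - proj_phi_beta beta phi p) / (sys beta phi) ^ 2
    <= alpha_sys beta phi - real (alpha_sys_C beta) /\
  (alpha_sys beta phi = real (alpha_sys_C beta) <->
   exists lam : R, 0 < lam /\ forall p, phi p ^ 2 = lam * phi_beta beta p ^ 2).
Proof.
  intros Hb Hphi; destruct (profile_exists beta Hb) as [c [s Hp]].
  assert (EC := alpha_sys_C_phi_beta beta c s Hb Hp).
  assert (St := alpha_stability beta c s phi Hb Hp Hphi).
  destruct (conf_factor_cont beta phi Hphi) as [Hf [Hpos [HA HB]]].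
  destruct (phi_beta_invariant beta c s Hb Hp) as [H1 [H2 H3]].
  assert (Hs := sys_pos beta c s phi Hb Hp Hphi).
  assert (Hbp : forall p, 0 < phi_beta beta p).
  { intros p; assert (B := phi_beta_bounds beta c s p Hb Hp); lra. }
  split; [exact EC|]; rewrite EC; simpl real; split; [exact St|].
  split.
  (* Equality makes the squared norm of the deviation [D] nonpositive; continuity gives [D = 0] on
     the fundamental domain, and invariance everywhere. *)
  - intros Eq; rewrite Eq, Rminus_diag in St.
    set (k := L2dot beta phi (phi_beta beta) / L2dot beta (phi_beta beta) (phi_beta beta)).
    set (D := fun p => phi p - k * phi_beta beta p).
    change (L2dot beta D D / sys beta phi ^ 2 <= 0) in St.
    assert (CD : cont D) by (unfold D; cont_tac).
    assert (N0 := L2dot_self_ge0 beta D Hb CD).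
    assert (N : L2dot beta D D = 0).
    { apply Rle_antisym; [|exact N0].
      apply Rmult_le_reg_r with (/ sys beta phi ^ 2); [apply Rinv_0_lt_compat, pow_lt, Hs|].
      rewrite Rmult_0_l; exact St. }
    assert (Z : forall p, phi p = k * phi_beta beta p).
    { intros p; destruct (fundamental_domain beta p Hb) as [x [y [Hx [Hy E]]]].
      rewrite (E phi HA HB), (E (phi_beta beta) H2 H3).
      assert (Q := intK_eq0 beta (fun p => D p * D p) Hb ltac:(cont_tac)
        ltac:(intros q; nra) N x y Hx Hy).
      cbv beta in Q; apply Rsqr_0_uniq in Q; unfold D in Q; lra. }
    assert (Hk : 0 < k).
    { assert (A := Hpos (0, 0)); rewrite Z in A; assert (B := Hbp (0, 0)); nra. }
    exists (k ^ 2); split; [apply pow_lt, Hk|].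
    intros p; rewrite Z; ring.
  - intros [lam [Hlam E]].
    set (k := sqrt lam); assert (Hk : 0 < k) by (apply sqrt_lt_R0, Hlam).
    assert (Ek : k ^ 2 = lam) by (apply pow2_sqrt; lra).
    assert (Z : forall p, phi p = k * phi_beta beta p).
    { intros p; rewrite <- (sqrt_pow2 (phi p)) by (apply Rlt_le, Hpos).
      rewrite E, sqrt_mult_alt, sqrt_pow2 by (try apply Rlt_le, Hbp; lra); reflexivity. }
    (* Homogeneity of the systole is obtained by comparing in both directions. *)
    assert (S1 : sys beta phi <= k * sys beta (phi_beta beta)).
    { apply sys_compare; auto; intros p; [apply Rlt_le, Hpos | apply Rlt_le, Hbp | rewrite Z; lra]. }
    assert (S2 : sys beta (phi_beta beta) <= / k * sys beta phi).
    { apply sys_compare; auto.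
      - intros p; apply Rlt_le, Hbp.
      - intros p; apply Rlt_le, Hpos.
      - apply Rinv_0_lt_compat, Hk.
      - intros p; rewrite Z, <- Rmult_assoc, Rinv_l; lra. }
    assert (S : sys beta phi = k * sys beta (phi_beta beta)).
    { apply Rle_antisym; [exact S1|].
      apply Rmult_le_compat_l with (r := k) in S2; [|lra].
      rewrite <- Rmult_assoc, Rinv_r, Rmult_1_l in S2 by lra; exact S2. }
    assert (A : area beta phi = k ^ 2 * area beta (phi_beta beta)).
    { unfold area; rewrite <- intK_scal by cont_tac; apply intK_ext; intros p; rewrite Z; ring. }
    unfold alpha_sys; rewrite S, A.
    rewrite (sys_phi_beta beta c s Hb Hp); assert (P := PI_RGT_0); field; lra.
Qed.
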